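(* Suppose that $X$ is a compact fractafold with no boundary and $p\in S^0$ is a symbol with variable coefficients. Then the operator $Tu(x)=p(x,-\Delta)u(x)$ is given by integration with a kernel $K(x,y)$ that is continuous off the diagonal and satisfies the estimate $$|K(x,y)|\lesssim R(x,y)^{-d}.$$
   Context: Fractals. Let $K_0=\bigcup_{i=1}^M F_i(K_0)$ be the self-similar set of contractions $F_1,\dots,F_M$ of Euclidean space; for a word $\omega=\omega_1\cdots\omega_n$ put $F_\omega=F_{\omega_1}\circ\dots\circ F_{\omega_n}$. $K_0$ is post-critically finite (p.c.f.) if there is a subset $V_0$ of the fixed points of the $F_i$ (the boundary) with $F_\omega(K_0)\cap F_{\omega'}(K_0)\subseteq F_\omega(V_0)\cap F_{\omega'}(V_0)$ for all distinct words of equal length; nested fractals are a class of p.c.f. sets. $K_0$ carries a self-similar Dirichlet energy $\mathcal{E}(u)=\sum_i r_i^{-1}\mathcal{E}(u\circ F_i)$, a self-similar probability measure $\mu$, the Laplacian defined weakly by $\Delta u=f$ iff $\mathcal{E}(u,v)=-\int fv\,d\mu$ for all $v\in\operatorname{dom}\mathcal{E}$ vanishing on $V_0$, and the resistance metric $R(x,y)^{-1}=\min\{\mathcal{E}(u):u(x)=0,u(y)=1\}$. A compact fractafold without boundary based on $K_0$ is a finite union of copies of $K_0$ of the same size glued at boundary points so that all boundary points are paired; these structures extend to it. Setting. $X$ is a compact fractafold without boundary based on a self-similar nested fractal. Its measure is doubling, and its heat kernel satisfies $h_t(x,y)\le c_1t^{-d/(d+1)}\exp(-c_2(R(x,y)^{d+1}/t)^\gamma)$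 with positive constants $c_1,c_2,d,\gamma$ and is holomorphic in $t$ on $\{\operatorname{Re}t>0\}$ (with the heat kernel understood modulo the projection onto constants). $\Lambda$ is the spectrum of $-\Delta$, $P_\lambda$ the spectral projection for $\lambda\in\Lambda$ with kernel $P_\lambda(x,y)$, and a function is smooth if it is in the domain of $\Delta^n$ for all $n$. Symbols with variable coefficients. $S^m$ consists of the smooth functions $p:X\times(0,\infty)\to\mathbb{C}$ such that for all $j,k\in\mathbb{N}$ there is $C_{j,k}>0$ with $\left|\left(\lambda\frac{\partial}{\partial\lambda}\right)^k\Delta_x^jp(x,\lambda)\right|\le C_{j,k}(1+\lambda)^{\frac{m}{d+1}}$. For $u$ a finite linear combination of eigenfunctions, $p(x,-\Delta)u(x)=\sum_{\lambda\in\Lambda}\int p(x,\lambda)P_\lambda(x,y)u(y)\,d\mu(y)$. $A\lesssim B$ means $A\le CB$ with $C$ independent of $x,y$. ''Given by integration with a kernel $K$'' means $Tu(x)=\int K(x,y)u(y)\,d\mu(y)$ for a.e. $x\notin\operatorname{supp}u$; ''off the diagonal'' means on $\{(x,y)\in X\times X:x\neq y\}$. *)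

(* Defs.v *)
From HB Require Import structures.
From mathcomp Require Import all_boot all_order all_algebra.
From mathcomp Require Import all_classical all_reals all_analysis.
From mathcomp Require Export finmap.
From mathcomp Require Export complex.

Set Implicit Arguments.
Unset Strict Implicit.
Unset Printing Implicit Defensive.

Import Order.TTheory GRing.Theory Num.Theory.
Import numFieldNormedType.Exports.
Local Open Scope classical_set_scope.
Local Open Scope ring_scope.

Notation borel T := (g_sigma_algebraType (@open T)).

(* The library norm on 'rV[R]_n is the sup norm; similitudes and reflections
   need the Euclidean one.  Both induce the topology of 'rV[R]_n. *)
Definition edot (R : realType) (n : nat) (x y : 'rV[R]_n) : R :=
  \sum_(i < n) x 0 i * y 0 i.

Definition edist (R : realType) (n : nat) (x y : 'rV[R]_n) : R :=
  Num.sqrt (edot (x - y) (x - y)).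

(* Reflection in the hyperplane {z : |z - x| = |z - y|}. *)
Definition reflection (R : realType) (n : nat) (x y z : 'rV[R]_n) : 'rV[R]_n :=
  z - (2 * edot (z - 2^-1 *: (x + y)) (x - y) / edot (x - y) (x - y))
      *: (x - y).

(* F_w = F_{w_1} o ... o F_{w_n}. *)
Definition wordmap (E : Type) (M : nat) (F : 'I_M -> E -> E) (w : seq 'I_M) :
  E -> E := foldr (fun i g => F i \o g) id w.

Definition fixed_points (E : Type) (M : nat) (F : 'I_M -> E -> E) : set E :=
  [set x | exists i, F i x = x].

(* The boundary V_0 of a nested fractal: the essential fixed points. *)
Definition boundary (E : Type) (M : nat) (F : 'I_M -> E -> E) : set E :=
  [set x | fixed_points F x /\
     exists i j y, [/\ i <> j, fixed_points F y & F i x = F j y]].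

Definition cell (E : Type) (M : nat) (F : 'I_M -> E -> E) (w : seq 'I_M) :
  set E := wordmap F w @` boundary F.

(* Lindstrom's nested fractals. *)
Record nested_fractal (R : realType) (n M : nat)
    (F : 'I_M -> 'rV[R]_n -> 'rV[R]_n) (K0 : set 'rV[R]_n) : Prop := {
  nf_similitudes : exists2 rho : R, 0 < rho < 1 &
    forall i x y, edist (F i x) (F i y) = rho * edist x y;
  nf_nonempty : K0 !=set0;
  nf_compact : compact K0;
  nf_selfsimilar : K0 = \bigcup_i (F i @` K0);
  nf_open_set : exists U : set 'rV[R]_n,
    [/\ open U, U !=set0, exists C : R, forall x, U x -> edist x 0 <= C,
        forall i, F i @` U `<=` U
      & forall i j, i <> j -> F i @` U `&` F j @` U = set0];
  nf_boundary : exists x y, [/\ boundary F x, boundary F y & x <> y];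
  nf_connected : forall i j,
    connect (fun k l => `[< cell F [:: k] `&` cell F [:: l] !=set0 >]) i j;
  nf_symmetric : forall x y, boundary F x -> boundary F y -> x <> y ->
    forall w : seq 'I_M,
      (exists2 w' : seq 'I_M, size w' = size w &
         reflection x y @` cell F w = cell F w') /\
      ((exists2 a, cell F w a & edist a x < edist a y) ->
       (exists2 b, cell F w b & edist b y < edist b x) ->
       reflection x y @` cell F w = cell F w);
  nf_nesting : forall w w' : seq 'I_M, size w = size w' -> w <> w' ->
    (wordmap F w @` K0) `&` (wordmap F w' @` K0) = cell F w `&` cell F w'
}.

(* A self-similar Dirichlet energy, presented as a resistance form in the sense
   of Kigami (points have positive capacity, so the domain consists of
   continuous functions): D is the domain, e the bilinear form, r the
   renormalization factors.  Functions on K0 are represented by functions on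
   the ambient space, whose values outside K0 are irrelevant (se_ext). *)
Record self_similar_energy (R : realType) (n M : nat)
    (F : 'I_M -> 'rV[R]_n -> 'rV[R]_n) (K0 : set 'rV[R]_n) (r : 'I_M -> R)
    (D : set ('rV[R]_n -> R))
    (e : ('rV[R]_n -> R) -> ('rV[R]_n -> R) -> R) : Prop := {
  se_ext : forall u v u' : 'rV[R]_n -> R, (forall x, K0 x -> u x = v x) ->
    (D u -> D v) /\ e u u' = e v u';
  se_continuous : forall u, D u -> {within K0, continuous u};
  se_const : D (cst 1);
  se_lin : forall (a : R) u v, D u -> D v -> D (fun x => a * u x + v x);
  se_sym : forall u v, D u -> D v -> e u v = e v u;
  se_bilin : forall (a : R) u v u', D u -> D v -> D u' ->
    e (fun x => a * u x + v x) u' = a * e u u' + e v u';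
  se_ge0 : forall u, D u -> 0 <= e u u;
  se_null : forall u, D u ->
    (e u u = 0 <-> forall x y, K0 x -> K0 y -> u x = u y);
  se_complete : forall u : nat -> 'rV[R]_n -> R, (forall k, D (u k)) ->
    (forall eps : R, 0 < eps -> exists N : nat, forall k l : nat,
       (N <= k)%N -> (N <= l)%N -> e (u k \- u l) (u k \- u l) < eps) ->
    exists2 v, D v & (fun k => e (u k \- v) (u k \- v)) @ \oo --> (0 : R);
  se_separates : forall x y, K0 x -> K0 y -> x <> y ->
    exists2 u, D u & u x <> u y;
  se_resistance : forall x y, K0 x -> K0 y ->
    exists C : R, forall u, D u -> (u x - u y) ^+ 2 <= C * e u u;
  se_markov : forall u, D u ->
    let u' := fun x => Num.min (Num.max (u x) 0) 1 in D u' /\ e u' u' <= e u u;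
  se_factors : forall i, 0 < r i < 1;
  se_dom : forall u, D u <-> forall i, D (u \o F i);
  se_selfsimilar : forall u v, D u -> D v ->
    e u v = \sum_i (r i)^-1 * e (u \o F i) (v \o F i)
}.

Record self_similar_measure (R : realType) (n M : nat)
    (F : 'I_M -> 'rV[R]_n -> 'rV[R]_n) (K0 : set 'rV[R]_n) (w : 'I_M -> R)
    (mu0 : probability (borel 'rV[R]_n) R) : Prop := {
  sm_weights : forall i, 0 < w i;
  sm_support : mu0 K0 = 1%E;
  sm_selfsimilar : forall A : set (borel 'rV[R]_n), measurable A ->
    mu0 A = (\sum_i (w i)%:E * mu0 (F i @^-1` A))%E
}.

(* phi i : K0 -> X is the i-th copy of K0 (only its values on K0 matter).
   The fixed-point-free involution s pairs the boundary points of the N copies,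
   and X is exactly the disjoint union of the copies modulo this pairing; being
   Hausdorff, X carries the quotient topology and is compact.  Connectedness is
   what makes the resistance metric finite. *)
Record compact_fractafold (R : realType) (n M : nat)
    (F : 'I_M -> 'rV[R]_n -> 'rV[R]_n) (K0 : set 'rV[R]_n)
    (X : ptopologicalType) (N : nat) (phi : 'I_N -> 'rV[R]_n -> X) : Prop := {
  cf_hausdorff : hausdorff_space X;
  cf_connected : connected [set: X];
  cf_continuous : forall i, {within K0, continuous (phi i)};
  cf_covers : forall x : X, exists i, exists2 a, K0 a & phi i a = x;
  cf_glued : exists s : 'I_N * 'rV[R]_n -> 'I_N * 'rV[R]_n,
    (forall z, boundary F z.2 -> [/\ boundary F (s z).2, s (s z) = z & s z <> z])
    /\ forall i j a b, K0 a -> K0 b ->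
         (phi i a = phi j b <->
          (i, a) = (j, b) \/ (boundary F a /\ s (i, a) = (j, b)))
}.

Definition fractafold_dom (R : realType) (n N : nat) (X : Type)
    (phi : 'I_N -> 'rV[R]_n -> X) (D0 : set ('rV[R]_n -> R)) : set (X -> R) :=
  [set u : X -> R | forall i, D0 (fun a => u (phi i a))].

Definition fractafold_energy (R : realType) (n N : nat) (X : Type)
    (phi : 'I_N -> 'rV[R]_n -> X)
    (e0 : ('rV[R]_n -> R) -> ('rV[R]_n -> R) -> R) (u v : X -> R) : R :=
  \sum_i e0 (fun a => u (phi i a)) (fun a => v (phi i a)).

Definition fractafold_measure (R : realType) (n N : nat) (X : ptopologicalType)
    (phi : 'I_N -> 'rV[R]_n -> X) (K0 : set 'rV[R]_n)
    (mu0 : probability (borel 'rV[R]_n) R)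
    (mu : {measure set (borel X) -> \bar R}) : Prop :=
  forall A : set (borel X), measurable A ->
    mu A = (\sum_i mu0 (K0 `&` phi i @^-1` A))%E.

(* D and e are the domain and the bilinear form of the energy.  For x = y the
   set below is empty, its inf is 0, and 0^-1 = 0. *)
Definition resistance (R : realType) (X : Type) (D : set (X -> R))
    (e : (X -> R) -> (X -> R) -> R) (x y : X) : R :=
  (inf [set e u u | u in [set u | [/\ D u, u x = 0 & u y = 1]]])^-1.

Definition doubling (R : realType) (X : ptopologicalType)
    (mu : {measure set (borel X) -> \bar R}) (rho : X -> X -> R) : Prop :=
  exists C : R, forall (x : X) (s : R), 0 < s ->
    (mu [set y | (rho x y < 2 * s)%R] <= C%:E * mu [set y | (rho x y < s)%R])%E.

Definition L2 (R : realType) (X : ptopologicalType)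
    (mu : {measure set (borel X) -> \bar R}) : set (X -> R) :=
  [set f | (f : borel X -> R) \in Lfun mu 2%:E].

(* Delta u = f weakly; X has no boundary, so v is arbitrary in dom E. *)
Definition weak_laplacian (R : realType) (X : ptopologicalType)
    (D : set (X -> R)) (e : (X -> R) -> (X -> R) -> R)
    (mu : {measure set (borel X) -> \bar R}) (u f : X -> R) : Prop :=
  [/\ D u, L2 mu f & forall v, D v -> e u v = - \int[mu]_x (f x * v x)].

(* l belongs to the spectrum of -Delta iff (-Delta - l) is not a bijection from
   the domain of Delta onto L2 (bounded invertibility is then automatic, -Delta
   being closed).  -Delta is self-adjoint, so real l suffice. *)
Definition spectrum (R : realType) (X : ptopologicalType)
    (D : set (X -> R)) (e : (X -> R) -> (X -> R) -> R)
    (mu : {measure set (borel X) -> \bar R}) : set R :=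
  [set l | ~ forall f, L2 mu f ->
     exists! u, weak_laplacian D e mu u (fun x => - (l * u x) - f x)].

Definition eigenspace (R : realType) (X : ptopologicalType)
    (D : set (X -> R)) (e : (X -> R) -> (X -> R) -> R)
    (mu : {measure set (borel X) -> \bar R}) (l : R) : set (X -> R) :=
  [set u | weak_laplacian D e mu u (fun x => - (l * u x))].

(* P is the (continuous) kernel of the spectral projection of -Delta at l, that
   is, of the orthogonal projection of L2 onto the eigenspace. *)
Record spectral_projection_kernel (R : realType) (X : ptopologicalType)
    (D : set (X -> R)) (e : (X -> R) -> (X -> R) -> R)
    (mu : {measure set (borel X) -> \bar R}) (l : R) (P : X -> X -> R) : Prop := {
  spk_continuous : continuous (fun z : X * X => P z.1 z.2);
  spk_range : forall f, L2 mu f ->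
    eigenspace D e mu l (fun x => \int[mu]_y (P x y * f y));
  spk_orthogonal : forall f v, L2 mu f -> eigenspace D e mu l v ->
    \int[mu]_x ((f x - \int[mu]_y (P x y * f y)) * v x) = 0
}.

(* The pointwise Laplacian, with continuous values. *)
Definition dom_Delta (R : realType) (X : ptopologicalType)
    (D : set (X -> R)) (e : (X -> R) -> (X -> R) -> R)
    (mu : {measure set (borel X) -> \bar R}) : set (X -> R) :=
  [set u | exists f : X -> R, continuous f /\ weak_laplacian D e mu u f].

Definition Delta (R : realType) (X : ptopologicalType)
    (D : set (X -> R)) (e : (X -> R) -> (X -> R) -> R)
    (mu : {measure set (borel X) -> \bar R}) (u : X -> R) : X -> R :=
  xget (cst 0) [set f : X -> R | continuous f /\ weak_laplacian D e mu u f].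

Notation cabs z := (ComplexField.Normc.normc z).

Definition cRe (R : realType) (T : Type) (f : T -> R[i]) : T -> R :=
  fun x => complex.Re (f x).
Definition cIm (R : realType) (T : Type) (f : T -> R[i]) : T -> R :=
  fun x => complex.Im (f x).

Definition cexp (R : realType) (z : R[i]) : R[i] :=
  (expR (complex.Re z) * cos (complex.Im z)
   +i* (expR (complex.Re z) * sin (complex.Im z)))%C.

Definition cintegral (R : realType) (X : ptopologicalType)
    (mu : {measure set (borel X) -> \bar R}) (f : X -> R[i]) : R[i] :=
  (\int[mu]_x cRe f x +i* \int[mu]_x cIm f x)%C.

Definition cL2 (R : realType) (X : ptopologicalType)
    (mu : {measure set (borel X) -> \bar R}) : set (X -> R[i]) :=
  [set f | L2 mu (cRe f) /\ L2 mu (cIm f)].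

Definition cL2_cvg (R : realType) (X : ptopologicalType)
    (mu : {measure set (borel X) -> \bar R}) (f : nat -> X -> R[i])
    (g : X -> R[i]) : Prop :=
  (fun k => \int[mu]_x (cabs (f k x - g x) ^+ 2)) @ \oo --> (0 : R).

(* Complement of the largest open set on which u vanishes almost everywhere. *)
Definition supp (R : realType) (X : ptopologicalType)
    (mu : {measure set (borel X) -> \bar R}) (u : X -> R[i]) : set X :=
  ~` [set x | exists U : set X, [/\ open U, U x &
        mu.-negligible ([set y | U y /\ u y <> 0] : set (borel X))]].

Definition cDelta (R : realType) (X : ptopologicalType)
    (D : set (X -> R)) (e : (X -> R) -> (X -> R) -> R)
    (mu : {measure set (borel X) -> \bar R}) (u : X -> R[i]) : X -> R[i] :=
  fun x => (Delta D e mu (cRe u) x +i* Delta D e mu (cIm u) x)%C.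

Definition smooth (R : realType) (X : ptopologicalType)
    (D : set (X -> R)) (e : (X -> R) -> (X -> R) -> R)
    (mu : {measure set (borel X) -> \bar R}) (u : X -> R[i]) : Prop :=
  forall k : nat, dom_Delta D e mu (cRe (iter k (cDelta D e mu) u)) /\
                  dom_Delta D e mu (cIm (iter k (cDelta D e mu) u)).

Definition cderivable (R : realType) (f : R -> R[i]) (l : R) : Prop :=
  derivable (cRe f) l 1 /\ derivable (cIm f) l 1.

(* lambda d/dlambda *)
Definition euler (R : realType) (f : R -> R[i]) : R -> R[i] :=
  fun l => (l * derive1 (cRe f) l +i* (l * derive1 (cIm f) l))%C.

Definition has_sum (R : realType) (A : set R) (f : R -> R[i]) (s : R[i]) : Prop :=
  forall eps : R, 0 < eps -> exists2 G : {fset R}, [set` G] `<=` A &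
    forall H : {fset R}, [set` G] `<=` [set` H] -> [set` H] `<=` A ->
      cabs (\sum_(l <- H) f l - s) < eps.

(* The kernel of exp(z Delta), Re z > 0, as a spectral sum; P l is the kernel
   of the spectral projection at l, and L the spectrum. *)
Definition heat_kernel (R : realType) (X : Type) (L : set R)
    (P : R -> X -> X -> R) (h : R[i] -> X -> X -> R[i]) : Prop :=
  forall (z : R[i]) (x y : X), 0 < complex.Re z ->
    has_sum L (fun l => cexp (- z * l%:C%C) * (P l x y)%:C%C) (h z x y).

Definition holomorphic_right_half_plane (R : realType) (g : R[i] -> R[i]) : Prop :=
  forall z : R[i], 0 < complex.Re z ->
    derivable (g : (R[i])^o -> (R[i])^o) (z : (R[i])^o) (1 : (R[i])^o).

Definition heat_bound (R : realType) (c1 c2 d gamma rho t : R) : R :=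
  c1 * t `^ (- (d / (d + 1))) * expR (- (c2 * (rho `^ (d + 1) / t) `^ gamma)).

(* On a compact space the heat kernel tends to that of the projection onto
   constants as t -> oo, so for large t the estimate can only hold modulo that
   projection (P0 is its kernel); as t -> 0 the decay off the diagonal is that
   of the full heat kernel. *)
Definition heat_kernel_estimate (R : realType) (X : Type) (rho : X -> X -> R)
    (P0 : X -> X -> R) (h : R[i] -> X -> X -> R[i]) (c1 c2 d gamma : R) : Prop :=
  forall (t : R) (x y : X),
    (0 < t <= 1 -> cabs (h t%:C%C x y) <= heat_bound c1 c2 d gamma (rho x y) t)
    /\ (1 <= t -> cabs (h t%:C%C x y - (P0 x y)%:C%C)
                  <= heat_bound c1 c2 d gamma (rho x y) t).

(* Symbols live on X x (0, oo); values at l <= 0 are irrelevant. *)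
Record symbol_class (R : realType) (X : ptopologicalType)
    (D : set (X -> R)) (e : (X -> R) -> (X -> R) -> R)
    (mu : {measure set (borel X) -> \bar R}) (d m : R)
    (p : X -> R -> R[i]) : Prop := {
  sc_smooth_space : forall l : R, 0 < l -> smooth D e mu (p ^~ l);
  sc_smooth_spectral : forall (j k : nat) (x : X) (l : R), 0 < l ->
    cderivable (iter k (@euler R) (fun s => iter j (cDelta D e mu) (p ^~ s) x)) l;
  sc_bound : forall j k : nat, exists2 C : R, 0 < C &
    forall (x : X) (l : R), 0 < l ->
      cabs (iter k (@euler R) (fun s => iter j (cDelta D e mu) (p ^~ s) x) l)
        <= C * (1 + l) `^ (m / (d + 1))
}.

Definition eigenspan (R : realType) (X : ptopologicalType)
    (D : set (X -> R)) (e : (X -> R) -> (X -> R) -> R)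
    (mu : {measure set (borel X) -> \bar R}) : set (X -> R[i]) :=
  [set u | exists (k : nat) (c : 'I_k -> R[i]) (l : 'I_k -> R)
                  (v : 'I_k -> X -> R),
     (forall a, eigenspace D e mu (l a) (v a)) /\
     u = fun x => \sum_(a < k) c a * (v a x)%:C%C].

(* p(x, -Delta)u for u in the eigenspan; only finitely many terms are nonzero.
   As p is defined for l > 0 only, the eigenvalue 0 (constants) is left out. *)
Definition symbol_op (R : realType) (X : ptopologicalType)
    (mu : {measure set (borel X) -> \bar R}) (L : set R)
    (P : R -> X -> X -> R) (p : X -> R -> R[i]) (u : X -> R[i]) : X -> R[i] :=
  fun x => \sum_(l \in L `&` [set l | 0 < l])
             cintegral mu (fun y => p x l * (P l x y)%:C%C * u y).

(* The L2-closure of p(x, -Delta) on the eigenspan: w = Tu. *)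
Definition symbol_op_L2 (R : realType) (X : ptopologicalType)
    (D : set (X -> R)) (e : (X -> R) -> (X -> R) -> R)
    (mu : {measure set (borel X) -> \bar R})
    (P : R -> X -> X -> R) (p : X -> R -> R[i]) (u w : X -> R[i]) : Prop :=
  [/\ cL2 mu u, cL2 mu w &
      exists2 v : nat -> X -> R[i], forall k, eigenspan D e mu (v k) &
        cL2_cvg mu v u /\
        cL2_cvg mu (fun k => symbol_op mu (spectrum D e mu) P p (v k)) w].

Definition given_by_kernel (R : realType) (X : ptopologicalType)
    (mu : {measure set (borel X) -> \bar R})
    (T : (X -> R[i]) -> (X -> R[i]) -> Prop) (K : X -> X -> R[i]) : Prop :=
  forall u w, T u w ->
    {ae mu, forall x : borel X, ~ supp mu u x ->
        w x = cintegral mu (fun y => K x y * u y)}.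

Definition continuous_off_diagonal (R : realType) (X : topologicalType)
    (K : X -> X -> R[i]) : Prop :=
  forall z : X * X, z.1 <> z.2 ->
    {for z, continuous (fun z => K z.1 z.2 : (R[i])^o)}.

(* Main.v *)
Require Import Defs.
From HB Require Import structures.
From mathcomp Require Import all_boot all_order all_algebra.
From mathcomp Require Import all_classical all_reals all_analysis.
From mathcomp Require Import measurable_realfun complex ring lra zify.

Set Implicit Arguments.
Unset Strict Implicit.
Unset Printing Implicit Defensive.

Import Order.TTheory GRing.Theory Num.Theory.
Import numFieldNormedType.Exports.
Local Open Scope classical_set_scope.
Local Open Scope ring_scope.

(* Let g be a smoothed low-pass filter, and let K_J be the kernel of the operator
   with symbol p(x, l) g(exp(-l / 2^J)).  The difference of two consecutive K_J
   has a symbol which, as a function of y = exp(-l / 2^J), is well approximated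
   by polynomials in y with controlled coefficients.  Since y^j is the multiplier
   of the heat semigroup at time j / 2^J, the heat kernel estimate for real times
   bounds K_{J+1} - K_J by 2^(J delta) min(1, (2^J R^(d+1))^-1) with
   delta = d / (d + 1).  Summing over J, the K_J converge off the diagonal to a
   kernel K bounded by a multiple of R^(-d).  On the other hand, the operators
   with kernels K_J are uniformly bounded on L^2 (by a Sobolev inequality in the
   x variable of the symbol) and converge to p(x, -Delta) on eigenfunctions;
   off the support of u the pointwise limit, which is the integral against K,
   agrees almost everywhere with the L^2 limit by Fatou's lemma. *)

(** * Approximation by polynomials with controlled coefficients *)

(** A heat bound at real times only allows finite combinations of the multipliers y^j with j >= 1,
    at the cost of the l^1 norm of their coefficients. Approximations of degree about N with error
    N^-q have coefficients of size 3^N, while the heat kernel at times up to about N / s carries the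
    factor exp(-c (s R^(d+1) / N)^gamma). With N about (s R^(d+1))^(1/q) and (q - 1) gamma >= 2 this
    exponent is at least of order N^2 and absorbs 3^N; the error N^-q becomes the factor (s
    R^(d+1))^-1, which is enough to sum over scales because delta < 1. The symbol is controlled only
    through Euler derivatives, so as a function of y its derivatives may blow up at y = 0 and y = 1.
    The filter g is therefore flat at both ends, to an order that depends on gamma alone. It is a
    polynomial in y, and y at scale 2^J is the square of y at scale 2^(J+1), so the difference of
    two filters is a polynomial as well. Tu is known only as an L^2 limit along finite sums of
    eigenfunctions. The L^2 bounds are proved on such sums, uniformly in J, and then passed to the
    limit. *)

Section approximation.
Variable R : realType.
Implicit Types (p q : {poly R}) (x y c : R) (f g : R -> R).

(** Replacing each power y^j by a heat kernel loses all cancellation between the powers, and this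
    norm is the price. *)
Definition coef_norm p : R := \sum_(i < size p) `|p`_i|.

Lemma coef_normE p n : (size p <= n)%N -> coef_norm p = \sum_(i < n) `|p`_i|.
Proof.
move=> pn; rewrite /coef_norm (big_ord_widen _ (fun i => `|p`_i|) pn).
rewrite big_mkcond; apply: eq_bigr => i _; case: ltnP => // h.
by rewrite nth_default// normr0.
Qed.

Lemma coef_norm_ge0 p : 0 <= coef_norm p.
Proof. by apply: sumr_ge0. Qed.

Lemma coef_norm0 : coef_norm 0 = 0.
Proof. by rewrite /coef_norm size_poly0 big_ord0. Qed.

Lemma coef_normD p q : coef_norm (p + q) <= coef_norm p + coef_norm q.
Proof.
pose n := maxn (size p) (size q).
rewrite (@coef_normE p n) ?leq_maxl// (@coef_normE q n) ?leq_maxr//.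
rewrite (@coef_normE (p + q) n) ?size_polyD// -big_split/=.
by apply: ler_sum => i _; rewrite coefD ler_normD.
Qed.

Lemma coef_normZ c p : coef_norm (c *: p) = `|c| * coef_norm p.
Proof.
rewrite (@coef_normE (c *: p) (size p)) ?size_scale_leq// mulr_sumr.
by apply: eq_bigr => i _; rewrite coefZ normrM.
Qed.

Lemma coef_normC c : coef_norm c%:P = `|c|.
Proof.
by rewrite (@coef_normE _ 1) ?size_polyC_leq1// big_ord1 coefC eqxx.
Qed.

Lemma coef_normMX p : coef_norm (p * 'X) = coef_norm p.
Proof.
rewrite (@coef_normE _ (size p).+1); last first.
  by have [->|/size_mulX->//] := eqVneq p 0; rewrite mul0r size_poly0.
rewrite big_ord_recl coefMX/= normr0 add0r.
by apply: eq_bigr => i _; rewrite coefMX.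
Qed.

Lemma coef_norm_sum (I : Type) (r : seq I) (F : I -> {poly R}) :
  coef_norm (\sum_(i <- r) F i) <= \sum_(i <- r) coef_norm (F i).
Proof.
elim/big_rec2: _ => [|i a p _ h]; first by rewrite coef_norm0.
by apply: (le_trans (coef_normD _ _)); rewrite lerD2l.
Qed.

Lemma coef_normM p q : coef_norm (p * q) <= coef_norm p * coef_norm q.
Proof.
elim/poly_ind: p => [|p c ih]; first by rewrite mul0r coef_norm0 mul0r.
have -> : coef_norm (p * 'X + c%:P) = coef_norm p + `|c|.
  rewrite (@coef_normE _ (size p).+1); last first.
    by rewrite size_MXaddC; case: ifP.
  rewrite big_ord_recl coefD coefMX/= add0r coefC eqxx addrC; congr (_ + _).
  by apply: eq_bigr => i _; rewrite coefD coefMX coefC/= addr0.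
rewrite mulrDl (le_trans (coef_normD _ _))// mulrDl lerD//.
  by rewrite mulrAC coef_normMX.
by rewrite mul_polyC coef_normZ.
Qed.

Lemma coef_normX p n : coef_norm (p ^+ n) <= coef_norm p ^+ n.
Proof.
elim: n => [|n ih]; first by rewrite !expr0 coef_normC normr1.
rewrite !exprS (le_trans (coef_normM _ _))//.
by rewrite ler_wpM2l// coef_norm_ge0.
Qed.

(** At index 0 the division by zero gives 0, so this is the primitive that vanishes at 0. *)
Definition primitive p : {poly R} := \poly_(i < (size p).+1) (p`_i.-1 / i%:R).

Lemma deriv_primitive p : (primitive p)^`() = p.
Proof.
apply/polyP => i; rewrite coef_deriv coef_poly/= ltnS.
case: ltnP => h; last by rewrite nth_default// mul0rn.
by rewrite -[LHS]mulr_natr divfK// pnatr_eq0.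
Qed.

Lemma size_primitive p : (size (primitive p) <= (size p).+1)%N.
Proof. exact: size_poly. Qed.

Lemma coef_norm_primitive p : coef_norm (primitive p) <= coef_norm p.
Proof.
rewrite (coef_normE (size_primitive p)) big_ord_recl coef_poly/= invr0 mulr0.
rewrite normr0 add0r; apply: ler_sum => i _.
rewrite coef_poly ltnS ltn_ord/= normrM ler_piMr//.
by rewrite ger0_norm// invf_le1 ?ltr0n// ler1n.
Qed.

Lemma horner_coef_norm p x : 0 <= x <= 1 -> `|p.[x]| <= coef_norm p.
Proof.
move=> /andP[x0 x1]; rewrite horner_coef (le_trans (ler_norm_sum _ _ _))//.
apply: ler_sum => i _; rewrite normrM ler_piMr//.
by rewrite normrX ger0_norm// exprn_ile1.
Qed.

(** One bound for f and its first k derivatives, the derivatives being witnesses. The interval is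
    open because the functions of interest contain [ln y] and its inverse, singular at 0 and 1. *)
Fixpoint bounded_jet (k : nat) (A : R) f : Prop :=
  (forall y, 0 < y < 1 -> `|f y| <= A) /\
  if k is j.+1 then
    exists2 g, (forall y, 0 < y < 1 -> is_derive y 1 f (g y)) & bounded_jet j A g
  else True.

Lemma bounded_jet_bound k A f y : bounded_jet k A f -> 0 < y < 1 -> `|f y| <= A.
Proof. by case: k => [[+ _]|k [+ _]]; exact. Qed.

Lemma bounded_jetW k A B f : A <= B -> bounded_jet k A f -> bounded_jet k B f.
Proof.
move=> AB; elim: k f => [|k ih] f [fA h]; split => //.
- by move=> y /fA; move/le_trans; exact.
- by move=> y /fA; move/le_trans; exact.
- by case: h => g fg gA; exists g => //; exact: ih.
Qed.

Lemma bounded_jet_ext k A f g : (forall y, 0 < y < 1 -> f y = g y) ->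
  bounded_jet k A f -> bounded_jet k A g.
Proof.
move=> fg; case: k => [[fA _]|k [fA [h fh hA]]]; split => //.
- by move=> y /[dup] /fg <- /fA.
- by move=> y /[dup] /fg <- /fA.
exists h => // y y01; apply: (near_eq_is_derive (f := f)); last exact: fh.
near=> z; apply: fg; apply/andP; split; near: z.
- by apply: lt_nbhsr; case/andP: y01.
- by apply: lt_nbhsl; case/andP: y01.
Unshelve. all: by end_near. Qed.

Lemma bounded_jet0 k : bounded_jet k 0 (cst 0).
Proof.
elim: k => [|k ih]; split => //.
- by move=> y _ /=; rewrite normr0.
- by move=> y _ /=; rewrite normr0.
- by exists (cst 0) => // y _; exact: is_derive_cst.
Qed.

Lemma bounded_jetD k A B f g : bounded_jet k A f -> bounded_jet k B g ->
  bounded_jet k (A + B) (f \+ g).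
Proof.
elim: k f g => [|k ih] f g [fA hf] [gB hg]; split => //.
- by move=> y y01; rewrite (le_trans (ler_normD _ _))// lerD ?fA ?gB.
- by move=> y y01; rewrite (le_trans (ler_normD _ _))// lerD ?fA ?gB.
case: hf => f' ff' jf'; case: hg => g' gg' jg'.
exists (f' \+ g'); last exact: ih.
by move=> y y01; have := ff' _ y01; have := gg' _ y01 => *; exact: is_deriveD.
Qed.

Lemma bounded_jetZ k A c f : bounded_jet k A f ->
  bounded_jet k (`|c| * A) (fun y => c * f y).
Proof.
elim: k f => [|k ih] f [fA hf]; split => //.
- by move=> y y01; rewrite normrM ler_wpM2l// fA.
- by move=> y y01; rewrite normrM ler_wpM2l// fA.
case: hf => f' ff' jf'; exists (fun y => c * f' y); last exact: ih.
by move=> y y01; have := ff' _ y01 => *; exact: is_deriveZ.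
Qed.

Lemma bounded_jet_sum k (I : Type) (r : seq I) (A : I -> R) (f : I -> R -> R) :
  (forall i, bounded_jet k (A i) (f i)) ->
  bounded_jet k (\sum_(i <- r) A i) (fun y => \sum_(i <- r) f i y).
Proof.
move=> h; elim: r => [|i r ih].
  by rewrite big_nil; apply: bounded_jet_ext (bounded_jet0 k) => y _; rewrite big_nil.
rewrite big_cons; apply: bounded_jet_ext (bounded_jetD (h i) ih) => y _.
by rewrite big_cons.
Qed.

Lemma derive_le_dist (B : R) f g x y : 0 < x < 1 -> 0 < y < 1 ->
  (forall z, Num.min x y <= z <= Num.max x y -> is_derive z 1 f (g z)) ->
  (forall z, Num.min x y <= z <= Num.max x y -> `|g z| <= B) ->
  `|f y - f x| <= B * `|y - x|.
Proof.
move=> x01 y01.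
wlog xy : x y x01 y01 / x <= y.
  move=> wl fg gB; have [xy|/ltW yx] := leP x y; first exact: wl.
  by rewrite distrC [X in _ * X]distrC; apply: wl => // z; rewrite minC maxC => ?;
    [exact: fg|exact: gB].
rewrite min_l// max_r// => fg gB.
have [] := @MVT_segment R f g x y xy.
- move=> z; rewrite in_itv/= => /andP[xz zy].
  by apply: fg; rewrite !ltW.
- apply: derivable_within_continuous => z; rewrite in_itv/= => zxy.
  by have := fg _ zxy => ?; exact: ex_derive.
move=> z; rewrite in_itv/= => zxy ->.
by rewrite normrM ler_wpM2r// gB.
Qed.

(** Induction on the order: the polynomial for f' is integrated and its constant adjusted so that
    the error vanishes at c; the mean value theorem then gives one more factor |y - c|. Each order
    multiplies the coefficient bound by 3: one share for the primitive, one for its value at c, one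
    for f(c). *)
Lemma taylor_poly k A f c : 0 < c < 1 -> bounded_jet k A f ->
  exists Q : {poly R}, [/\ (size Q <= k)%N, coef_norm Q <= A * 3 ^+ k &
    forall y, 0 < y < 1 -> `|f y - Q.[y]| <= A * `|y - c| ^+ k].
Proof.
move=> c01; elim: k f => [|k ih] f hf.
  have A0 : 0 <= A by rewrite (le_trans _ (bounded_jet_bound hf c01)).
  exists 0; split => [||y y01]; first by rewrite size_poly0.
    by rewrite coef_norm0 mulr_ge0.
  by rewrite horner0 subr0 expr0 mulr1 (bounded_jet_bound hf).
have fA := bounded_jet_bound hf.
have A0 : 0 <= A by rewrite (le_trans _ (fA _ c01)).
case: hf => _ [g fg /ih[Q [sQ nQ hQ]]].
pose S := primitive Q; pose T := S + (f c - S.[c])%:P.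
exists T; split.
- rewrite (leq_trans (size_polyD _ _))// geq_max; apply/andP; split.
    by rewrite (leq_trans (size_primitive _)).
  by rewrite (leq_trans (size_polyC_leq1 _)).
- rewrite (le_trans (coef_normD _ _))// coef_normC.
  have nS : coef_norm S <= A * 3 ^+ k.
    exact: le_trans (coef_norm_primitive Q) nQ.
  have : `|f c - S.[c]| <= A + A * 3 ^+ k.
    rewrite (le_trans (ler_normB _ _))// lerD ?fA//.
    by rewrite (le_trans _ nS)// horner_coef_norm//; case/andP: c01 => *; rewrite !ltW.
  move=> h; rewrite (le_trans (lerD nS h))// exprS.
  have : A <= A * 3 ^+ k by rewrite ler_peMr// exprn_ege1// ler1n.
  lra.
- move=> y y01; have -> : f y - T.[y] =
      (fun z => f z - T.[z]) y - (fun z => f z - T.[z]) c.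
    by rewrite /T !hornerE/=; ring.
  rewrite exprSr mulrA.
  have in01 z : Num.min c y <= z <= Num.max c y -> 0 < z < 1.
    move=> /andP[cz zy]; case/andP: c01 y01 => c0 c1 /andP[y0 y1].
    by rewrite (lt_le_trans _ cz) ?lt_min ?c0// (le_lt_trans zy)// gt_max c1.
  apply: (@derive_le_dist _ (fun z => f z - T.[z]) (fun z => g z - Q.[z])) => // z zcy.
    have z01 := in01 _ zcy.
    have -> : Q.[z] = T^`().[z] by rewrite derivD derivC addr0 deriv_primitive.
    by have := fg _ z01 => ?; apply: is_deriveB; exact: is_derive_poly.
  rewrite (le_trans (hQ _ (in01 _ zcy)))// ler_wpM2l// lerXn2r ?nnegrE//.
  case/andP: zcy; have [cy|yc] := leP c y => cz zy.
    by rewrite !ger0_norm ?subr_ge0// lerB.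
  by rewrite !ler0_norm ?subr_le0 ?(ltW yc)// lerN2 lerB.
Qed.

End approximation.

(** * Bernstein polynomials and the moments of the binomial law *)

Section bernstein.
Variable R : realType.
Implicit Types (t x y A : R) (f : R -> R) (N i q : nat).

Definition bern N i y : R := 'C(N, i)%:R * (y ^+ i * (1 - y) ^+ (N - i)).

Lemma bern_ge0 N i y : 0 <= y <= 1 -> 0 <= bern N i y.
Proof.
by move=> /andP[y0 y1]; rewrite mulr_ge0// mulr_ge0// exprn_ge0// subr_ge0.
Qed.

Lemma bern_mgf N t y : \sum_(i < N.+1) bern N i y * expR (t * (i%:R - N%:R * y)) =
  ((1 - y) * expR (- (t * y)) + y * expR (t * (1 - y))) ^+ N.
Proof.
rewrite exprDn; apply: eq_bigr => i _; rewrite /bern -[RHS]mulr_natl -!mulrA.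
congr (_ * _); rewrite !exprMn -!expRM_natl.
have iN : (i <= N)%N by rewrite -ltnS.
have -> : t * (i%:R - N%:R * y) = (N - i)%:R * - (t * y) + i%:R * (t * (1 - y)).
  by rewrite natrB//; ring.
by rewrite expRD; ring.
Qed.

Lemma bern_sum N y : \sum_(i < N.+1) bern N i y = 1.
Proof.
have := bern_mgf N 0 y; rewrite !mul0r oppr0 expR0 !mulr1 subrK expr1n => <-.
by apply: eq_bigr => i _; rewrite mul0r expR0 mulr1.
Qed.

Lemma expR_le_quad x : `|x| <= 2^-1 -> expR x <= 1 + x + 2 * x ^+ 2.
Proof.
rewrite ler_norml => /andP[x1 x2].
have h : 1 - x <= (expR x)^-1 by rewrite -expRN expR_ge1Dx.
have x3 : 0 < 1 - x by lra.
have : expR x <= (1 - x)^-1 by rewrite -[expR x]invrK lef_pV2 ?posrE ?invr_gt0 ?expR_gt0.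
move/le_trans; apply; rewrite -div1r ler_pdivrMr//.
have : 0 <= x ^+ 2 * (1 - 2 * x) by rewrite mulr_ge0 ?sqr_ge0//; lra.
by nra.
Qed.

(** The binomial law is centred here: the terms of first order in t cancel between the two
    exponentials, and each factor is at most 1 + 2 t^2, hence a Gaussian bound for the N-th
    power. *)
Lemma bern_mgf_le N t y : 0 <= y <= 1 -> `|t| <= 2^-1 ->
  \sum_(i < N.+1) bern N i y * expR (t * (i%:R - N%:R * y)) <=
  expR (2 * t ^+ 2 * N%:R).
Proof.
move=> /andP[y0 y1] t2; rewrite bern_mgf expRM_natr.
have h1 : `|t * y| <= 2^-1.
  by rewrite normrM (le_trans _ t2)// ler_piMr// ger0_norm.
have h2 : `|t * (1 - y)| <= 2^-1.
  by rewrite normrM (le_trans _ t2)// ler_piMr// ger0_norm; lra.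
apply: lerXn2r; rewrite ?nnegrE ?expR_ge0//.
  by rewrite addr_ge0// mulr_ge0 ?expR_ge0//; lra.
have e1 : expR (- (t * y)) <= 1 + - (t * y) + 2 * (- (t * y)) ^+ 2.
  by rewrite expR_le_quad// normrN.
have e2 := expR_le_quad h2.
have e3 : 1 + 2 * t ^+ 2 <= expR (2 * t ^+ 2) by exact: expR_ge1Dx.
apply: le_trans e3.
have yy : 0 <= 1 - y by lra.
apply: (le_trans (lerD (ler_wpM2l yy e1) (ler_wpM2l y0 e2))).
have -> : (1 - y) * (1 + - (t * y) + 2 * (- (t * y)) ^+ 2) +
    y * (1 + t * (1 - y) + 2 * (t * (1 - y)) ^+ 2) =
  1 + 2 * t ^+ 2 * (y * (1 - y)) by ring.
rewrite lerD2l ler_piMr//; first by rewrite mulr_ge0 ?sqr_ge0.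
by nra.
Qed.

Lemma expr_le_expR (k : nat) x : 0 <= x -> x ^+ k <= k%:R ^+ k * expR x.
Proof.
case: k => [|k] x0; first by rewrite !expr0 mul1r (le_trans _ (expR_ge1Dx _))// lerDl.
have -> : expR x = expR (x / k.+1%:R) ^+ k.+1.
  by rewrite -expRM_natr divfK// pnatr_eq0.
rewrite -exprMn; apply: lerXn2r; rewrite ?nnegrE// ?mulr_ge0 ?expR_ge0//.
rewrite -ler_pdivrMl ?ltr0n// mulrC (le_trans _ (expR_ge1Dx _))//.
by rewrite lerDr.
Qed.

(** Powers are dominated by exponentials: for z = t (i - N y), |z|^(2q) is at most (2q)^(2q) (e^z +
    e^-z). The choice t = 1 / (2 sqrt N) gives |y - i/N|^2 = 4 z^2 / N and 2 t^2 N = 1/2, so the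
    exponential moments stay bounded in N. *)
Lemma bern_moment q N y : (0 < N)%N -> 0 <= y <= 1 ->
  \sum_(i < N.+1) bern N i y * `|y - i%:R / N%:R| ^+ (2 * q) <=
  2 * expR 2^-1 * 4 ^+ q * (2 * q)%:R ^+ (2 * q) / N%:R ^+ q.
Proof.
move=> N0 y01; pose t : R := (2 * Num.sqrt N%:R)^-1.
have Np : 0 < N%:R :> R by rewrite ltr0n.
have N1 : 1 <= N%:R :> R by rewrite ler1n.
have s0 : 0 < Num.sqrt N%:R :> R by rewrite sqrtr_gt0.
have s1 : 1 <= Num.sqrt N%:R :> R by rewrite -[leLHS]sqrtr1 ler_wsqrtr.
have t0 : 0 < t by rewrite invr_gt0 mulr_gt0.
have t2 : t ^+ 2 = (4 * N%:R)^-1.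
  by rewrite exprVn exprMn sqr_sqrtr ?ltW//; congr (_ * _)^-1; ring.
have th : `|t| <= 2^-1.
  by rewrite gtr0_norm// lef_pV2 ?posrE//; lra.
have tN : 2 * t ^+ 2 * N%:R = 2^-1 by rewrite t2; field; rewrite gt_eqF.
pose z (i : nat) := t * (i%:R - N%:R * y).
have key (i : nat) : `|y - i%:R / N%:R| ^+ (2 * q) <=
    4 ^+ q * (2 * q)%:R ^+ (2 * q) / N%:R ^+ q * (expR (z i) + expR (- z i)).
  have -> : `|y - i%:R / N%:R| ^+ (2 * q) = 4 ^+ q / N%:R ^+ q * `|z i| ^+ (2 * q).
    rewrite !exprM !real_normK ?num_real// -exprVn -!exprMn; congr (_ ^+ _).
    by rewrite /z exprMn t2; field; rewrite gt_eqF.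
  rewrite [X in _ <= X](_ : _ = 4 ^+ q / N%:R ^+ q *
    ((2 * q)%:R ^+ (2 * q) * (expR (z i) + expR (- z i)))); last by ring.
  rewrite ler_wpM2l ?divr_ge0 ?exprn_ge0// (le_trans (expr_le_expR _ (normr_ge0 _)))//.
  rewrite ler_wpM2l ?exprn_ge0//.
  by case: (ger0P (z i)) => _; rewrite ?lerDl ?lerDr expR_ge0.
apply: (@le_trans _ _ (\sum_(i < N.+1) (bern N i y *
   (4 ^+ q * (2 * q)%:R ^+ (2 * q) / N%:R ^+ q * (expR (z i) + expR (- z i)))))).
  by apply: ler_sum => i _; rewrite ler_wpM2l// bern_ge0.
have -> : \sum_(i < N.+1) (bern N i y *
   (4 ^+ q * (2 * q)%:R ^+ (2 * q) / N%:R ^+ q * (expR (z i) + expR (- z i)))) =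
   4 ^+ q * (2 * q)%:R ^+ (2 * q) / N%:R ^+ q *
   (\sum_(i < N.+1) bern N i y * expR (t * (i%:R - N%:R * y)) +
    \sum_(i < N.+1) bern N i y * expR (- t * (i%:R - N%:R * y))).
  rewrite -big_split/= mulr_sumr; apply: eq_bigr => i _.
  by rewrite /z mulNr; ring.
rewrite [leRHS](_ : _ = 4 ^+ q * (2 * q)%:R ^+ (2 * q) / N%:R ^+ q *
   (expR 2^-1 + expR 2^-1)); last by ring.
apply: ler_wpM2l; first by rewrite divr_ge0 ?mulr_ge0 ?exprn_ge0.
apply: lerD.
- by rewrite -[X in _ <= expR X]tN bern_mgf_le.
- by rewrite -[X in _ <= expR X]tN -sqrrN bern_mgf_le// normrN.
Qed.

Definition bern_poly N i : {poly R} := 'C(N, i)%:R *: ('X ^+ i * (1 - 'X) ^+ (N - i)).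

Lemma horner_bern_poly N i y : (bern_poly N i).[y] = bern N i y.
Proof. by rewrite /bern_poly /bern !hornerE. Qed.

Lemma size_bern_poly N i : (i <= N)%N -> (size (bern_poly N i) <= N.+1)%N.
Proof.
move=> iN; rewrite (leq_trans (size_scale_leq _ _))//.
have s1 : size (1 - 'X : {poly R}) = 2%N by rewrite -opprB size_polyN -polyC1 size_XsubC.
rewrite (leq_trans (size_polyMleq _ _))// size_polyXn.
have := @size_poly_exp_leq _ (1 - 'X : {poly R}) (N - i); rewrite s1 mul1n => h.
by rewrite addSn/= (leq_trans (leq_add (leqnn i) h))// addnS subnKC.
Qed.

Lemma coef_norm_bern_poly N i : coef_norm (bern_poly N i) <= 'C(N, i)%:R * 2 ^+ (N - i).
Proof.
rewrite coef_normZ ger0_norm// ler_wpM2l//.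
rewrite mulrC; elim: i (N - i)%N => [|i ih] j; last by rewrite exprSr mulrA coef_normMX.
rewrite expr0 mulr1 (le_trans (coef_normX _ _))// lerXn2r ?nnegrE ?coef_norm_ge0//.
have -> : 1 - 'X = -1 *: 'X + 1%:P :> {poly R} by rewrite scaleN1r addrC.
rewrite (le_trans (coef_normD _ _))// coef_normC coef_normZ -['X]mul1r.
by rewrite coef_normMX -polyC1 coef_normC normrN !normr1 mulr1.
Qed.

(** The base 3 is 2 + 1: the coefficients of (1 - X)^(N - i) have total size at most 2^(N - i), and
    the binomial theorem sums these. *)
Lemma sum_coef_norm_bern_poly N : \sum_(i < N.+1) coef_norm (bern_poly N i) <= 3 ^+ N.
Proof.
have -> : 3 ^+ N = (2 + 1) ^+ N :> R by congr (_ ^+ _); ring.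
rewrite exprDn; apply: ler_sum => i _.
by rewrite (le_trans (coef_norm_bern_poly _ _))// expr1n mulr1 -[leRHS]mulr_natl.
Qed.

(* Bernstein's operator applied to local Taylor polynomials instead of values:
   the error is N^-q for 2q derivatives, and the coefficients grow only
   exponentially in N. *)
Lemma bernstein_taylor q : (0 < q)%N -> exists2 C : R, 0 < C &
  forall N A f, (0 < N)%N -> 0 <= A -> bounded_jet (2 * q) A f ->
    (forall y, 0 < y <= 1 -> `|f y| <= A * (y ^+ (2 * q) * (1 - y) ^+ (2 * q))) ->
    exists Q : {poly R}, [/\ (size Q <= N + (2 * q).+1)%N,
      coef_norm Q <= A * C * 3 ^+ N &
      forall y, 0 < y <= 1 -> `|f y - Q.[y]| <= A * C / N%:R ^+ q].
Proof.
move=> q0; pose C1 : R := 2 * expR 2^-1 * 4 ^+ q * (2 * q)%:R ^+ (2 * q).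
have C10 : 0 <= C1 by rewrite !mulr_ge0 ?expR_ge0 ?exprn_ge0.
exists (C1 + 3 ^+ (2 * q)); first by rewrite ltr_wpDl// exprn_gt0.
move=> N A f N0 A0 jf fA.
have Np : 0 < N%:R :> R by rewrite ltr0n.
(* The nodes of i = 0 and i = N lie outside the open interval where f has derivatives. There the
   zero polynomial serves, since the flatness of f is a Taylor bound at 0 and at 1. Taking T = 0 at
   i = N also makes Q exact at y = 1, where only the last Bernstein weight is nonzero. *)
have /choice[T hT] : forall i : 'I_N.+1, exists T : {poly R},
    [/\ (size T <= 2 * q)%N, coef_norm T <= A * 3 ^+ (2 * q),
     forall y, 0 < y < 1 -> `|f y - T.[y]| <= A * `|y - i%:R / N%:R| ^+ (2 * q) &
     (i = N :> nat) -> T = 0].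
  move=> i; have [->|i0] := eqVneq (i : nat) 0%N; [|have [iN|iN] := eqVneq (i : nat) N].
  - exists 0; split => //; first by rewrite size_poly0.
      by rewrite coef_norm0 mulr_ge0.
    move=> y y01; rewrite mul0r subr0 horner0 subr0.
    case/andP: y01 => y0 y1; rewrite (le_trans (fA _ _)) ?y0 ?(ltW y1)//.
    rewrite (ger0_norm (ltW y0)) ler_wpM2l// ler_piMr ?exprn_ge0 ?(ltW y0)//.
    by rewrite exprn_ile1//; lra.
  - exists 0; split => //; first by rewrite size_poly0.
      by rewrite coef_norm0 mulr_ge0.
    move=> y y01; rewrite iN divff ?gt_eqF// horner0 subr0.
    case/andP: y01 => y0 y1; rewrite (le_trans (fA _ _)) ?y0 ?(ltW y1)//.
    rewrite distrC ger0_norm ?subr_ge0 ?(ltW y1)// ler_wpM2l// ler_piMl//.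
      by rewrite exprn_ge0// subr_ge0 ltW.
    by rewrite exprn_ile1// ltW.
  - have c01 : 0 < (i%:R / N%:R : R) < 1.
      apply/andP; split; first by rewrite divr_gt0// ltr0n lt0n.
      by rewrite ltr_pdivrMr// mul1r ltr_nat ltn_neqAle iN -ltnS ltn_ord.
    have [Q [sQ nQ hQ]] := taylor_poly c01 jf.
    by exists Q; split => // /eqP; rewrite (negbTE iN).
pose Q := \sum_(i < N.+1) T i * bern_poly N i.
exists Q; split.
- rewrite (leq_trans (size_sum _ _ _))//; apply/bigmax_leqP => i _.
  rewrite (leq_trans (size_polyMleq _ _))//; case: (hT i) => sT _ _ _.
  have sb := size_bern_poly (ltn_ord i : i <= N)%N.
  by rewrite -ltnS (leq_ltn_trans (leq_pred _))// ltnS; lia.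
- rewrite (le_trans (coef_norm_sum _ _))//.
  apply: (@le_trans _ _ (\sum_(i < N.+1) A * 3 ^+ (2 * q) * coef_norm (bern_poly N i))).
    apply: ler_sum => i _; rewrite (le_trans (coef_normM _ _))//.
    by rewrite ler_wpM2r ?coef_norm_ge0//; case: (hT i).
  rewrite -mulr_sumr; apply: ler_pM => //.
  + by rewrite mulr_ge0.
  + by rewrite sumr_ge0// => i _; exact: coef_norm_ge0.
  + by rewrite ler_wpM2l// lerDr.
  + exact: sum_coef_norm_bern_poly.
- move=> y /andP[y0]; rewrite le_eqVlt => /predU1P[->|y1].
    have -> : f 1 = 0.
      apply/eqP; rewrite -normr_le0 (le_trans (fA _ _)) ?ltr01 ?lexx//.
      by rewrite subrr expr0n muln_eq0/= gtn_eqF// !mulr0.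
    have -> : Q.[1] = 0.
      rewrite horner_sum big1// => i _; rewrite hornerM horner_bern_poly /bern.
      have [iN|iN] := eqVneq (i : nat) N.
        by case: (hT i) => _ _ _ ->//; rewrite horner0 mul0r.
      rewrite subrr expr0n subn_eq0 leqNgt ltn_neqAle iN/= -ltnS ltn_ord/=.
      by rewrite !mulr0.
    by rewrite subrr normr0 !mulr_ge0 ?addr_ge0 ?invr_ge0 ?exprn_ge0// ?ltW.
  have y01 : 0 <= y <= 1 by rewrite !ltW.
  have -> : f y - Q.[y] = \sum_(i < N.+1) bern N i y * (f y - (T i).[y]).
    rewrite horner_sum -[f y in LHS]mul1r -(bern_sum N y) mulr_suml -sumrB.
    by apply: eq_bigr => i _; rewrite hornerM horner_bern_poly; ring.
  rewrite (le_trans (ler_norm_sum _ _ _))//.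
  apply: (@le_trans _ _ (\sum_(i < N.+1)
      A * (bern N i y * `|y - i%:R / N%:R| ^+ (2 * q)))).
    apply: ler_sum => i _; rewrite normrM ger0_norm ?bern_ge0// mulrCA.
    rewrite ler_wpM2l ?bern_ge0//; case: (hT i) => _ _ + _; apply.
    by rewrite y0.
  rewrite -mulr_sumr -mulrA ler_wpM2l// (le_trans (bern_moment _ _ _))//.
  by rewrite ler_wpM2r ?invr_ge0 ?exprn_ge0// lerDl.
Qed.

End bernstein.

(** * The symbol as a function of y = exp(-l / s), and the low-pass filter *)

Section symbol_jets.
Variable R : realType.
Implicit Types (E : nat -> R -> R) (s y l B : R) (i j k a b : nat).

(* E i stands for the i-th iterate of the Euler operator applied to E 0. *)
Definition euler_jet E := forall i l, 0 < l -> is_derive l 1 (E i) (E i.+1 l / l).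

(** A family closed under d/dy up to linear combinations: the derivative of E_i(-s ln y) is
    E_(i+1)(-s ln y) / (y ln y), in which s has cancelled. Each derivative costs at most one power
    of y, and one power of 1 / ln y or of 1 - y. The exponents a and b are the reserves for this, as
    |ln y| >= 1 - y. *)
Definition jet_monomial E s i j a b y : R :=
  E i (- s * ln y) * ((ln y)^-1 ^+ j * (y ^+ a * (1 - y) ^+ b)).

Lemma ln_le_sub1 y : 0 < y -> ln y <= y - 1.
Proof.
by move=> y0; have := expR_ge1Dx (ln y); rewrite lnK ?posrE//; lra.
Qed.

Lemma inv_ln_bound y : 0 < y < 1 -> `|(ln y)^-1| * (1 - y) <= 1.
Proof.
move=> /andP[y0 y1]; have l0 := ln_le_sub1 y0.
have ly : ln y < 0 by lra.
rewrite normrV ?unitfE ?lt_eqF// ltr0_norm// ler_pdivrMl ?oppr_gt0//; lra.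
Qed.

Lemma is_derive_jet_monomial E s i j a b y : euler_jet E -> 0 < s -> 0 < y < 1 ->
  is_derive y 1 (jet_monomial E s i j a.+1 b.+1)
    (jet_monomial E s i.+1 j.+1 a b.+1 y - j%:R * jet_monomial E s i j.+1 a b.+1 y
     + a.+1%:R * jet_monomial E s i j a b.+1 y
     - b.+1%:R * jet_monomial E s i j a.+1 b y).
Proof.
move=> hE s0 y01; have /andP[y0 y1] := y01.
have ly : ln y < 0 by have := ln_le_sub1 y0; lra.
have l0 : 0 < - s * ln y by rewrite nmulr_rgt0 ?oppr_lt0.
have d1 : is_derive y 1 (fun z => - s * ln z) (- s * y^-1).
  by have := is_derive1_ln y0 => ?; exact: is_deriveZ.
have d2 : is_derive y 1 (fun z => E i (- s * ln z))
    (E i.+1 (- s * ln y) / (- s * ln y) * (- s * y^-1)).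
  by apply: (@is_derive1_comp _ (E i)) => //; exact: hE.
have d3 : is_derive y 1 (fun z => (ln z)^-1) (- (ln y) ^- 2 * y^-1).
  by have := is_derive1_ln y0 => ?; apply: is_deriveV; rewrite lt_eqF.
have d4 := is_deriveX j d3.
have d5 : is_derive y 1 (id : R -> R) 1 by exact: is_derive_id.
have d6 := is_deriveX a.+1 d5.
have d7 : is_derive y 1 (fun z : R => 1 - z) (0 - 1).
  by apply: is_deriveB.
have d8 := is_deriveX b.+1 d7.
have -> : jet_monomial E s i j a.+1 b.+1 = (fun z => E i (- s * ln z)) *
    ((fun z => (ln z)^-1) ^+ j * (id ^+ a.+1 * (fun z => 1 - z) ^+ b.+1)).
  by apply/funext => z; rewrite /jet_monomial !fctE.
apply: is_derive_eq (is_deriveM d2 (is_deriveM d4 (is_deriveM d6 d8))) _.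
rewrite /jet_monomial !fctE /= /GRing.scale/=.
have sn : s != 0 by rewrite gt_eqF.
have yn : y != 0 by rewrite gt_eqF.
have ln0 : ln y != 0 by rewrite lt_eqF.
have -> : j%:R * (ln y)^-1 ^+ j.-1 * (- (ln y) ^- 2 * y^-1) =
    - j%:R * (ln y)^-1 ^+ j.+1 / y.
  case: j d4 => [|j] _; first by ring.
  by rewrite /= -exprVn !exprS; set u := (ln y)^-1; set v := y^-1; ring.
rewrite !exprS; field.
by rewrite yn ln0 sn.
Qed.

(** The two inequalities are the budget for k derivatives: each of them lowers a, and also b - j, by
    at most one. The constant is independent of s by the scale invariance of the Euler operator. *)
Lemma bounded_jet_monomial k i j a b : (k <= a)%N -> (j + k <= b)%N ->
  exists2 C : R, 0 <= C & forall E s B, euler_jet E -> 0 < s ->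
    (forall i' l, (i' <= i + k)%N -> 0 < l -> `|E i' l| <= B) ->
    bounded_jet k (C * B) (jet_monomial E s i j a b).
Proof.
(* The j' factors 1 / ln y are paired with as many factors 1 - y; the remaining powers are at most
   1. *)
have bound k' i' j' a' b' E s B : (j' <= b')%N ->
    (forall i'' l, (i'' <= i' + k')%N -> 0 < l -> `|E i'' l| <= B) -> 0 < s ->
    forall y, 0 < y < 1 -> `|jet_monomial E s i' j' a' b' y| <= B.
  move=> jb EB s0 y y01; have /andP[y0 y1] := y01.
  have ly : ln y < 0 by have := ln_le_sub1 y0; lra.
  have l0 : 0 < - s * ln y by rewrite nmulr_rgt0 ?oppr_lt0.
  rewrite normrM -[leRHS]mulr1 ler_pM//; first by rewrite EB// leq_addr.
  rewrite -(subnKC jb) exprD [X in `|X|](_ : _ = (ln y)^-1 ^+ j' * (1 - y) ^+ j' *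
    (y ^+ a' * (1 - y) ^+ (b' - j'))); last by ring.
  rewrite normrM.
  have h1 : `|(ln y)^-1 ^+ j' * (1 - y) ^+ j'| <= 1.
    by rewrite -exprMn normrX exprn_ile1// normrM (@ger0_norm _ (1 - y)) ?inv_ln_bound//; lra.
  have h2 : `|y ^+ a' * (1 - y) ^+ (b' - j')| <= 1.
    rewrite normrM !normrX mulr_ile1 ?exprn_ge0//.
      by rewrite exprn_ile1// ger0_norm ltW.
    by rewrite exprn_ile1// ger0_norm; lra.
  by rewrite mulr_ile1.
elim: k i j a b => [|k ih] i j a b ka jb.
  exists 1 => // E s B hE s0 EB; split=> // y y01; rewrite mul1r.
  by apply: (bound 0%N) => //; rewrite (leq_trans _ jb)// leq_addr.
case: a ka => // a ka; case: b jb => [|b] jb; first by rewrite addnS in jb.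
have [||C1 C10 h1] := ih i.+1 j.+1 a b.+1 => //; first by lia.
have [||C2 C20 h2] := ih i j.+1 a b.+1 => //; first by lia.
have [||C3 C30 h3] := ih i j a b.+1 => //; first by lia.
have [||C4 C40 h4] := ih i j a.+1 b => //; [by lia|by lia|].
exists (1 + (C1 + j%:R * C2 + a.+1%:R * C3 + b.+1%:R * C4)).
  by rewrite !(addr_ge0, mulr_ge0).
move=> E s B hE s0 EB.
have B0 : 0 <= B by rewrite (le_trans _ (EB 0%N 1 _ _)).
have S0 : 0 <= C1 + j%:R * C2 + a.+1%:R * C3 + b.+1%:R * C4.
  by rewrite !(addr_ge0, mulr_ge0).
split.
  move=> y y01; apply: (@le_trans _ _ B).
    by apply: (bound k.+1) => //; rewrite (leq_trans _ jb)// leq_addr.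
  by rewrite ler_peMl// lerDl.
exists (fun y => jet_monomial E s i.+1 j.+1 a b.+1 y - j%:R * jet_monomial E s i j.+1 a b.+1 y
     + a.+1%:R * jet_monomial E s i j a b.+1 y
     - b.+1%:R * jet_monomial E s i j a.+1 b y).
  by move=> y y01; exact: is_derive_jet_monomial.
have {h1} : bounded_jet k (C1 * B) (jet_monomial E s i.+1 j.+1 a b.+1).
  by apply: h1 => // i' l i'k l0; apply: EB => //; lia.
have {h2} : bounded_jet k (C2 * B) (jet_monomial E s i j.+1 a b.+1).
  by apply: h2 => // i' l i'k l0; apply: EB => //; lia.
have {h3} : bounded_jet k (C3 * B) (jet_monomial E s i j a b.+1).
  by apply: h3 => // i' l i'k l0; apply: EB => //; lia.
have {h4} : bounded_jet k (C4 * B) (jet_monomial E s i j a.+1 b).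
  by apply: h4 => // i' l i'k l0; apply: EB => //; lia.
move=> /(bounded_jetZ (- b.+1%:R)) h4 /(bounded_jetZ a.+1%:R) h3.
move=> /(bounded_jetZ (- j%:R)) h2 h1.
have := bounded_jetD (bounded_jetD (bounded_jetD h1 h2) h3) h4.
rewrite !normrN !normr_nat => h.
apply: bounded_jetW (bounded_jet_ext _ h); last by move=> y _ /=; ring.
by rewrite -[in leRHS](add0r (C1 + _)) !mulrDl !mulrA mul0r; lra.
Qed.

Lemma bounded_jet_symbol k (r : {poly R}) :
  exists2 C : R, 0 <= C & forall E s B, euler_jet E -> 0 < s ->
    (forall i' l, (i' <= k)%N -> 0 < l -> `|E i' l| <= B) ->
    bounded_jet k (C * B) (fun y => E 0%N (- s * ln y) * (y ^+ k * (1 - y) ^+ k * r.[y])).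
Proof.
have /choice[C hC] : forall m : nat, exists C : R, 0 <= C /\
    forall E s B, euler_jet E -> 0 < s ->
      (forall i' l, (i' <= k)%N -> 0 < l -> `|E i' l| <= B) ->
      bounded_jet k (C * B) (jet_monomial E s 0 0 (k + m) k).
  by move=> m; have [|//|C C0 h] := @bounded_jet_monomial k 0 0 (k + m) k;
    [rewrite leq_addr|exists C].
exists (\sum_(m < size r) `|r`_m| * C m).
  by apply: sumr_ge0 => m _; rewrite mulr_ge0//; case: (hC m).
move=> E s B hE s0 EB; rewrite mulr_suml.
have := @bounded_jet_sum _ k _ (index_enum 'I_(size r)) (fun m => `|r`_m| * (C m * B))
  (fun m y => r`_m * jet_monomial E s 0 0 (k + m) k y).
move=> h.
have {h} := h (fun m => bounded_jetZ _ ((hC m).2 _ _ _ hE s0 EB)).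
under eq_bigr do rewrite mulrA.
apply: bounded_jet_ext => y _.
rewrite horner_coef !mulr_sumr; apply: eq_bigr => m _.
by rewrite /jet_monomial expr0 exprD; ring.
Qed.

(* Flat to order k + 1 both at 0 and (up to the constant 1) at 1. *)
Definition low_pass k y : R := 1 - (1 - y ^+ k.+1) ^+ k.+1.

Lemma low_pass1 k : low_pass k 1 = 1.
Proof. by rewrite /low_pass expr1n subrr expr0n/= subr0. Qed.

(** The linear bound is Bernoulli's inequality for (1 - y^(k+1))^(k+1), followed by y^(k+1) <= y. It
    makes the filter decay like exp(-l / s) in l, so that filtered spectral sums converge. *)
Lemma low_pass_bound k y : 0 <= y <= 1 ->
  [/\ 0 <= low_pass k y, low_pass k y <= 1 & low_pass k y <= k.+1%:R * y].
Proof.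
move=> /andP[y0 y1].
have yk0 : 0 <= y ^+ k.+1 by rewrite exprn_ge0.
have yk1 : y ^+ k.+1 <= 1 by rewrite exprn_ile1.
have z0 : 0 <= 1 - y ^+ k.+1 by lra.
split; rewrite /low_pass.
- by rewrite subr_ge0 exprn_ile1//; lra.
- by rewrite gerBl exprn_ge0.
- have yk : y ^+ k.+1 <= y by rewrite exprS ler_piMr// exprn_ile1.
  suff : 1 - k.+1%:R * y ^+ k.+1 <= (1 - y ^+ k.+1) ^+ k.+1.
    have := ler_wpM2l (ler0n R k.+1) yk; lra.
  elim: (k.+1) (y ^+ k.+1) yk0 z0 => [|n ih] z z0 z1; first by rewrite expr0 mul0r subr0.
  rewrite exprS -[(n.+1)%:R]natr1; apply: le_trans (ler_wpM2l z1 (ih _ z0 z1)).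
  have : 0 <= n%:R * z * z by rewrite !mulr_ge0.
  by nra.
Qed.

(** The cofactor in [low_pass_band]. With z = y^(k+1) the difference of the filters is (1 - z)^(k+1)
    ((1 + z)^(k+1) - 1); the geometric sums are the quotients of 1 - z by 1 - y and of (1 + z)^(k+1)
    - 1 by z. *)
Definition band_poly k : {poly R} :=
  (1 - 'X) * (\sum_(i < k.+1) 'X ^+ i) ^+ k.+1 * \sum_(i < k.+1) (1 + 'X ^+ k.+1) ^+ i.

(** Squaring y = exp(-l / s) halves s, so this compares the filters at two consecutive dyadic
    scales. The leading factor y is kept apart: it turns every power of y into a heat multiplier at
    positive time and makes the approximation error summable over the spectrum. *)
Lemma low_pass_band k y : low_pass k y - low_pass k (y ^+ 2) =
  y * (y ^+ k * (1 - y) ^+ k * (band_poly k).[y]).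
Proof.
rewrite /low_pass /band_poly.
have -> : 1 - (1 - y ^+ k.+1) ^+ k.+1 - (1 - (1 - y ^+ 2 ^+ k.+1) ^+ k.+1) =
    (1 - y ^+ 2 ^+ k.+1) ^+ k.+1 - (1 - y ^+ k.+1) ^+ k.+1 by ring.
have -> : y ^+ 2 ^+ k.+1 = y ^+ k.+1 ^+ 2 by rewrite -!exprM mulnC.
set z := y ^+ k.+1.
have -> : 1 - z ^+ 2 = (1 - z) * (1 + z) by ring.
rewrite exprMn -[X in _ - X]mulr1 -mulrBr subrX1.
have -> : 1 - z = (1 - y) * \sum_(i < k.+1) y ^+ i.
  by rewrite /z -[LHS]opprB subrX1 -mulNr opprB.
rewrite exprMn !hornerE !horner_sum.
have -> : \sum_(i < k.+1) ('X ^+ i : {poly R}).[y] = \sum_(i < k.+1) y ^+ i.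
  by apply: eq_bigr => i _; rewrite !hornerE.
have -> : \sum_(i < k.+1) ((1 + 'X ^+ k.+1) ^+ i : {poly R}).[y] = \sum_(i < k.+1) (1 + z) ^+ i.
  by apply: eq_bigr => i _; rewrite !hornerE.
by rewrite /z !exprS /=; ring.
Qed.

End symbol_jets.

(** * Kernel estimate for a single dyadic band *)

Section band_estimate.
Variable R : realType.
Implicit Types (s t l c delta gamma sigma B L : R) (sp : nat -> seq R) (a m : R -> R).

Definition spectral_sum sp a n m : R := \sum_(l <- sp n) m l * a l.

(* The data of the spectral sums at two points: [a l] is the kernel of the
   spectral projection and [H t] the heat kernel. *)
Record heat_data c (c2 : R) delta gamma sigma sp a (H : R -> R) : Prop := {
  hd_ge0 : forall n l, l \in sp n -> 0 <= l;
  hd_abs : forall n t, 0 < t <= 1 ->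
    \sum_(l <- sp n) expR (- (t * l)) * `|a l| <= c * t `^ (- delta);
  hd_cvg : forall t, 0 < t <= 1 ->
    spectral_sum sp a n (fun l => expR (- (t * l))) @[n --> \oo] --> H t;
  hd_bound : forall t, 0 < t <= 1 ->
    `|H t| <= c * t `^ (- delta) * expR (- (c2 * (sigma / t) `^ gamma))
}.

Lemma powR_divN s t delta : 0 < s -> 0 < t -> (t / s) `^ (- delta) = (s / t) `^ delta.
Proof.
move=> s0 t0; have st0 : 0 <= s / t by rewrite divr_ge0// ltW.
by rewrite -[t / s]invf_div -(powR_inv1 st0) -powRrM mulrNN mul1r.
Qed.

(** Comparison with the absolutely summed heat kernel at time 1 / s, a time at most 1 since s >= 1;
    there t^(-delta) becomes s^delta. *)
Lemma spectral_sum_abs c (c2 : R) delta gamma sigma sp a H s B m n :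
  heat_data c c2 delta gamma sigma sp a H -> 1 <= s -> 0 <= B ->
  (forall l, 0 <= l -> `|m l| <= B * expR (- (l / s))) ->
  `|spectral_sum sp a n m| <= B * (c * s `^ delta).
Proof.
move=> hd s1 B0 hm; have s0 : 0 < s by lra.
apply: (@le_trans _ _ (\sum_(l <- sp n) B * (expR (- (s^-1 * l)) * `|a l|))).
  rewrite (le_trans (ler_norm_sum _ _ _))// big_seq [leRHS]big_seq ler_sum// => l ln.
  rewrite normrM mulrA ler_wpM2r// (le_trans (hm _ (hd_ge0 hd ln)))//.
  by rewrite [s^-1 * l]mulrC.
rewrite -mulr_sumr ler_wpM2l// (le_trans (hd_abs hd _ _))//.
  by rewrite invr_gt0 s0/= invf_le1.
by rewrite -[s^-1]mul1r powR_divN// divr1.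
Qed.

Definition band k E s l : R :=
  E 0%N l * (low_pass k (expR (- (l / s))) - low_pass k (expR (- (l / s)) ^+ 2)).

(** Both filter values lie between 0 and (k + 1) y, so their difference has at most this size. At l
    = 0, where no bound on the symbol is given, both values are 1 and the band vanishes. *)
Lemma band_le k E s l B : 0 < s -> 0 <= l -> (0 < l -> `|E 0%N l| <= B) ->
  0 <= B -> `|band k E s l| <= k.+1%:R * B * expR (- (l / s)).
Proof.
move=> s0; rewrite le_eqVlt => /predU1P[<- _ B0|l0 /(_ l0) EB B0].
  by rewrite /band mul0r oppr0 expR0 expr1n subrr mulr0 normr0 !mulr_ge0.
set y := expR _.
have y0 : 0 <= y by exact: expR_ge0.
have y1 : y <= 1 by rewrite expR_le1 oppr_le0 divr_ge0// ltW.
have y01 : 0 <= y <= 1 by rewrite y0.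
have yy : y ^+ 2 <= y by rewrite expr2 ler_piMl.
have [g0 g1 g2] := low_pass_bound k y01.
have yy01 : 0 <= y ^+ 2 <= 1 by rewrite exprn_ge0//= (le_trans yy).
have [h0 h1 h2] := low_pass_bound k yy01.
rewrite /band normrM -/y [leRHS](_ : _ = B * (k.+1%:R * y)); last by ring.
rewrite ler_pM//.
rewrite ler_norml; have := ler_wpM2l (ler0n R k.+1) yy; lra.
Qed.

Lemma root_floor (q : nat) t : (0 < q)%N -> 1 <= t ->
  exists N : nat, [/\ (0 < N)%N, N%:R ^+ q <= t & t < N.+1%:R ^+ q].
Proof.
move=> q0 t1; pose P n := (n%:R ^+ q <= t).
have P1 : P 1%N by rewrite /P expr1n.
have ub n : P n -> (n <= Num.bound t)%N.
  move=> Pn; have [/ltnW//|h] := ltnP n (Num.bound t).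
  suff : t < n%:R ^+ q by rewrite ltNge => /negP; case/(_ Pn).
  have : t < n%:R.
    rewrite (le_lt_trans (ler_norm _))//.
    have t0 : 0 <= t by lra.
    by rewrite ger0_norm// (lt_le_trans (archi_boundP t0))// ler_nat.
  move/lt_le_trans; apply.
  have [->|n0] := eqVneq n 0%N; first by rewrite exprn_ge0.
  by rewrite -[leLHS]expr1 ler_weXn2l// ler1n lt0n.
have [N PN hN] := ex_maxnP (ex_intro P 1%N P1) ub.
exists N; split => //; first exact: hN.
by rewrite ltNge; apply/negP => /hN; rewrite ltnn.
Qed.

(** The exponent is at least c3 N^((q-1) gamma), hence at least c3 N^2, while 3^N <= e^(2N) and N^q
    <= q^q e^N together cost only e^(3N). The constant 9 / (4 c3) is the maximum of 3N - c3 N^2. *)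
Lemma exp_vs_superexp (q : nat) (c2 : R) gamma : 0 < c2 -> 0 < gamma -> (1 < q)%N ->
  2 <= q.-1%:R * gamma -> exists2 C : R, 0 < C & forall N : nat, (0 < N)%N ->
   3 ^+ N * expR (- (c2 * (N%:R ^+ q / (N + (2 * q).+1)%:R) `^ gamma)) <= C / N%:R ^+ q.
Proof.
move=> c20 g0 q1 qg; have q0 : (0 < q)%N by lia.
pose c3 : R := c2 / (2 * q).+2%:R `^ gamma.
have c30 : 0 < c3 by rewrite divr_gt0// powR_gt0.
exists (q%:R ^+ q * expR (9 / (4 * c3))).
  by rewrite mulr_gt0 ?expR_gt0// exprn_gt0// ltr0n.
move=> N N0; have N1 : 1 <= N%:R :> R by rewrite ler1n.
have Np : 0 < N%:R :> R by rewrite ltr0n.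
rewrite ler_pdivlMr ?exprn_gt0//.
have e1 := @expr_le_expR R q N%:R (ler0n R N).
have e2 : 3 ^+ N <= expR (2 * N%:R) :> R.
  rewrite expRM_natr lerXn2r ?nnegrE ?expR_ge0//.
  by have := expR_ge1Dx (2 : R); lra.
have e3 : c3 * N%:R ^+ 2 <= c2 * (N%:R ^+ q / (N + (2 * q).+1)%:R) `^ gamma.
  rewrite /c3 -mulrA ler_wpM2l ?(ltW c20)//.
  apply: (@le_trans _ _ ((N%:R ^+ q.-1 / (2 * q).+2%:R) `^ gamma)).
    rewrite powRM ?exprn_ge0 ?invr_ge0// mulrC.
    rewrite ler_pM ?exprn_ge0 ?invr_ge0 ?powR_ge0//.
      rewrite -[N%:R ^+ q.-1]powR_mulrn// -powRrM -[N%:R ^+ 2]powR_mulrn//.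
      by rewrite ler_powR.
    by rewrite -powR_inv1// -powRrM mulrC powRrM powR_inv1 ?powR_ge0.
  rewrite ge0_ler_powR ?nnegrE ?divr_ge0 ?exprn_ge0 ?(ltW g0)//.
  rewrite ler_pdivrMr ?ltr0n// mulrAC ler_pdivlMr ?ltr0n ?addnS//.
  have -> : N%:R ^+ q = N%:R ^+ q.-1 * N%:R :> R by rewrite -exprSr prednK.
  rewrite -[leRHS]mulrA ler_wpM2l ?exprn_ge0//.
  by rewrite -natrM ler_nat; nia.
have e4 : 3 * N%:R - c3 * N%:R ^+ 2 <= 9 / (4 * c3).
  rewrite ler_pdivlMr ?mulr_gt0//.
  have : 0 <= (2 * c3 * N%:R - 3) ^+ 2 by rewrite sqr_ge0.
  by nra.
have e5 : 3 ^+ N * expR (- (c2 * (N%:R ^+ q / (N + (2 * q).+1)%:R) `^ gamma)) <=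
    expR (2 * N%:R) * expR (- (c3 * N%:R ^+ 2)).
  by apply: ler_pM; rewrite ?exprn_ge0 ?expR_ge0// ler_expR lerN2.
apply: (le_trans (ler_pM _ _ e5 e1)); first by rewrite mulr_ge0 ?exprn_ge0 ?expR_ge0.
  by rewrite exprn_ge0.
rewrite mulrCA ler_wpM2l ?exprn_ge0// -!expRD ler_expR.
by rewrite (le_trans _ e4)//; lra.
Qed.

Lemma norm_cvg_le (u v : nat -> R) L b : u @ \oo --> L -> v @ \oo --> b ->
  (forall n, `|u n| <= v n) -> `|L| <= b.
Proof.
move=> /cvg_norm uL vb uv; apply: (ler_cvg_to uL vb).
by near=> n; exact: uv.
Unshelve. all: by end_near. Qed.

Lemma cvg_rsum (I T : Type) (r : seq I) (F : set_system T) {FF : Filter F}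
    (f : I -> T -> R) (l : I -> R) :
  (forall i, f i x @[x --> F] --> l i) ->
  \sum_(i <- r) f i x @[x --> F] --> \sum_(i <- r) l i.
Proof.
move=> h; elim: r => [|i r ih].
  by under eq_cvg do rewrite big_nil; rewrite big_nil; exact: cvg_cst.
by under eq_cvg do rewrite big_cons; rewrite big_cons; exact: cvgD.
Qed.

(* With y = exp (- l / s), band k E s l = y f(y) where f is flat at 0 and at 1,
   and y^j is the multiplier of the heat kernel at time j / s.  Replacing f by
   its Bernstein-Taylor polynomial Q of parameter N ~ (s sigma)^(1/q), the
   superexponential decay of the heat kernel beats the 3^N growth of the
   coefficients of Q, and the error f - Q is O(N^-q). *)
Lemma band_bound c (c2 : R) delta gamma (sigmax : R) : 0 < c -> 0 < c2 -> 0 < gamma ->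
  0 <= delta -> 0 < sigmax -> exists k : nat, exists2 C : R, 0 < C &
  forall sp a H sigma E B s L, heat_data c c2 delta gamma sigma sp a H ->
    0 < sigma <= sigmax -> euler_jet E ->
    (forall i l, (i <= k)%N -> 0 < l -> `|E i l| <= B) -> 1 <= s ->
    spectral_sum sp a n (band k E s) @[n --> \oo] --> L ->
    `|L| <= C * B * s `^ delta /\ `|L| <= C * B * s `^ delta / (s * sigma).
Proof.
move=> c0 c20 g0 d0 sm0.
have [q q1 qg] : exists2 q : nat, (1 < q)%N & 2 <= q.-1%:R * gamma.
  exists (Num.bound (2 / gamma)).+2 => //=.
  rewrite -ler_pdivrMr// (le_trans (ltW (archi_boundP _)))//.
    by rewrite divr_ge0// ltW.
  by rewrite ler_nat.
have q0 : (0 < q)%N by lia.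
pose k := (2 * q)%N; exists k.
have [C1 C10 hC1] := bernstein_taylor R q0.
have [C2 C20 hC2] := exp_vs_superexp c20 g0 q1 qg.
have [C3 C30 hC3] := bounded_jet_symbol k (band_poly R k).
pose C4 := coef_norm (band_poly R k).
have C40 : 0 <= C4 by exact: coef_norm_ge0.
(* For s >= s1 all heat times used below are at most 1, as the heat bounds require: half of s covers
   k + 1, since 4q + 2 = 2 (k + 1), and the other half covers N, since N^2 <= s sigmax <= s^2 /
   4. *)
pose s1 : R := 4 * sigmax + (4 * q + 2)%:R.
have s10 : 0 <= s1 by rewrite addr_ge0// mulr_ge0// ltW.
have [D0 D00 D0E] : exists2 D0 : R, 0 < D0 & D0 = k.+1%:R * c.
  by exists (k.+1%:R * c) => //; rewrite mulr_gt0.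
have [D1 D10 D1E] : exists2 D1 : R, 0 <= D1 &
    D1 = (C3 + C4) * C1 * c * (2 ^+ q * (C2 + 1)).
  by eexists; last reflexivity; rewrite !mulr_ge0 ?addr_ge0 ?exprn_ge0// ltW.
exists (D0 * (s1 * sigmax + 2) + D1).
  by rewrite ltr_wpDr// mulr_gt0// ltr_wpDl// mulr_ge0// ltW.
move=> sp a H sigma E B s L hd /andP[sg0 sgm] hE EB s_ge1 Lcvg.
have B0 : 0 <= B by rewrite (le_trans _ (EB 0%N 1 _ _)).
have s0 : 0 < s by lra.
have ss0 : 0 < s * sigma by rewrite mulr_gt0.
have trivial_bound : `|L| <= D0 * B * s `^ delta.
  apply: (norm_cvg_le Lcvg (cvg_cst _)) => n.
  have h := @spectral_sum_abs _ _ _ _ _ _ _ _ s (k.+1%:R * B) (band k E s) n hd s_ge1.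
  rewrite (le_trans (h _ _)) ?mulr_ge0//; last by rewrite D0E; lra.
  by move=> l l0; apply: band_le => // l_gt0; exact: EB.
pose S := s `^ delta; have S0 : 0 <= S by exact: powR_ge0.
have BS0 : 0 <= B * S by rewrite mulr_ge0.
split.
  rewrite (le_trans trivial_bound)// -!mulrA -/S.
  have : 0 <= (D0 * (s1 * sigmax + 1) + D1) * (B * S).
    by rewrite mulr_ge0// addr_ge0// mulr_ge0 ?addr_ge0 ?mulr_ge0// ltW.
  by lra.
(* As long as s sigma stays bounded, dividing by it costs a constant and the trivial bound is
   enough. *)
have [ssm|ssm] := leP (s * sigma) (s1 * sigmax + 1).
  rewrite (le_trans trivial_bound)// ler_pdivlMr// -!mulrA -/S.
  have h1 : 0 <= D0 * (B * S) by rewrite mulr_ge0// ltW.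
  have := ler_wpM2l h1 ssm.
  have : 0 <= D1 * (B * S) by rewrite mulr_ge0.
  by lra.
have s_ge_s1 : s1 <= s.
  rewrite -(ler_pM2r sm0) (@le_trans _ _ (s * sigma))//; first by lra.
  by rewrite ler_wpM2l// ltW.
have ss1 : 1 <= s * sigma.
  have : 0 <= s1 * sigmax by rewrite mulr_ge0// ltW.
  by lra.
have [N [N0 N1 N2]] := root_floor q0 ss1.
have Np : 0 < N%:R :> R by rewrite ltr0n.
have Nq : N%:R ^- q <= 2 ^+ q / (s * sigma).
  rewrite ler_pdivlMr// ler_pdivrMl ?exprn_gt0// -exprMn.
  rewrite (le_trans (ltW N2))// lerXn2r ?nnegrE ?mulr_ge0//.
  by rewrite -natrM ler_nat muln2 -addnn -addn1 leq_add2l.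
have Ns : (N + k.+1)%:R <= s.
  have kk : (4 * q + 2)%:R = 2 * k.+1%:R :> R by rewrite /k -natrM; congr (_%:R); clear; lia.
  suff : N%:R <= s / 2.
    rewrite natrD; move: s_ge_s1; rewrite /s1 kk; lra.
  have : N%:R ^+ 2 <= s * sigmax.
    rewrite (@le_trans _ _ (N%:R ^+ q))// ?ler_weXn2l ?ler1n//.
    by rewrite (le_trans N1)// ler_wpM2l// ltW.
  have : s * (4 * sigmax) <= s * s.
    rewrite ler_wpM2l// ?(ltW s0)//; move: s_ge_s1; rewrite /s1.
    by have := ler0n R (4 * q + 2); lra.
  by have [//|] := leP N%:R (s / 2); nra.
pose f y := E 0%N (- s * ln y) * (y ^+ k * (1 - y) ^+ k * (band_poly R k).[y]).
pose A := (C3 + C4) * B.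
have A0 : 0 <= A by rewrite mulr_ge0// addr_ge0.
have jf : bounded_jet k A f.
  apply: bounded_jetW (hC3 E s B hE s0 EB).
  by rewrite ler_wpM2r// lerDl.
have fA y : 0 < y <= 1 -> `|f y| <= A * (y ^+ k * (1 - y) ^+ k).
  move=> /andP[y0]; rewrite le_eqVlt => /predU1P[->|y1].
    rewrite /f subrr expr0n/= muln_eq0/= gtn_eqF//.
    by rewrite mulr0 mul0r !mulr0 normr0.
  have ly : ln y < 0 by have := ln_le_sub1 y0; lra.
  have l0 : 0 < - s * ln y by rewrite nmulr_rgt0 ?oppr_lt0.
  have e0 : 0 <= y ^+ k * (1 - y) ^+ k.
    by rewrite mulr_ge0 ?exprn_ge0//; lra.
  rewrite /f !normrM -(normrM (y ^+ k)) (ger0_norm e0).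
  have h1 : `|E 0%N (- s * ln y)| <= B by exact: EB.
  have h2 : `|(band_poly R k).[y]| <= C4.
    by rewrite horner_coef_norm// !ltW.
  rewrite mulrCA mulrC ler_wpM2r// (le_trans (ler_pM _ _ h1 h2))//.
  by rewrite mulrC ler_wpM2r// lerDr.
have [Q [sQ nQ hQ]] := hC1 N A f N0 A0 jf fA.
(* The factor y in front of f shifts the exponents by one: the coefficient of index j meets the heat
   kernel at time (j + 1) / s. *)
pose h j l := expR (- (j.+1%:R / s * l)).
pose u n := \sum_(j < size Q) Q`_j * spectral_sum sp a n (h j).
have tj (j : 'I_(size Q)) : 0 < j.+1%:R / s <= 1.
  rewrite divr_gt0//= ler_pdivrMr// mul1r (le_trans _ Ns)// ler_nat.
  by rewrite (leq_trans (ltn_ord j)).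
have ucvg : u @ \oo --> \sum_(j < size Q) Q`_j * H (j.+1%:R / s).
  by apply: cvg_rsum => j; apply: cvgMr; exact: (hd_cvg hd (tj j)).
have bandE l : 0 <= l -> band k E s l =
    \sum_(j < size Q) Q`_j * h j l + expR (- (l / s)) *
     (f (expR (- (l / s))) - Q.[expR (- (l / s))]).
  move=> l0; rewrite mulrBr; set y := expR _.
  have -> : \sum_(j < size Q) Q`_j * h j l = y * Q.[y].
    rewrite horner_coef mulr_sumr; apply: eq_bigr => j _.
    rewrite mulrCA -exprS; congr (_ * _); rewrite /h /y -expRM_natl; congr expR.
    by rewrite mulrN mulrAC mulrA.
  rewrite addrC subrK /band low_pass_band -/y /f /y expRK.
  have -> : - s * - (l / s) = l by rewrite mulrNN mulrC divfK// gt_eqF.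
  by rewrite mulrCA.
have split n : `|spectral_sum sp a n (band k E s)| <= `|u n| + A * C1 / N%:R ^+ q * (c * S).
  pose m l := if 0 <= l then expR (- (l / s)) *
     (f (expR (- (l / s))) - Q.[expR (- (l / s))]) else 0.
  have -> : spectral_sum sp a n (band k E s) = u n + spectral_sum sp a n m.
    have -> : u n = \sum_(l <- sp n) \sum_(j < size Q) Q`_j * (h j l * a l).
      by rewrite exchange_big/=; apply: eq_bigr => j _; rewrite -mulr_sumr.
    rewrite /spectral_sum -big_split/= big_seq [RHS]big_seq.
    apply: eq_bigr => l ln; have l0 := hd_ge0 hd ln.
    rewrite bandE// /m l0 mulrDl mulr_suml; congr (_ + _).
    by apply: eq_bigr => j _; rewrite mulrA.
  rewrite (le_trans (ler_normD _ _))// lerD2l.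
  apply: (spectral_sum_abs _ hd s_ge1).
    by apply: divr_ge0; [apply: mulr_ge0 => //; exact: ltW|exact: exprn_ge0].
  move=> l l0; rewrite /m l0 normrM (ger0_norm (expR_ge0 _)) [leLHS]mulrC ler_wpM2r ?expR_ge0//.
  by apply: hQ; rewrite expR_gt0 expR_le1 oppr_le0 divr_ge0// ltW.
apply: (le_trans (norm_cvg_le Lcvg (cvgD (cvg_norm ucvg) (cvg_cst _)) split)).
(* The times (j + 1) / s lie between 1 / s and (N + 2q + 1) / s. The lower end bounds t^(-delta) by
   s^delta; the upper end, with N^q <= s sigma, gives the exponential of [exp_vs_superexp]. *)
have Hb : `|\sum_(j < size Q) Q`_j * H (j.+1%:R / s)| <= A * C1 * (C2 / N%:R ^+ q) * (c * S).
  pose z := expR (- (c2 * (N%:R ^+ q / (N + (2 * q).+1)%:R) `^ gamma)).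
  apply: (@le_trans _ _ (\sum_(j < size Q) `|Q`_j| * (c * S * z))).
    rewrite (le_trans (ler_norm_sum _ _ _))// ler_sum// => j _.
    rewrite normrM ler_wpM2l// (le_trans (hd_bound hd (tj j)))//.
    have j0 : 0 < j.+1%:R :> R by [].
    rewrite powR_divN//; apply: ler_pM; rewrite ?mulr_ge0 ?powR_ge0 ?expR_ge0 ?(ltW c0)//.
      rewrite ler_wpM2l ?(ltW c0)// ge0_ler_powR ?nnegrE ?divr_ge0 ?(ltW s0)//.
      by rewrite ler_pdivrMr// ler_peMr ?(ltW s0)// ler1n.
    rewrite ler_expR lerN2 ler_wpM2l ?(ltW c20)//.
    rewrite ge0_ler_powR ?nnegrE ?divr_ge0 ?exprn_ge0 ?(ltW g0) ?(ltW s0) ?(ltW sg0)//.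
    rewrite invf_div mulrA ler_pM ?invr_ge0 ?exprn_ge0//; first by rewrite mulrC.
    by rewrite lef_pV2 ?posrE// ler_nat (leq_trans (ltn_ord j)).
  rewrite -mulr_suml -/(coef_norm Q).
  have z0 : 0 <= z by exact: expR_ge0.
  have cS0 : 0 <= c * S by rewrite mulr_ge0// ltW.
  apply: (@le_trans _ _ (A * C1 * 3 ^+ N * (c * S * z))).
    by rewrite ler_wpM2r// mulr_ge0.
  rewrite [leLHS](_ : _ = A * C1 * (3 ^+ N * z) * (c * S)); last by ring.
  rewrite ler_wpM2r//; apply: ler_wpM2l; last exact: hC2.
  by apply: mulr_ge0 => //; exact: ltW.
rewrite (le_trans (lerD Hb (lexx _)))//.
have AC : 0 <= A * C1 * (C2 + 1) * (c * S).
  by rewrite ?(mulr_ge0, addr_ge0) ?(ltW C10) ?(ltW C20) ?(ltW c0).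
apply: (@le_trans _ _ (A * C1 * (C2 + 1) * (c * S) * N%:R ^- q)); first by lra.
apply: (le_trans (ler_wpM2l AC Nq)).
rewrite [leLHS](_ : _ = D1 * B * S / (s * sigma)); last by rewrite D1E /A; ring.
rewrite ler_wpM2r ?invr_ge0 ?(ltW ss0)// ler_wpM2r// ler_wpM2r// lerDr.
by rewrite mulr_ge0 ?(ltW D00)// addr_ge0// mulr_ge0// ltW.
Qed.

End band_estimate.

(** * Energy and measure of the fractafold *)

Section euclidean_distance.
Variables (R : realType) (n : nat).
Implicit Types x y : 'rV[R]_n.

Lemma norm_le_edist x y : `|x - y| <= Defs.edist x y.
Proof.
rewrite {1}/Num.norm/= mx_normrE; apply/bigmax_leP; split; first exact: sqrtr_ge0.
move=> [i j] _ /=; rewrite (ord1 i) -sqrtr_sqr ler_wsqrtr//.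
rewrite /edot (bigD1 j)//= -expr2 lerDl.
by apply: sumr_ge0 => k _; rewrite -expr2 sqr_ge0.
Qed.

Lemma edist_le_norm x y : Defs.edist x y <= n%:R * `|x - y|.
Proof.
rewrite -[leRHS]ger0_norm ?mulr_ge0// -sqrtr_sqr ler_wsqrtr//.
apply: (@le_trans _ _ (\sum_(i < n) `|x - y| ^+ 2)).
  apply: ler_sum => i _; rewrite -expr2 -real_normK ?num_real//.
  rewrite lerXn2r ?nnegrE// {2}/Num.norm/= mx_normrE.
  exact: (le_bigmax _ (fun k => `|(x - y) k.1 k.2|) (0, i)).
rewrite sumr_const card_ord -[leLHS]mulr_natl exprMn ler_wpM2r ?exprn_ge0//.
by rewrite -natrX ler_nat; case: n => // m; rewrite leq_pmulr.
Qed.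

Lemma similitude_continuous (rho : R) (f : 'rV[R]_n -> 'rV[R]_n) : 0 < rho ->
  (forall x y, Defs.edist (f x) (f y) = rho * Defs.edist x y) -> continuous f.
Proof.
move=> r0 hf x A /nbhs_ballP[eps /= e0 hA].
have c0 : 0 < rho * n.+1%:R by rewrite mulr_gt0.
apply/nbhs_ballP; exists (eps / (rho * n.+1%:R)); first by rewrite /= divr_gt0.
move=> y; rewrite -ball_normE /= ltr_pdivlMr// => xy; apply: hA.
rewrite -ball_normE /= (le_lt_trans (norm_le_edist _ _))// hf (le_lt_trans _ xy)//.
rewrite mulrCA ler_wpM2l ?(ltW r0)//.
by rewrite (le_trans (edist_le_norm _ _))// mulrC ler_wpM2l// ler_nat.
Qed.

End euclidean_distance.

(** * Cells, energy and measure of the nested fractal *)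

Section nested_fractal_cells.
Variables (R : realType) (n M : nat).
Variables (F : 'I_M -> 'rV[R]_n -> 'rV[R]_n) (K0 : set 'rV[R]_n).
Hypothesis hK0 : nested_fractal F K0.

Lemma nested_map_continuous i : continuous (F i).
Proof.
have [rho /andP[r0 _] h] := nf_similitudes hK0.
exact: similitude_continuous r0 (h i).
Qed.

Lemma nested_closed : closed K0.
Proof. exact: compact_closed (@norm_hausdorff _ _) (nf_compact hK0). Qed.

Lemma nested_map_sub i a : K0 a -> K0 (F i a).
Proof. by move=> Ka; rewrite (nf_selfsimilar hK0); exists i => //; exists a. Qed.

Lemma nested_word_sub w a : K0 a -> K0 (wordmap F w a).
Proof. by elim: w a => //= i w ih a Ka; apply/nested_map_sub/ih. Qed.

Lemma nested_word_cover m a : K0 a ->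
  exists w, size w = m /\ exists2 b, K0 b & a = wordmap F w b.
Proof.
elim: m a => [|m ih] a Ka; first by exists [::]; split => //; exists a.
have : (\bigcup_i (F i @` K0)) a by rewrite -(nf_selfsimilar hK0).
move=> [i _ [b Kb <-]].
have [w [sw [c Kc ->]]] := ih _ Kb.
by exists (i :: w); split; [rewrite /= sw|exists c].
Qed.

(** The maps contract by rho, so the cells of level m that contain a shrink to a at the rate
    rho^m. *)
Lemma nested_small_cell a (U : set 'rV[R]_n) : K0 a -> nbhs a U ->
  exists w, forall b, K0 b -> U (wordmap F w b).
Proof.
move=> Ka /nbhs_ballP[eps /= e0 aU].
have [rho /andP[r0 r1] hF] := nf_similitudes hK0.
have [B hB] : exists B : R, forall x, K0 x -> `|x| <= B.
  have [B [_ hB]] := compact_bounded (nf_compact hK0).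
  by exists (B + 1) => x Kx; apply: hB => //; rewrite ltrDl.
have B0 : 0 <= B by rewrite (le_trans (normr_ge0 _) (hB _ Ka)).
pose Dm : R := n%:R * (B + B) + 1.
have Dm0 : 0 < Dm by rewrite ltr_wpDl// mulr_ge0// addr_ge0.
have hw w x y : Defs.edist (wordmap F w x) (wordmap F w y) = rho ^+ size w * Defs.edist x y.
  by elim: w => [|i w ih] /=; rewrite ?expr0 ?mul1r// hF ih exprS mulrA.
have [m hm] : exists m, rho ^+ m * Dm < eps.
  have : (fun k => rho ^+ k * Dm) @ \oo --> (0 * Dm : R).
    by apply: cvgMl; apply: cvg_expr; rewrite ger0_norm// ltW.
  rewrite mul0r => /cvgr_lt/(_ _ e0) [m _ hm].
  by exists m; apply: hm => /=.
have [w [sw [b Kb aE]]] := nested_word_cover m Ka.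
exists w => c Kc; apply: aU; rewrite -ball_normE /= aE.
rewrite (le_lt_trans (norm_le_edist _ _))// hw sw (le_lt_trans _ hm)//.
rewrite ler_wpM2l ?exprn_ge0 ?ltW// /Dm.
rewrite (le_lt_trans (edist_le_norm _ _))// ltr_pwDr// ler_wpM2l//.
by rewrite (le_trans (ler_normB _ _))// lerD// hB.
Qed.

Section energy.
Variables (r : 'I_M -> R) (D0 : set ('rV[R]_n -> R))
  (e0 : ('rV[R]_n -> R) -> ('rV[R]_n -> R) -> R).
Hypothesis he0 : self_similar_energy F K0 r D0 e0.

Lemma energy_cell_le u i : D0 u -> e0 (u \o F i) (u \o F i) <= r i * e0 u u.
Proof.
move=> Du; have Dui j : D0 (u \o F j) by exact: ((se_dom he0 u).1 Du j).
have ri0 j : 0 < r j by case/andP: (se_factors he0 j).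
rewrite -ler_pdivrMl// (se_selfsimilar he0 Du Du) (bigD1 i)//= lerDl.
apply: sumr_ge0 => j _; rewrite mulr_ge0 ?invr_ge0 ?(ltW (ri0 j))//.
exact: se_ge0 he0 _ (Dui j).
Qed.

(* A point is the limit of F_w v along prefixes w of its address; each letter
   multiplies the energy of u o F_w by at most max r < 1. *)
Lemma energy_oscillation : exists C : R, forall u a b, D0 u -> K0 a -> K0 b ->
  (u a - u b) ^+ 2 <= C * e0 u u.
Proof.
have [v Kv] := nf_nonempty hK0.
have /choice[c hc] : forall i, exists c : R, forall u, D0 u ->
    (u (F i v) - u v) ^+ 2 <= c * e0 u u.
  by move=> i; apply: (se_resistance he0) => //; exact: nested_map_sub.
pose c1 : R := \sum_i `|c i|.
have c10 : 0 <= c1 by apply: sumr_ge0.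
pose rm : R := \big[Order.max/0]_i r i.
have rm0 : 0 <= rm by exact: bigmax_ge_id.
have rm1 : rm < 1.
  by apply: bigmax_lt => // i _; case/andP: (se_factors he0 i).
have srm1 : Num.sqrt rm < 1 by rewrite -[ltRHS]sqrtr1 ltr_sqrt.
(* The sum of a geometric series of ratio sqrt(rm): the solution of A = sqrt(rm) A + sqrt(c1), which
   is what the induction on words has to reproduce. *)
pose A := Num.sqrt c1 / (1 - Num.sqrt rm).
have A0 : 0 <= A by rewrite divr_ge0 ?sqrtr_ge0// subr_ge0 ltW.
have AE : Num.sqrt rm * A + Num.sqrt c1 = A.
  rewrite /A; field; lra.
have hw w u : D0 u -> `|u (wordmap F w v) - u v| <= A * Num.sqrt (e0 u u).
  elim: w u => [|i w ih] u Du; first by rewrite subrr normr0 mulr_ge0// sqrtr_ge0.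
  have Eu := se_ge0 he0 Du.
  rewrite -[u _ - _](subrKA (u (F i v))) (le_trans (ler_normD _ _))//.
  rewrite -AE mulrDl lerD//.
    apply: (le_trans (ih (u \o F i) _)); first exact: ((se_dom he0 u).1 Du i).
    rewrite [leRHS](_ : _ = A * (Num.sqrt rm * Num.sqrt (e0 u u))); last by ring.
    rewrite ler_wpM2l// -sqrtrM// ler_wsqrtr//.
    rewrite (le_trans (energy_cell_le i Du))// ler_wpM2r//.
    exact: le_bigmax.
  rewrite -sqrtrM// -sqrtr_sqr ler_wsqrtr// (le_trans (hc i _ Du))// ler_wpM2r//.
  by rewrite (le_trans (ler_norm _))// /c1 (bigD1 i)//= lerDl sumr_ge0.
have ha u a : D0 u -> K0 a -> `|u a - u v| <= A * Num.sqrt (e0 u u).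
  move=> Du Ka; apply/ler_addgt0Pr => eps ep.
  have /subspace_continuousP/(_ _ Ka) := se_continuous he0 Du.
  move/cvgrPdist_le => /(_ _ ep); rewrite near_withinE => hU.
  have [w hU'] := nested_small_cell Ka hU.
  have := hU' _ Kv (nested_word_sub w Kv) => h1.
  rewrite -[u a - u v](subrKA (u (wordmap F w v))) addrC.
  by rewrite (le_trans (ler_normD _ _))// lerD// hw.
clearbody A; exists ((2 * A) ^+ 2) => u a b Du Ka Kb.
have Eu := se_ge0 he0 Du.
rewrite -[e0 u u](sqr_sqrtr Eu) -exprMn -[leLHS]real_normK ?num_real//.
rewrite lerXn2r ?nnegrE ?mulr_ge0 ?sqrtr_ge0//.
rewrite -[u a - u b](subrKA (u v)) (le_trans (ler_normD _ _))//.
rewrite [X in _ + X]distrC.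
by have := ha u a Du Ka; have := ha u b Du Kb; lra.
Qed.

Lemma energy_dom0 : D0 (cst 0).
Proof.
have := se_lin he0 (-1) (se_const he0) (se_const he0).
by congr D0; apply/funext => x /=; ring.
Qed.

Lemma energy_dom_sum (I : Type) (s : seq I) (c : I -> R) (f : I -> 'rV[R]_n -> R) :
  (forall i, D0 (f i)) -> D0 (fun x => \sum_(i <- s) c i * f i x).
Proof.
move=> Df; elim: s => [|i s ih].
  by have := energy_dom0; congr D0; apply/funext => x; rewrite big_nil.
by have := se_lin he0 (c i) (Df i) ih; congr D0; apply/funext => x; rewrite big_cons.
Qed.

(* (sum_a f_a - (#s - 1))^+ where f_a takes values in [0, 1], is 1 at b and 0
   at a. *)
Lemma energy_bump (s : seq 'rV[R]_n) b : K0 b -> (forall a, a \in s -> K0 a) ->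
  exists2 f, D0 f & f b = 1 /\ forall a, a \in s -> a != b -> f a = 0.
Proof.
move=> Kb Ks.
have /choice[f hf] : forall a, exists f, [/\ D0 f, forall x, 0 <= f x <= 1,
    f b = 1 & a \in s -> a != b -> f a = 0].
  move=> a; have [as_|ans] := boolP (a \in s); last first.
    exists (cst 1); split => //; first exact: se_const he0.
    by move=> x /=; rewrite ler01 lexx.
  have [->|/eqP ab] := eqVneq a b.
    exists (cst 1); split => //; first exact: se_const he0.
    by move=> x /=; rewrite ler01 lexx.
  have [u Du uab] := se_separates he0 (Ks _ as_) Kb ab.
  have ub : u b - u a != 0 by rewrite subr_eq0 eq_sym; apply/eqP.
  pose v x := (u b - u a)^-1 * u x + (- u a / (u b - u a)) * 1.
  have Dv : D0 v.
    apply: (se_lin he0) => //.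
    have := se_lin he0 (- u a / (u b - u a)) (se_const he0) energy_dom0.
    by congr D0; apply/funext => x /=; rewrite addr0.
  exists (fun x => Num.min (Num.max (v x) 0) 1); split.
  - by have [] := se_markov he0 Dv.
  - by move=> x; rewrite ge_min lexx orbT andbT le_min ler01 le_max lexx orbT.
  - have -> : v b = 1 by rewrite /v; field.
    by rewrite max_l// minxx.
  - have -> : v a = 0 by rewrite /v; field.
    by rewrite maxxx min_l.
pose m : R := (size s)%:R - 1.
pose g x := \sum_(a <- s) 1 * f a x + - m * 1.
have Dg : D0 g.
  have := se_lin he0 1 (energy_dom_sum s (cst 1) (fun a => let: And4 h _ _ _ := hf a in h))
    (se_lin he0 (- m) (se_const he0) energy_dom0).
  by congr D0; apply/funext => x /=; rewrite mul1r addr0.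
exists (fun x => Num.min (Num.max (g x) 0) 1).
  by have [] := se_markov he0 Dg.
split.
  have -> : g b = 1.
    rewrite /g (eq_bigr (fun=> 1)); last by move=> a _; case: (hf a) => _ _ -> _; rewrite mulr1.
    by rewrite big_const_seq count_predT iter_addr addr0 /m; ring.
  by rewrite max_l// minxx.
move=> a as_ ab; rewrite max_r ?min_l//.
suff : \sum_(c <- s) 1 * f c a <= m by rewrite /g mulr1 subr_le0.
rewrite (big_rem a)//=; case: (hf a) => _ _ _ ->//; rewrite mulr0 add0r.
rewrite /m -[(size s)%:R]/((size s)%:R) -(prednK (_ : 0 < size s)%N); last first.
  by case: (s) as_.
rewrite -natr1 addrK -(size_rem as_).
apply: (@le_trans _ _ (\sum_(c <- rem a s) 1)).
  by apply: ler_sum => c _; rewrite mul1r; case: (hf c) => _ /(_ a)/andP[].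
by rewrite big_const_seq count_predT iter_addr addr0.
Qed.

(** Lagrange interpolation with the bumps as basis. It later gives functions on different copies the
    same values at glued points. *)
Lemma energy_interpolation (s : seq 'rV[R]_n) (tau : 'rV[R]_n -> R) :
  uniq s -> (forall a, a \in s -> K0 a) ->
  exists2 f, D0 f & forall a, a \in s -> f a = tau a.
Proof.
move=> us Ks.
have /choice[f hf] : forall b, exists f, D0 f /\ (b \in s -> f b = 1 /\
    forall a, a \in s -> a != b -> f a = 0).
  move=> b; have [bs|bns] := boolP (b \in s); last by exists (cst 0); split => //; exact: energy_dom0.
  by have [g Dg hg] := energy_bump (Ks _ bs) Ks; exists g.
exists (fun x => \sum_(b <- s) tau b * f b x).
  by apply: energy_dom_sum => b; case: (hf b).
move=> a as_; rewrite (bigD1_seq a)//= [X in _ + X]big1_seq.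
  by rewrite addr0; case: (hf a) => _ /(_ as_)[-> _]; rewrite mulr1.
move=> b /andP[ba bs]; case: (hf b) => _ /(_ bs)[_ ->]//; first by rewrite mulr0.
by rewrite eq_sym.
Qed.

End energy.

(** Boundary points are fixed points, and each of the M contractions has at most one. *)
Lemma boundary_finite : finite_set (boundary F).
Proof.
have [rho /andP[r0 r1] hF] := nf_similitudes hK0.
have fixU i x y : F i x = x -> F i y = y -> x = y.
  move=> xx yy; have := hF i x y; rewrite xx yy => E.
  have e0 : Defs.edist x y = 0 by nra.
  apply/eqP; rewrite -subr_eq0 -normr_le0 -e0; exact: norm_le_edist.
apply: (@sub_finite_set _ _ (\bigcup_(i in [set: 'I_M]) [set x | F i x = x])).
  by move=> x [[i ix] _]; exists i.
apply: bigcup_finite => // i _.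
have [[x ix]|nx] := pselect (exists x, F i x = x).
  apply: (@sub_finite_set _ _ [set x]) => // y /= iy; exact: fixU iy ix.
apply: (@sub_finite_set _ _ set0) => // y /= iy; exfalso; apply: nx; by exists y.
Qed.

Section measure.
Variables (w : 'I_M -> R) (mu0 : probability (borel 'rV[R]_n) R).
Hypothesis hmu0 : self_similar_measure F K0 w mu0.

Lemma open_borel (T : ptopologicalType) (A : set T) : open A -> measurable (A : set (borel T)).
Proof. by move=> oA; exact: sub_sigma_algebra. Qed.

Lemma closed_borel (T : ptopologicalType) (A : set T) : closed A -> measurable (A : set (borel T)).
Proof.
by move=> cA; rewrite -[A]setCK; apply: measurableC; apply: open_borel; exact: closed_openC.
Qed.

(** V contains the part F_w(K0) of K0 for some word w. Pulling V back along w loses one positive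
    weight per letter, until the preimage contains all of K0, which has measure 1. *)
Lemma self_similar_measure_open (V : set 'rV[R]_n) a : open V -> V a -> K0 a ->
  (0 < mu0 V)%E.
Proof.
move=> oV Va Ka.
have [u hu] := nested_small_cell Ka (open_nbhs_nbhs (conj oV Va)).
elim: u V oV hu {Va} => [|i u ih] V oV hu.
  apply: (@lt_le_trans _ _ (mu0 K0)); first by rewrite (sm_support hmu0).
  apply: le_measure; rewrite ?inE; last by move=> x /hu.
    by apply: closed_borel; exact: nested_closed.
  exact: open_borel.
have oVi : open (F i @^-1` V).
  by apply: open_comp => // x _; exact: nested_map_continuous.
have := ih _ oVi hu => h.
rewrite (sm_selfsimilar hmu0 (open_borel oV)) (bigD1 i)//=.
apply: (@lt_le_trans _ _ ((w i)%:E * mu0 (F i @^-1` V))%E).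
  by rewrite mule_gt0// lte_fin; exact: sm_weights hmu0 i.
rewrite leeDl// sume_ge0// => j _; rewrite mule_ge0// lee_fin ltW//.
exact: sm_weights hmu0 j.
Qed.

End measure.
End nested_fractal_cells.

(* What the argument uses of the fractafold. *)
Record energy_space (R : realType) (X : ptopologicalType)
    (D : set (X -> R)) (e : (X -> R) -> (X -> R) -> R)
    (mu : {measure set (borel X) -> \bar R}) : Prop := {
  es_compact : compact [set: X];
  es_hausdorff : hausdorff_space X;
  es_finite : (mu setT < +oo)%E;
  es_support : forall U : set X, open U -> U !=set0 -> (0 < mu U)%E;
  es_continuous : forall u, D u -> continuous u;
  es_zero : D (cst 0);
  es_const : D (cst 1);
  es_null : e (cst 1) (cst 1) = 0;
  es_lin : forall (a : R) u v, D u -> D v -> D (fun x => a * u x + v x);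
  es_sym : forall u v, D u -> D v -> e u v = e v u;
  es_bilin : forall (a : R) u v u', D u -> D v -> D u' ->
    e (fun x => a * u x + v x) u' = a * e u u' + e v u';
  es_ge0 : forall u, D u -> 0 <= e u u;
  es_osc : exists2 C : R, 0 < C & forall u x y, D u -> (u x - u y) ^+ 2 <= C * e u u;
  es_separates : forall x y, x <> y -> exists2 u, D u & u x = 0 /\ u y = 1
}.

(** * From the copies of the fractal to the glued space *)

Section fractafold.
Variables (R : realType) (n M : nat) (F : 'I_M -> 'rV[R]_n -> 'rV[R]_n).
Variables (K0 : set 'rV[R]_n) (hK0 : nested_fractal F K0).
Variables (r : 'I_M -> R) (D0 : set ('rV[R]_n -> R)).
Variables (e0 : ('rV[R]_n -> R) -> ('rV[R]_n -> R) -> R).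
Hypothesis he0 : self_similar_energy F K0 r D0 e0.
Variables (w : 'I_M -> R) (mu0 : probability (borel 'rV[R]_n) R).
Hypothesis hmu0 : self_similar_measure F K0 w mu0.
Variables (X : ptopologicalType) (N : nat) (phi : 'I_N -> 'rV[R]_n -> X).
Hypothesis hX : compact_fractafold F K0 phi.
Variable mu : {measure set (borel X) -> \bar R}.
Hypothesis hmu : fractafold_measure phi K0 mu0 mu.

Let D := fractafold_dom phi D0.
Let e := fractafold_energy phi e0.

Lemma fractafold_copy_continuous i : {within K0, continuous (phi i)}.
Proof. by case: hX. Qed.

Lemma fractafold_closed_image i (A : set 'rV[R]_n) :
  closed (A : set (subspace K0)) -> closed (phi i @` (K0 `&` A)).
Proof.
move=> /closed_subspaceP[V cV VA].
apply: compact_closed; first exact: cf_hausdorff hX.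
apply: continuous_compact.
  by apply: continuous_subspaceW (@fractafold_copy_continuous i) => x [].
rewrite setIC -VA setIC; apply: compact_closedI => //; exact: nf_compact hK0.
Qed.

Lemma fractafold_closed_copy i : closed (phi i @` K0).
Proof. by rewrite -[K0]setIT; apply: fractafold_closed_image; exact: closedT. Qed.

Lemma fractafold_coverE : [set: X] = \bigcup_(i in [set: 'I_N]) (phi i @` K0).
Proof.
apply/seteqP; split => // x _; have [i [a Ka ax]] := cf_covers hX x.
by exists i => //; exists a.
Qed.

Lemma fractafold_compact : compact [set: X].
Proof.
rewrite fractafold_coverE -bigsetU_fset_set//; last exact: finite_finset.
apply: bigsetU_compact => i _; apply: continuous_compact.
  exact: fractafold_copy_continuous.
exact: nf_compact hK0.
Qed.

(** Pasting over finitely many copies: the preimage of a closed set is a finite union of images of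
    compact sets. *)
Lemma fractafold_dom_continuous u : D u -> continuous u.
Proof.
move=> Du; apply/continuous_closedP => A cA.
have -> : u @^-1` A = \bigcup_(i in [set: 'I_N]) (phi i @` (K0 `&` (u \o phi i) @^-1` A)).
  apply/seteqP; split => [x Ax|x [i _ [a [Ka Aa] <-]]] //.
  have [i [a Ka ax]] := cf_covers hX x.
  by exists i => //; exists a => //; split => //=; rewrite ax.
apply: closed_bigcup; first exact: finite_finset.
move=> i _; apply: fractafold_closed_image.
by have /continuous_closedP := se_continuous he0 (Du i); exact.
Qed.

Lemma fractafold_energy_part u i : D u ->
  e0 (fun a => u (phi i a)) (fun a => u (phi i a)) <= e u u.
Proof.
move=> Du; rewrite /e /fractafold_energy (bigD1 i)//= lerDl.
by apply: sumr_ge0 => j _; exact: se_ge0 he0 _ (Du j).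
Qed.

Lemma fractafold_energy_ge0 u : D u -> 0 <= e u u.
Proof. by move=> Du; apply: sumr_ge0 => i _; exact: se_ge0 he0 _ (Du i). Qed.

Let near_copies i j := exists2 C : R, 0 <= C & forall u x y, D u ->
  (phi i @` K0) x -> (phi j @` K0) y -> (u x - u y) ^+ 2 <= C * e u u.

(** Within a copy this is [energy_oscillation], and a bound extends from a copy to any copy that
    meets it. The copies with a bound relative to a given one and the other copies thus have
    disjoint closed unions, and connectedness leaves nothing for the second union. *)
Lemma fractafold_oscillation : exists2 C : R, 0 < C &
  forall u x y, D u -> (u x - u y) ^+ 2 <= C * e u u.
Proof.
have [C0 hC0] := energy_oscillation hK0 he0.
have copy_osc i u x y : D u -> (phi i @` K0) x -> (phi i @` K0) y ->
    (u x - u y) ^+ 2 <= `|C0| * e u u.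
  move=> Du [a Ka <-] [b Kb <-].
  have := hC0 _ a b (Du i) Ka Kb => /le_trans; apply.
  apply: (@le_trans _ _ (`|C0| * e0 (fun a => u (phi i a)) (fun a => u (phi i a)))).
    by rewrite ler_wpM2r ?ler_norm//; exact: se_ge0 he0 _ (Du i).
  by rewrite ler_wpM2l// fractafold_energy_part.
have nearii i : near_copies i i by exists `|C0| => //; exact: copy_osc.
have near_step i j k : near_copies i j ->
    (phi j @` K0) `&` (phi k @` K0) !=set0 -> near_copies i k.
  move=> [C C_ge0 hC] [z [jz kz]]; exists (2 * (C + `|C0|)).
    by rewrite mulr_ge0// addr_ge0.
  move=> u x y Du ix ky.
  have h1 := hC u x z Du ix jz; have h2 := copy_osc k u z y Du kz ky.
  have := sqr_ge0 ((u x - u z) - (u z - u y)); nra.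
have all_near i : [set: X] = \bigcup_(j in [set j | near_copies i j]) (phi j @` K0).
  set A := \bigcup_(j in _) _.
  have cA : closed A.
    by apply: closed_bigcup; [exact: finite_finset|move=> j _; exact: fractafold_closed_copy].
  pose B := \bigcup_(j in [set j | ~ near_copies i j]) (phi j @` K0).
  have cB : closed B.
    by apply: closed_bigcup; [exact: finite_finset|move=> j _; exact: fractafold_closed_copy].
  have AB : A = ~` B.
    apply/seteqP; split => [x [j ij jx] [k ik kx]|x nBx].
      by apply: ik; apply: (near_step i j k ij); exists x.
    have [j [a Ka ax]] := cf_covers hX x.
    have [ij|nij] := pselect (near_copies i j); first by exists j => //; exists a.
    by exfalso; apply: nBx; exists j => //; exists a.
  apply/esym/(cf_connected hX).
  - have [a Ka] := nf_nonempty hK0.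
    by exists (phi i a); exists i; [exact: nearii|exists a].
  - by exists A; rewrite ?setTI// AB; exact: closed_openC.
  - by exists A; rewrite ?setTI.
have near_all i j x : (phi j @` K0) x -> exists2 C : R, 0 <= C &
    forall u y, D u -> (phi i @` K0) y -> (u x - u y) ^+ 2 <= C * e u u.
  move=> jx; have : [set: X] x by [].
  rewrite (all_near i) => -[k [C C_ge0 hC] kx]; exists C => // u y Du iy.
  by rewrite -sqrrN opprB; exact: hC.
have /choice[C1 hC1] : forall ij : 'I_N * 'I_N, exists C : R, 0 <= C /\
    forall u x y, D u -> (phi ij.1 @` K0) x -> (phi ij.2 @` K0) y ->
      (u x - u y) ^+ 2 <= C * e u u.
  move=> [i j] /=; have [a Ka] := nf_nonempty hK0.
  have [C C_ge0 hC] := near_all j i (phi i a) (imageP _ Ka).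
  exists (2 * (C + `|C0|)); split; first by rewrite mulr_ge0// addr_ge0.
  move=> u x y Du ix jy.
  have h1 := hC u y Du jy; have h2 := copy_osc i u x (phi i a) Du ix (imageP _ Ka).
  have := sqr_ge0 ((u x - u (phi i a)) - (u (phi i a) - u y)); nra.
exists (1 + \sum_ij C1 ij).
  by rewrite ltr_pwDl// sumr_ge0// => ij _; case: (hC1 ij).
move=> u x y Du.
have [i [a Ka ax]] := cf_covers hX x; have [j [b Kb bx]] := cf_covers hX y.
have [_ h] := hC1 (i, j).
apply: (le_trans (h u x y Du _ _)); [by exists a|by exists b|].
rewrite ler_wpM2r ?fractafold_energy_ge0//.
rewrite (bigD1 (i, j))//= addrA [1 + _]addrC -addrA lerDl addr_ge0// sumr_ge0// => ij _.
by case: (hC1 ij).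
Qed.

(** Distinct points of one copy are identified only if they are boundary points, and there are
    finitely many of these. *)
Lemma fractafold_fiber_finite i x : finite_set (K0 `&` [set a | phi i a = x]).
Proof.
have [s [_ hs]] := cf_glued hX.
have [[a [Ka ax]]|na] := pselect (exists a, K0 a /\ phi i a = x).
  apply: (@sub_finite_set _ _ ([set a] `|` boundary F)).
    move=> b [Kb bx]; have := (hs i i b a Kb Ka).1 (etrans bx (esym ax)).
    by move=> [[->]|[]]; [left|right].
  by rewrite finite_setU; split => //; exact: boundary_finite hK0.
apply: (@sub_finite_set _ _ set0) => // b [Kb bx]; exfalso; apply: na; by exists b.
Qed.

(** Functions on the copies descend to X when they agree at paired boundary points. Interpolating
    one function [tau] on X, at all boundary points and on the fibres of x and y, makes them
    compatible. *)
Lemma fractafold_separates x y : x <> y -> exists2 u, D u & u x = 0 /\ u y = 1.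
Proof.
move=> xy; pose tau z : R := if `[< z = y >] then 1 else 0.
have /choice[f hf] : forall i, exists f, D0 f /\ forall a, K0 a ->
    (boundary F a \/ phi i a = x \/ phi i a = y) -> f a = tau (phi i a).
  move=> i; pose S := (K0 `&` boundary F) `|` ((K0 `&` [set a | phi i a = x]) `|`
    (K0 `&` [set a | phi i a = y])).
  have fS : finite_set S.
    rewrite !finite_setU; split; last by split; exact: fractafold_fiber_finite.
    by apply: (@sub_finite_set _ _ (boundary F)) => [a []//|]; exact: boundary_finite hK0.
  have [|f Df hf] := energy_interpolation he0 (tau \o phi i) (fset_uniq (fset_set S)).
    by move=> a; rewrite in_fset_set// inE /S /=; tauto.
  exists f; split => // a Ka ha; apply: hf.
  by rewrite in_fset_set// inE /S /=; tauto.
(* An arbitrary preimage of each point; by the gluing relation the value of u does not depend on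
   it. *)
have /choice[c hc] : forall z : X, exists c : 'I_N * 'rV[R]_n, K0 c.2 /\ phi c.1 c.2 = z.
  by move=> z; have [i [a Ka az]] := cf_covers hX z; exists (i, a).
have [s [hs1 hs2]] := cf_glued hX.
pose u z := f (c z).1 (c z).2.
have uE i a : K0 a -> u (phi i a) = f i a.
  move=> Ka; rewrite /u; case: (hc (phi i a)) => Kc Ec.
  case: (hs2 i (c (phi i a)).1 a (c (phi i a)).2 Ka Kc) => /(_ (esym Ec)) h _.
  case: h => [[<- <-]//|[ba sE]].
  have [bs _ _] := hs1 (i, a) ba; rewrite sE /= in bs.
  rewrite (hf (c (phi i a)).1).2 //; last by left.
  by rewrite Ec (hf i).2//; left.
have Du : D u.
  move=> i; have [h _] := se_ext he0 (u := f i) (v := fun a => u (phi i a)) (f i)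
    (fun a Ka => esym (uE i a Ka)).
  exact: h (hf i).1.
exists u => //; split.
- have [Kc Ec] := hc x; rewrite /u (hf (c x).1).2//; last by right; left.
  by rewrite Ec /tau asboolF.
- have [Kc Ec] := hc y; rewrite /u (hf (c y).1).2//; last by right; right.
  by rewrite Ec /tau asboolT.
Qed.

Lemma fractafold_measure_finite : (mu setT < +oo)%E.
Proof.
rewrite (hmu measurableT); apply/lte_sum_pinfty => i _.
by rewrite preimage_setT setIT (sm_support hmu0) ltry.
Qed.

Lemma fractafold_measure_open (U : set X) : open U -> U !=set0 -> (0 < mu U)%E.
Proof.
move=> oU [x Ux]; have [i [a Ka ax]] := cf_covers hX x.
have /open_subspaceP[V oV VE] : open (phi i @^-1` U : set (subspace K0)).
  by have /continuousP := @fractafold_copy_continuous i; exact.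
have [Va _] : (V `&` K0) a by rewrite VE; split => //=; rewrite ax.
rewrite (hmu (open_borel oU)) (bigD1 i)//=.
have -> : mu0 (K0 `&` phi i @^-1` U) = mu0 V.
  have mK0 : measurable (K0 : set (borel 'rV[R]_n)) by apply: closed_borel; exact: nested_closed hK0.
  have mV := open_borel oV.
  rewrite setIC -VE -[in RHS](setIT V) -(setUv K0) setIUr measureU//=.
  - suff -> : mu0 (V `&` ~` K0) = 0%E by rewrite adde0.
    apply/eqP; rewrite -measure_le0 -(_ : mu0 (~` K0) = 0%E).
      by apply: le_measure; rewrite ?inE//; [exact: measurableI mV (measurableC mK0)|exact: measurableC].
    by rewrite probability_setC// (sm_support hmu0) subee.
  - exact: measurableI.
  - by apply: measurableI => //; exact: measurableC.
  - by rewrite setIACA setICr setI0.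
apply: (@lt_le_trans _ _ (mu0 V)).
  exact: (self_similar_measure_open hK0 hmu0 oV Va Ka).
by rewrite leeDl// sume_ge0.
Qed.

Lemma fractafold_energy_space : energy_space D e mu.
Proof.
split.
- exact: fractafold_compact.
- exact: cf_hausdorff hX.
- exact: fractafold_measure_finite.
- exact: fractafold_measure_open.
- exact: fractafold_dom_continuous.
- by move=> i; exact: energy_dom0 he0.
- by move=> i; exact: se_const he0.
- by apply: big1 => i _; apply/(se_null he0 (se_const he0)).
- by move=> a u v Du Dv i; exact: se_lin he0 a _ _ (Du i) (Dv i).
- by move=> u v Du Dv; apply: eq_bigr => i _; exact: se_sym he0 _ _ (Du i) (Dv i).
- move=> a u v u' Du Dv Du'; rewrite /e /fractafold_energy mulr_sumr -big_split/=.
  by apply: eq_bigr => i _; exact: se_bilin he0 a _ _ _ (Du i) (Dv i) (Du' i).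
- exact: fractafold_energy_ge0.
- exact: fractafold_oscillation.
- exact: fractafold_separates.
Qed.

End fractafold.

(** * Square integrable functions and eigenspaces *)

Section square_integrable.
Variables (R : realType) (X : ptopologicalType).
Variable mu : {measure set (borel X) -> \bar R}.
Implicit Types f g h : X -> R.

Definition rinner f g : R := \int[mu]_x (f x * g x).

Lemma continuous_borel f : continuous f -> measurable_fun [set: borel X] (f : borel X -> R).
Proof.
move=> /continuousP cf; apply: (measurability _ (RGenOpens.measurableE R)).
move=> _ [_ [a [b ->] <-]]; rewrite setTI; apply: open_borel.
exact/cf/interval_open.
Qed.

Lemma L2P f : measurable_fun [set: borel X] (f : borel X -> R) ->
  mu.-integrable [set: borel X] (EFin \o (fun x => f x ^+ 2)) -> L2 mu f.
Proof.
move=> mf intf; rewrite /L2/= inE; apply/andP; split; rewrite inE//=.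
rewrite /finite_norm unlock /Lnorm poweR_lty//.
have /integrableP[_] := intf; apply: le_lt_trans.
apply: ge0_le_integral => //=.
- apply/measurable_EFinP.
  apply/(@measurableT_comp _ _ _ _ _ _ (fun x : R => x `^ 2)) => //.
  exact/measurableT_comp.
- by apply/measurable_EFinP; apply: measurableT_comp => //; exact: measurable_funX.
- by move=> x _; rewrite lee_fin powR_mulrn// normrX.
Qed.

Lemma L2_measurable f : L2 mu f -> measurable_fun [set: borel X] (f : borel X -> R).
Proof. by rewrite /L2/= inE => /andP[]; rewrite inE. Qed.

Lemma L2_integrable_mul f g : L2 mu f -> L2 mu g ->
  mu.-integrable [set: borel X] (EFin \o (fun x => f x * g x)).
Proof. by move=> hf hg; apply/Lfun1_integrable; exact: Lfun2_mul_Lfun1. Qed.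

Lemma L2_lin (a : R) f g : L2 mu f -> L2 mu g -> L2 mu (fun x => a * f x + g x).
Proof.
move=> hf hg; apply: L2P.
  apply: measurable_funD; last exact: L2_measurable.
  by apply: measurable_funM => //; exact: L2_measurable.
have -> : EFin \o (fun x => (a * f x + g x) ^+ 2) =
    ((EFin \o (fun x => a ^+ 2 * (f x * f x))%R) \+
     ((EFin \o (fun x => (2 * a) * (f x * g x))%R) \+ (EFin \o (fun x => g x * g x)%R)))%E.
  by apply/funext => x /=; rewrite -!EFinD; congr EFin; ring.
have intZ (c : R) (k : X -> R) : mu.-integrable [set: borel X] (EFin \o k) ->
    mu.-integrable [set: borel X] (EFin \o (fun x => c * k x)).
  by move=> ik; have := integrableZl measurableT c ik.
apply: integrableD => //; first by apply: intZ; exact: L2_integrable_mul.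
apply: integrableD => //; last exact: L2_integrable_mul.
by apply: intZ; exact: L2_integrable_mul.
Qed.

Lemma L2_0 : L2 mu (cst 0).
Proof.
apply: L2P => //; have -> : EFin \o (fun x : X => cst 0 x ^+ 2) = cst 0%E :> (X -> \bar R).
  by apply/funext => x /=; rewrite expr0n.
exact: integrable0.
Qed.

Lemma L2_sum (I : Type) (s : seq I) (c : I -> R) (f : I -> X -> R) :
  (forall i, L2 mu (f i)) -> L2 mu (fun x => \sum_(i <- s) c i * f i x).
Proof.
move=> hf; elim: s => [|i s ih].
  by have := L2_0; congr L2; apply/funext => x; rewrite big_nil.
by have := L2_lin (c i) (hf i) ih; congr L2; apply/funext => x; rewrite big_cons.
Qed.

Lemma rinnerC f g : rinner f g = rinner g f.
Proof. by apply: eq_Rintegral => x _; rewrite mulrC. Qed.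

Lemma rinner_lin (a : R) f g h : L2 mu f -> L2 mu g -> L2 mu h ->
  rinner (fun x => a * f x + g x) h = a * rinner f h + rinner g h.
Proof.
move=> hf hg hh; rewrite /rinner -RintegralZl//; last exact: L2_integrable_mul.
rewrite -RintegralD//; last exact: L2_integrable_mul.
  by apply: eq_Rintegral => x _; ring.
by have := integrableZl measurableT a (L2_integrable_mul hf hh).
Qed.

Lemma rinner_linr (a : R) f g h : L2 mu f -> L2 mu g -> L2 mu h ->
  rinner h (fun x => a * f x + g x) = a * rinner h f + rinner h g.
Proof. by move=> hf hg hh; rewrite rinnerC rinner_lin// !(rinnerC h). Qed.

Lemma rinner_suml (I : Type) (s : seq I) (c : I -> R) (f : I -> X -> R) h :
  (forall i, L2 mu (f i)) -> L2 mu h ->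
  rinner (fun x => \sum_(i <- s) c i * f i x) h = \sum_(i <- s) c i * rinner (f i) h.
Proof.
move=> hf hh; elim: s => [|i s ih].
  rewrite big_nil /rinner (@eq_Rintegral _ _ _ _ _ (cst 0)) ?Rintegral_cst ?mul0r//.
  by move=> x _; rewrite big_nil mul0r.
rewrite big_cons -ih -rinner_lin//; last exact: L2_sum.
by apply: eq_Rintegral => x _; rewrite big_cons.
Qed.

Lemma rinner_ge0 f : 0 <= rinner f f.
Proof. by apply: Rintegral_ge0 => x _; rewrite -expr2 sqr_ge0. Qed.

Lemma rinner_sqD (a b : R) f g : L2 mu f -> L2 mu g ->
  rinner (fun x => a * f x + b * g x) (fun x => a * f x + b * g x) =
  a ^+ 2 * rinner f f + 2 * (a * b) * rinner f g + b ^+ 2 * rinner g g.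
Proof.
move=> hf hg.
have hbg : L2 mu (fun x => b * g x).
  by have := L2_lin b hg L2_0; congr L2; apply/funext => x /=; rewrite addr0.
have zr k : L2 mu k -> rinner (fun x => b * g x) k = b * rinner g k.
  move=> hk; have := rinner_lin b hg L2_0 hk.
  rewrite (_ : (fun x => b * g x + cst 0 x) = (fun x => b * g x)); last first.
    by apply/funext => x /=; rewrite addr0.
  move=> ->; rewrite [X in _ + X](_ : _ = 0) ?addr0//.
  rewrite /rinner (@eq_Rintegral _ _ _ _ _ (cst 0)) ?Rintegral_cst ?mul0r//.
  by move=> x _; rewrite mul0r.
have hab := L2_lin a hf hbg.
rewrite rinner_lin// rinner_linr// zr// rinner_linr// [rinner f (fun x => b * g x)]rinnerC !zr//.
by rewrite [rinner g (fun x => b * g x)]rinnerC zr// [rinner g f]rinnerC; ring.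
Qed.

Lemma quadratic_discriminant (a b c : R) : 0 <= c ->
  (forall t, 0 <= a + 2 * t * b + t ^+ 2 * c) -> b ^+ 2 <= a * c.
Proof.
rewrite le_eqVlt => /predU1P[<- h|c0 h].
  (* For c = 0 the polynomial is affine in t; if b were nonzero, the t chosen next would give it the
     value -1. *)
  have [->|b0] := eqVneq b 0; first by rewrite expr0n mulr0.
  have := h (- (a + 1) / (2 * b)).
  rewrite mulr0 addr0 (_ : 2 * _ * b = - (a + 1)); first by lra.
  by field.
rewrite -(ler_pM2r (_ : 0 < c^-1)) ?invr_gt0// mulfK ?gt_eqF//.
have := h (- b / c); rewrite (_ : a + _ + _ = a - b ^+ 2 / c) ?subr_ge0//.
by field; rewrite gt_eqF.
Qed.

Lemma rinner_cauchy f g : L2 mu f -> L2 mu g ->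
  rinner f g ^+ 2 <= rinner f f * rinner g g.
Proof.
move=> hf hg; apply: quadratic_discriminant; first exact: rinner_ge0.
move=> t; have := rinner_sqD 1 t hf hg; rewrite expr1n !mul1r => <-.
exact: rinner_ge0.
Qed.

Lemma rinner_eq0_ae f : L2 mu f -> rinner f f = 0 ->
  mu.-negligible ([set x | f x <> 0] : set (borel X)).
Proof.
move=> hf f0; have intf := L2_integrable_mul hf hf.
have mf : measurable_fun [set: borel X] (EFin \o (fun x => f x * f x)).
  by case/integrableP: intf.
have : (\int[mu]_x `|(f x * f x)%:E| = 0)%E.
  have fin := integrable_fin_num measurableT intf.
  have E : (\int[mu]_x (f x * f x)%:E)%E = (rinner f f)%:E by rewrite /rinner /Rintegral fineK.
  rewrite f0 in E; rewrite -[RHS]E.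
  by apply: eq_integral => x _; rewrite gee0_abs// lee_fin -expr2 sqr_ge0.
move=> /(ae_eq_integral_abs _ measurableT mf) [N [mN N0 hN]].
exists N; split => // x fx; apply: hN => /= h; apply: fx.
by have [] := h I => /eqP; rewrite mulf_eq0 orbb => /eqP.
Qed.

Variables (D : set (X -> R)) (e : (X -> R) -> (X -> R) -> R).
Hypothesis es : energy_space D e mu.

Lemma continuous_bounded f : continuous f -> exists2 B, 0 < B & forall x, `|f x| <= B.
Proof.
move=> cf; have : compact (f @` [set: X]).
  by apply: continuous_compact; [exact: continuous_subspaceT|exact: es_compact es].
move=> /compact_bounded[B [_ hB]]; exists (`|B| + 1); first by rewrite ltr_wpDl.
move=> x; apply: hB; last by exists x.
by rewrite (le_lt_trans (ler_norm _))// ltrDl.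
Qed.

Lemma bounded_integrable f B : measurable_fun [set: borel X] (f : borel X -> R) ->
  (forall x, `|f x| <= B) -> mu.-integrable [set: borel X] (EFin \o f).
Proof.
move=> mf fB; apply: measurable_bounded_integrable => //.
  exact: es_finite es.
exists B; split; first exact: num_real.
by move=> c Bc x _ /=; rewrite (le_trans (fB x))// ltW.
Qed.

Lemma bounded_L2 f B : measurable_fun [set: borel X] (f : borel X -> R) ->
  (forall x, `|f x| <= B) -> L2 mu f.
Proof.
move=> mf fB; apply: L2P => //; apply: (@bounded_integrable _ (B ^+ 2)).
  exact: measurable_funX.
move=> x; rewrite normrX lerXn2r ?nnegrE//.
exact: le_trans (normr_ge0 _) (fB x).
Qed.

Lemma continuous_L2 f : continuous f -> L2 mu f.
Proof.
move=> cf; have [B _ fB] := continuous_bounded cf.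
by apply: bounded_L2 fB; exact: continuous_borel.
Qed.

Lemma continuous_integrable f : continuous f -> mu.-integrable [set: borel X] (EFin \o f).
Proof.
move=> cf; have [B _ fB] := continuous_bounded cf.
by apply: bounded_integrable fB; exact: continuous_borel.
Qed.

Lemma dom_L2 u : D u -> L2 mu u.
Proof. by move=> /(es_continuous es)/continuous_L2. Qed.

(** A continuous f that vanishes almost everywhere is nonzero on an open null set, and mu charges
    every nonempty open set. *)
Lemma rinner_eq0 f : continuous f -> rinner f f = 0 -> f = cst 0.
Proof.
move=> cf /(rinner_eq0_ae (continuous_L2 cf)) [N [mN N0 hN]].
apply/funext => x /=; apply: contrapT => fx.
have oU : open [set y | f y <> 0].
  rewrite (_ : [set y | f y <> 0] = f @^-1` ~` [set 0])//.
  apply: open_comp; first by move=> y _; exact: cf.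
  by apply: closed_openC; exact: closed_eq.
have := es_support es oU (ex_intro _ x fx); rewrite ltNge => /negP; apply.
rewrite -N0; apply: le_measure; rewrite ?inE//; exact: open_borel.
Qed.

Definition mass : R := fine (mu setT).

Lemma mass_ge0 : 0 <= mass.
Proof. by rewrite fine_ge0. Qed.

Lemma Rintegral_le_const f B : mu.-integrable [set: borel X] (EFin \o f) ->
  (forall x, f x <= B) -> \int[mu]_x f x <= B * mass.
Proof.
move=> intf fB; rewrite /mass -Rintegral_cst//; apply: le_Rintegral => //.
by apply: continuous_integrable => x; exact: cvg_cst.
Qed.

End square_integrable.

(** * Eigenspaces and the kernels of the spectral projections *)

Section eigenspaces.
Variables (R : realType) (X : ptopologicalType).
Variable mu : {measure set (borel X) -> \bar R}.
Variables (D : set (X -> R)) (e : (X -> R) -> (X -> R) -> R).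
Hypothesis es : energy_space D e mu.
Implicit Types (u v f : X -> R) (l a : R).

Lemma eigenspaceE l v : Defs.eigenspace D e mu l v <->
  D v /\ forall w, D w -> e v w = l * rinner mu v w.
Proof.
split=> [[Dv _ hv]|[Dv hv]].
  split=> // w Dw; rewrite hv// /rinner.
  rewrite (@eq_Rintegral _ _ _ _ _ (fun x : borel X => (- l) * (v x * w x))); last by move=> x _; ring.
  rewrite RintegralZl// ?mulNr ?opprK//.
  by apply: L2_integrable_mul; [exact: (dom_L2 es Dv)|exact: (dom_L2 es Dw)].
split=> //.
  have := L2_lin (- l) (dom_L2 es Dv) (L2_0 mu).
  by congr L2; apply/funext => x /=; rewrite addr0 mulNr.
move=> w Dw; rewrite hv// /rinner.
rewrite [in RHS](@eq_Rintegral _ _ _ _ _ (fun x : borel X => (- l) * (v x * w x))); last by move=> x _; ring.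
rewrite RintegralZl// ?mulNr ?opprK//.
by apply: L2_integrable_mul; [exact: (dom_L2 es Dv)|exact: (dom_L2 es Dw)].
Qed.

Lemma eigenspace_dom l v : Defs.eigenspace D e mu l v -> D v.
Proof. by move=> /eigenspaceE[]. Qed.

Lemma eigenspace_continuous l v : Defs.eigenspace D e mu l v -> continuous v.
Proof. by move=> /eigenspace_dom/(es_continuous es). Qed.

Lemma eigenspace_L2 l v : Defs.eigenspace D e mu l v -> L2 mu v.
Proof. by move=> /eigenspace_dom Dv; exact: (dom_L2 es Dv). Qed.

Lemma eigenspace_lin l a u v : Defs.eigenspace D e mu l u -> Defs.eigenspace D e mu l v ->
  Defs.eigenspace D e mu l (fun x => a * u x + v x).
Proof.
move=> /[dup] /eigenspace_L2 Lu /eigenspaceE[Du hu] /[dup] /eigenspace_L2 Lv /eigenspaceE[Dv hv].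
apply/eigenspaceE; split; first exact: es_lin es a _ _ Du Dv.
move=> w Dw; rewrite (es_bilin es)// hu// hv// rinner_lin//; first by ring.
exact: (dom_L2 es Dw).
Qed.

Lemma eigenspace0 l : Defs.eigenspace D e mu l (cst 0).
Proof.
apply/eigenspaceE; split; first exact: es_zero es.
move=> w Dw; have := es_bilin es (-1) (es_zero es) (es_zero es) Dw.
rewrite (_ : (fun x => _) = cst 0); last by apply/funext => x /=; rewrite mulr0 addr0.
move=> h; have -> : e (cst 0) w = 0 by lra.
rewrite /rinner (@eq_Rintegral _ _ _ _ _ (cst 0)) ?Rintegral_cst ?mul0r ?mulr0//.
by move=> x _; rewrite mul0r.
Qed.

Lemma eigenspace_orthogonal l l' u v : l != l' ->
  Defs.eigenspace D e mu l u -> Defs.eigenspace D e mu l' v -> rinner mu u v = 0.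
Proof.
move=> ll' /eigenspaceE[Du hu] /eigenspaceE[Dv hv].
have := hu v Dv; rewrite (es_sym es)// hv// rinnerC => h.
have : (l - l') * rinner mu u v = 0 by rewrite mulrBl -h subrr.
by move/eqP; rewrite mulf_eq0 subr_eq0 (negbTE ll') => /eqP.
Qed.

Lemma eigenspace_neg l v : l < 0 -> Defs.eigenspace D e mu l v -> v = cst 0.
Proof.
move=> l0 /[dup] /eigenspace_continuous cv /eigenspaceE[Dv hv].
apply: (rinner_eq0 es cv); have := es_ge0 es Dv; rewrite hv// => h.
by have := rinner_ge0 mu v; nra.
Qed.

(** For the right-hand side 0, the equation that defines the spectrum would have two solutions, v
    and 0. *)
Lemma eigenspace_spectrum l v : Defs.eigenspace D e mu l v -> v <> cst 0 ->
  spectrum D e mu l.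
Proof.
move=> Ev v0 h; apply: v0; have [u [_ uU]] := h _ (L2_0 mu).
have weak u' : Defs.eigenspace D e mu l u' ->
    weak_laplacian D e mu u' (fun x => - (l * u' x) - cst 0 x).
  rewrite /Defs.eigenspace/=; congr weak_laplacian.
  by apply/funext => x /=; rewrite subr0.
by rewrite -(uU _ (weak _ Ev)) (uU _ (weak _ (eigenspace0 l))).
Qed.

Section projection.
Variables (l : R) (P : X -> X -> R).
Hypothesis hP : spectral_projection_kernel D e mu l P.

Definition kernel_op f : X -> R := fun x => rinner mu (P x) f.

Lemma kernel_continuous x : continuous (P x).
Proof.
move=> y; have /= c := @spk_continuous _ _ _ _ _ _ _ hP (x, y).
apply: (@continuous_comp _ _ _ (fun y => (x, y)) (fun z : X * X => P z.1 z.2)); last exact: c.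
by apply: cvg_pair => /=; [exact: cvg_cst|exact: cvg_id].
Qed.

Lemma kernel_diag_continuous : continuous (fun x => P x x).
Proof.
move=> y; have /= c := @spk_continuous _ _ _ _ _ _ _ hP (y, y).
apply: (@continuous_comp _ _ _ (fun y => (y, y)) (fun z : X * X => P z.1 z.2)); last exact: c.
by apply: cvg_pair => /=; exact: cvg_id.
Qed.

Lemma kernel_L2 x : L2 mu (P x).
Proof. by apply: (continuous_L2 es); exact: kernel_continuous. Qed.

Lemma kernel_op_eigen f : L2 mu f -> Defs.eigenspace D e mu l (kernel_op f).
Proof. exact: spk_range hP f. Qed.

Lemma kernel_op_orthogonal f v : L2 mu f -> Defs.eigenspace D e mu l v ->
  rinner mu (fun x => -1 * kernel_op f x + f x) v = 0.
Proof.
move=> hf hv; rewrite -[RHS](spk_orthogonal hP hf hv) /rinner.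
by apply: eq_Rintegral => x _; rewrite /kernel_op /rinner mulN1r addrC.
Qed.

Lemma kernel_op_id v x : Defs.eigenspace D e mu l v -> kernel_op v x = v x.
Proof.
move=> hv; have Lv := eigenspace_L2 hv.
have hd := eigenspace_lin (-1) (kernel_op_eigen Lv) hv.
have := rinner_eq0 es (eigenspace_continuous hd) (kernel_op_orthogonal Lv hd).
by move=> /(congr1 (fun f => f x)) /=; lra.
Qed.

Lemma kernel_op_perp f x : L2 mu f ->
  (forall v, Defs.eigenspace D e mu l v -> rinner mu f v = 0) -> kernel_op f x = 0.
Proof.
move=> hf fE; have h := kernel_op_eigen hf.
have := kernel_op_orthogonal hf h.
rewrite rinner_lin//; try exact: eigenspace_L2 h.
rewrite (fE _ h) addr0 => h0.
have := rinner_eq0 es (eigenspace_continuous h) (_ : rinner mu _ _ = 0).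
by move=> ->//; lra.
Qed.

(** The difference f between P(x, .) and its own projection is orthogonal to the eigenspace, so the
    projection of f vanishes at x; this value is the product of P(x, .) with f, and it follows that
    f is orthogonal to itself. Symmetry and the reproducing property of P, which its definition does
    not state, follow from this. *)
Lemma kernel_eigen x : Defs.eigenspace D e mu l (P x).
Proof.
have Lk := kernel_L2 x; have hk := kernel_op_eigen Lk.
have Lkk := eigenspace_L2 hk.
have perp := fun v => @kernel_op_orthogonal (P x) v Lk.
pose f y := -1 * kernel_op (P x) y + P x y.
have Lf : L2 mu f by exact: L2_lin.
have h1 : rinner mu (P x) f = 0 by exact: (kernel_op_perp x Lf perp).
have h2 : rinner mu f f = 0.
  rewrite {1}/f rinner_lin// h1 addr0 (rinnerC _ (kernel_op (P x))).
  by rewrite (perp _ hk) mulr0.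
have cf : continuous f.
  move=> y; apply: cvgD; last exact: kernel_continuous.
  by apply: cvgMr; exact: eigenspace_continuous hk y.
have f0 := rinner_eq0 es cf h2.
have -> : P x = kernel_op (P x).
  by apply/funext => y; have := congr1 (fun g => g y) f0; rewrite /f /=; lra.
exact: hk.
Qed.

Lemma kernel_reproducing x y : P x y = rinner mu (P y) (P x).
Proof. by rewrite -[LHS](kernel_op_id _ (kernel_eigen x)). Qed.

Lemma kernel_sym x y : P x y = P y x.
Proof. by rewrite kernel_reproducing rinnerC -kernel_reproducing. Qed.

Lemma kernel_diag_ge0 x : 0 <= P x x.
Proof. by rewrite kernel_reproducing rinner_ge0. Qed.

(** Positivity of the square norms of P(x, .) + P(y, .) and P(x, .) - P(y, .). It reduces absolute
    sums off the diagonal to diagonal ones, whose terms are nonnegative. *)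
Lemma kernel_le_diag x y : `|P x y| <= (P x x + P y y) / 2.
Proof.
have := rinner_sqD 1 1 (kernel_L2 x) (kernel_L2 y).
have := rinner_sqD 1 (-1) (kernel_L2 x) (kernel_L2 y).
rewrite -!kernel_reproducing [P y x]kernel_sym => h1 h2.
have := rinner_ge0 mu (fun z => 1 * P x z + 1 * P y z).
have := rinner_ge0 mu (fun z => 1 * P x z + -1 * P y z).
by rewrite h1 h2 ler_norml; lra.
Qed.

Lemma kernel_op_other l' v x : l != l' -> Defs.eigenspace D e mu l' v -> kernel_op v x = 0.
Proof. by move=> ll' hv; exact: eigenspace_orthogonal ll' (kernel_eigen x) hv. Qed.

(** The trace of a nonzero projection is at least 1: integrate P(x,y)^2 <= P(x,x) P(y,y) in y and
    divide by P(x,x). *)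
Lemma kernel_trace_ge1 x : P x x != 0 -> 1 <= \int[mu]_y P y y.
Proof.
move=> Pxx; have Lk := kernel_L2 x; pose c := rinner mu (P x) (P x).
have c0 : 0 < c by rewrite lt_neqAle rinner_ge0 andbT eq_sym /c -kernel_reproducing.
have key y : P x y * P x y <= c * P y y.
  rewrite -expr2 {1}kernel_reproducing.
  have := rinner_cauchy (kernel_L2 y) Lk.
  by rewrite -(kernel_reproducing y y) mulrC.
rewrite -(ler_pM2l c0) mulr1 {1}/c /rinner.
have cd : mu.-integrable [set: borel X] (EFin \o (fun y => P y y)).
  exact: (continuous_integrable es kernel_diag_continuous).
rewrite -RintegralZl//; apply: le_Rintegral => //.
  exact: L2_integrable_mul.
by have := integrableZl measurableT c cd.
Qed.

Lemma kernel_neg x y : l < 0 -> P x y = 0.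
Proof. by move=> l0; rewrite (eigenspace_neg l0 (kernel_eigen x)). Qed.

End projection.
End eigenspaces.

(** * Summation over dyadic scales *)

Section rapidly_cauchy.
Variable R : realType.
Implicit Types (u tau : nat -> R) (A B b sigma delta : R).

Lemma cauchy_rate u tau : tau @ \oo --> (0 : R) ->
  (forall n m, (n <= m)%N -> `|u m - u n| <= tau n) ->
  cvg (u @ \oo) /\ forall n, `|lim (u @ \oo) - u n| <= tau n.
Proof.
move=> tau0 hu; have cu : cvg (u @ \oo).
  apply: R_complete; apply: cauchy_exP => eps e0.
  have [N _ hN] := (cvgr_lt 0 tau0) _ e0.
  exists (u N); exists N => // n /= Nn; rewrite -ball_normE /= distrC.
  by apply: le_lt_trans (hu _ _ Nn) (hN N (leqnn N)).
split => // n; apply: (ler_cvg_to (cvg_norm (cvgB cu (cvg_cst (u n)))) (cvg_cst (tau n))).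
by near=> m; apply: hu; near: m; exact: nbhs_infty_ge.
Unshelve. all: by end_near. Qed.

Lemma pow2_powR delta n : (2 ^+ n) `^ delta = (2 `^ delta) ^+ n :> R.
Proof.
by rewrite -powR_mulrn// -powRrM mulrC powRrM powR_mulrn// powR_ge0.
Qed.

Lemma geometric_tail u B b : 0 <= B -> 0 < b < 1 ->
  (forall n, `|u n.+1 - u n| <= B * b ^+ n.+1) ->
  cvg (u @ \oo) /\ forall n, `|lim (u @ \oo) - u n| <= B / (1 - b) * b ^+ n.
Proof.
move=> B0 /andP[b0 b1] hu; apply: cauchy_rate.
  rewrite -[X in _ --> X](mulr0 (B / (1 - b))); apply: cvgMr.
  by apply: cvg_expr; rewrite ger0_norm// ltW.
have c0 : 0 <= B / (1 - b) by rewrite divr_ge0// subr_ge0 ltW.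
move=> n m nm; suff : `|u m - u n| <= B / (1 - b) * (b ^+ n - b ^+ m).
  by move/le_trans; apply; rewrite ler_wpM2l// gerBl exprn_ge0// ltW.
rewrite -(subnK nm); elim: (m - n)%N => [|k ih].
  by rewrite add0n !subrr normr0 mulr0.
rewrite addSn -[u _ - _](subrKA (u (k + n)%N)) (le_trans (ler_normD _ _))//.
rewrite (le_trans (lerD (hu _) ih))// exprS.
have bk : 0 <= b ^+ (k + n) by rewrite exprn_ge0// ltW.
rewrite (_ : B / (1 - b) * (b ^+ n - b * b ^+ (k + n)) =
   B * b ^+ (k + n) + B / (1 - b) * (b ^+ n - b ^+ (k + n))); last first.
  by field; lra.
by rewrite lerD2r ler_wpM2l// ler_piMl// ltW.
Qed.

Lemma geometric_head u B a : 0 <= B -> 1 < a ->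
  (forall n, `|u n.+1 - u n| <= B * a ^+ n.+1) ->
  forall n, `|u n - u 0%N| <= B * a / (a - 1) * a ^+ n.
Proof.
move=> B0 a1 hu; have c0 : 0 <= B * a / (a - 1).
  by rewrite divr_ge0 ?mulr_ge0//; lra.
elim=> [|n ih]; first by rewrite subrr normr0 mulr_ge0 ?exprn_ge0//; lra.
rewrite -[u n.+1 - _](subrKA (u n)) (le_trans (ler_normD _ _))//.
rewrite (le_trans (lerD (hu _) ih))// exprS le_eqVlt; apply/orP; left; apply/eqP.
by field; lra.
Qed.

Lemma dyadic_scale (sigma : R) : 0 < sigma < 1 ->
  exists n : nat, 2 ^+ n <= sigma^-1 /\ sigma^-1 < 2 ^+ n.+1.
Proof.
move=> /andP[s0 s1]; pose Q n := (2 ^+ n <= sigma^-1).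
have i0 : 0 <= sigma^-1 by rewrite invr_ge0 ltW.
have Q0 : Q 0%N by rewrite /Q expr0 invf_ge1// ltW.
have ub n : Q n -> (n <= Num.bound sigma^-1)%N.
  move=> Qn; rewrite -(ler_nat R) (le_trans _ (ltW (archi_boundP i0)))//.
  by rewrite (le_trans _ Qn)// -natrX ler_nat ltnW// ltn_expl.
have [n Qn hn] := ex_maxnP (ex_intro Q 0%N Q0) ub.
exists n; split => //; rewrite ltNge; apply/negP => /hn; by rewrite ltnn.
Qed.

(** The first bound is used while 2^n <= 1 / sigma, where the increments grow by the ratio 2^delta >
    1, and the second one beyond, where they decay by the ratio 2^delta / 2 < 1. Both geometric sums
    are dominated by the crossover, of size sigma^(-delta). *)
Lemma dyadic_sum delta : 0 < delta < 1 -> exists2 C : R, 0 < C &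
  forall u A B sigma, 0 < sigma -> 0 <= A -> `|u 0%N| <= B ->
    (forall n, `|u n.+1 - u n| <= A * (2 ^+ n.+1) `^ delta /\
       `|u n.+1 - u n| <= A * (2 ^+ n.+1) `^ delta / (2 ^+ n.+1 * sigma)) ->
    [/\ cvg (u @ \oo),
      `|lim (u @ \oo)| <= B + C * A * sigma `^ (- delta) &
      forall n, `|lim (u @ \oo) - u n| <= C * A / sigma * (2 `^ delta / 2) ^+ n].
Proof.
move=> /andP[d0 d1]; pose a : R := 2 `^ delta; pose b := a / 2.
have gt1 (r : R) : 0 < r -> 1 < 2 `^ r.
  move=> r0; have := @gt0_ltr_powR R r r0 1 2; rewrite powR1; apply; rewrite ?nnegrE//.
  by rewrite ltr1n.
have a1 : 1 < a by exact: gt1.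
have b01 : 0 < b < 1.
  rewrite divr_gt0 ?(lt_trans ltr01 a1)//= ltr_pdivrMr// mul1r.
  have E : delta + (1 - delta) = 1 by ring.
  have h2 : 2 `^ (delta + (1 - delta)) = a * 2 `^ (1 - delta).
    by apply: powRD; rewrite E oner_eq0.
  rewrite E powRr1 in h2; last by [].
  rewrite [ltRHS]h2.
  by rewrite ltr_pMr ?(lt_trans ltr01 a1)// gt1// subr_gt0.
have b1 : 0 < 1 - b by case/andP: b01 => *; lra.
have a10 : 0 < a - 1 by lra.
pose C := a * a / (a - 1) + (1 - b)^-1.
have C0 : 0 < C by rewrite addr_gt0 ?invr_gt0// divr_gt0// mulr_gt0//; lra.
exists C => // u A B sigma s0 A0 uB hu.
have As : 0 <= A / sigma by rewrite divr_ge0// ltW.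
have hu1 n : `|u n.+1 - u n| <= A * a ^+ n.+1.
  by have [h _] := hu n; rewrite -pow2_powR.
have hu2 n : `|u n.+1 - u n| <= A / sigma * b ^+ n.+1.
  have [_ h] := hu n; apply: (le_trans h).
  rewrite pow2_powR -/a /b exprMn exprVn invfM le_eqVlt; apply/orP; left; apply/eqP; ring.
have [cu tail] := geometric_tail As b01 hu2.
have head := geometric_head A0 a1 hu1.
have bC : (1 - b)^-1 <= C by rewrite /C lerDr divr_ge0 ?mulr_ge0//; lra.
have aC : 0 <= a * a / (a - 1) by rewrite divr_ge0 ?mulr_ge0//; lra.
have b0 : 0 <= b by case/andP: b01 => /ltW.
split => //; last first.
  move=> n; rewrite (le_trans (tail n))// ler_wpM2r ?exprn_ge0//.
  by rewrite [leLHS]mulrC -[leRHS]mulrA; apply: ler_wpM2r.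
have sd0 : 0 <= sigma `^ (- delta) by exact: powR_ge0.
(* For sigma >= 1 there is no growing part: the tail starts at 0, and sigma^-1 <= sigma^(-delta). *)
have [s1|s1] := leP 1 sigma.
  have := tail 0%N; rewrite expr0 mulr1 => t0.
  rewrite -[lim _](subrK (u 0%N)) addrC (le_trans (ler_normD _ _))// lerD//.
  rewrite (le_trans t0)// [leLHS](_ : _ = (1 - b)^-1 * A * sigma^-1); last by ring.
  rewrite ler_pM ?mulr_ge0 ?invr_ge0 ?(ltW s0) ?(ltW b1)//; first by rewrite ler_wpM2r.
  by rewrite -powR_inv1 ?(ltW s0)// ler_powR// lerN2 ltW.
have [n [n1 n2]] := @dyadic_scale sigma (introT andP (conj s0 s1)).
have sE : sigma `^ (- delta) = sigma^-1 `^ delta.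
  by rewrite -powR_inv1 ?(ltW s0)// -powRrM mulN1r.
have si : 0 < sigma^-1 by rewrite invr_gt0.
have an : a ^+ n <= sigma `^ (- delta).
  by rewrite /a -pow2_powR sE ge0_ler_powR ?nnegrE ?exprn_ge0// ltW.
have bn : b ^+ n.+1 / sigma <= sigma `^ (- delta).
  pose y := 2 ^+ n.+1 * sigma.
  have y1 : 1 <= y by rewrite /y -ler_pdivrMr// mul1r ltW.
  have -> : b ^+ n.+1 / sigma = y `^ delta * sigma `^ (- delta) / y.
    rewrite sE -powRM ?(le_trans ler01 y1) ?(ltW si)// /y mulfK ?gt_eqF//.
    rewrite pow2_powR -/a /b exprMn exprVn; field.
    by rewrite gt_eqF// expf_eq0 pnatr_eq0 andbF.
  have y0 : 0 < y by lra.
  by rewrite ler_pdivrMr// mulrC ler_wpM2l// ler1_powR// ltW.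
rewrite -[lim _](subrK (u n.+1)) -[u n.+1 in X in `|_ + X|](subrK (u 0%N)).
rewrite [leRHS](_ : _ = (1 - b)^-1 * A * sigma `^ (- delta) +
   (A * (a * a / (a - 1)) * sigma `^ (- delta) + B)); last by rewrite /C; ring.
rewrite (le_trans (ler_normD _ _))// lerD//.
  rewrite (le_trans (tail _))// [leLHS](_ : _ = (1 - b)^-1 * A * (b ^+ n.+1 / sigma)); last by ring.
  by rewrite ler_wpM2l// mulr_ge0 ?invr_ge0// ltW.
rewrite (le_trans (ler_normD _ _))// lerD//.
rewrite (le_trans (head _))// exprS.
rewrite [leLHS](_ : _ = A * (a * a / (a - 1)) * a ^+ n); last by ring.
by rewrite ler_wpM2l// mulr_ge0.
Qed.

End rapidly_cauchy.

(** * Bounds for the resistance *)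

Section resistance_metric.
Variables (R : realType) (X : ptopologicalType).
Variable mu : {measure set (borel X) -> \bar R}.
Variables (D : set (X -> R)) (e : (X -> R) -> (X -> R) -> R).
Hypothesis es : energy_space D e mu.
Implicit Types (x y : X) (u : X -> R).

Let admissible x y : set R :=
  [set e u u | u in [set u | [/\ D u, u x = 0 & u y = 1]]].

(** By Cauchy-Schwarz for the semidefinite form, e(1, 1) = 0 forces e(1, v) = 0 for all v, so
    additive constants do not change the energy. *)
Lemma energy_affine u (a b : R) : D u ->
  D (fun x => a * u x + b) /\ e (fun x => a * u x + b) (fun x => a * u x + b) = a ^+ 2 * e u u.
Proof.
move=> Du; have D1 := es_const es.
have Dc (c : R) : D (fun=> c).
  have := es_lin es c D1 (es_zero es).
  by congr D; apply/funext => x /=; rewrite mulr1 addr0.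
have ez v : D v -> e (cst 0) v = 0.
  move=> Dv; have := es_bilin es 0 D1 (es_zero es) Dv; rewrite mul0r add0r.
  have := es_bilin es (-1) (es_zero es) (es_zero es) Dv.
  rewrite (_ : (fun x => _) = cst 0); last by apply/funext => x /=; rewrite mulr0 addr0.
  by move=> h _; lra.
have ec (c : R) v : D v -> e (fun=> c) v = c * e (cst 1) v.
  move=> Dv; have := es_bilin es c D1 (es_zero es) Dv; rewrite ez// addr0 => <-.
  by congr e; apply/funext => x /=; rewrite mulr1 addr0.
have e1 v : D v -> e (cst 1) v = 0.
  move=> Dv; apply/eqP; rewrite -sqrf_eq0 -[_ == 0]orbF; apply/orP; left.
  rewrite eq_le sqr_ge0 andbT -[leRHS](mul0r (e v v)) -(es_null es).
  rewrite mulrC; apply: quadratic_discriminant => [|t]; first by rewrite (es_null es).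
  have Dt := es_lin es t D1 Dv.
  have := es_ge0 es Dt; rewrite (es_bilin es)// (es_sym es D1)// (es_sym es Dv)//.
  rewrite !(es_bilin es)// (es_null es) [e v (cst 1)](es_sym es)//; lra.
have Dau : D (fun x => a * u x + b).
  by have := es_lin es a Du (Dc b).
split => //.
rewrite (es_bilin es)// ec// e1// mulr0 addr0 (es_sym es)//.
by rewrite (es_bilin es)// ec// e1// mulr0 addr0 expr2 mulrA.
Qed.

Lemma admissible_lbound : exists2 C : R, 0 < C &
  forall x y, lbound (admissible x y) C^-1.
Proof.
have [C C0 hC] := es_osc es; exists C => // x y _ [u [Du ux uy] <-].
have := hC u x y Du; rewrite ux uy sub0r sqrrN expr1n => h.
by rewrite -[leLHS]mulr1 ler_pdivrMl.
Qed.

Lemma resistance_le : exists2 C : R, 0 < C & forall x y, resistance D e x y <= C.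
Proof.
have [C C0 hC] := admissible_lbound; exists C => // x y; rewrite /resistance -/(admissible x y).
have [->|/set0P ne] := eqVneq (admissible x y) set0; first by rewrite inf0 invr0 ltW.
have h : C^-1 <= inf (admissible x y) by apply: lb_le_inf => //; exact: hC.
rewrite -[leRHS]invrK lef_pV2// ?posrE ?invr_gt0//.
by rewrite (lt_le_trans _ h)// invr_gt0.
Qed.

(** u is normalised to the values 0 at x and 1 at y. The uniform lower bound for admissible energies
    keeps the infimum positive, so that its inverse is not the default value 0. *)
Lemma le_resistance x y u : D u -> u x != u y ->
  0 < resistance D e x y /\ (u x - u y) ^+ 2 <= resistance D e x y * e u u.
Proof.
move=> Du uxy; have [C C0 hC] := admissible_lbound.
have q0 : u y - u x != 0 by rewrite subr_eq0 eq_sym.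
pose v z := (u y - u x)^-1 * u z + - u x / (u y - u x).
have [Dv ev] := energy_affine ((u y - u x)^-1) (- u x / (u y - u x)) Du.
have av : admissible x y ((u y - u x)^-1 ^+ 2 * e u u).
  by exists v; [split => //; rewrite /v; field|exact: ev].
have hinf : inf (admissible x y) <= (u y - u x)^-1 ^+ 2 * e u u.
  by apply: ge_inf => //; exists C^-1; exact: hC.
have inf0 : 0 < inf (admissible x y).
  apply: (@lt_le_trans _ _ C^-1); first by rewrite invr_gt0.
  by apply: lb_le_inf; [exists ((u y - u x)^-1 ^+ 2 * e u u)|exact: hC].
rewrite /resistance -/(admissible x y) invr_gt0; split => //.
rewrite ler_pdivlMl//; have q2 : 0 < (u y - u x) ^+ 2 by rewrite lt_neqAle sqr_ge0 eq_sym sqrf_eq0 q0.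
have -> : (u x - u y) ^+ 2 = (u y - u x) ^+ 2 by ring.
rewrite -ler_pdivlMr// (le_trans hinf)// exprVn mulrC.
exact: lexx.
Qed.

Lemma resistance_refl x : resistance D e x x = 0.
Proof.
rewrite /resistance [X in inf X](_ : _ = set0) ?inf0 ?invr0//.
apply/seteqP; split => // r [u [_ ux0 ux1] _].
by move: ux1; rewrite ux0 => /eqP; rewrite eq_sym oner_eq0.
Qed.

Lemma resistance_gt0 x y : x <> y -> 0 < resistance D e x y.
Proof.
move=> xy; have [u Du [ux uy]] := es_separates es xy.
by have [] := @le_resistance x y u Du; rewrite // ux uy eq_sym oner_neq0.
Qed.

(** A single u with u(x0) = 0 and u(y0) = 1 serves for all nearby pairs: its values there stay 1/3
    apart, whence 1/9 in the numerator. The 1 added to the energy keeps the denominator positive. *)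
Lemma resistance_near x0 y0 : x0 <> y0 -> exists2 c : R, 0 < c &
  exists U V, [/\ open U, U x0, open V, V y0 &
    forall x y, U x -> V y -> c <= resistance D e x y].
Proof.
move=> xy; have [u Du [ux uy]] := es_separates es xy.
have cu := es_continuous es Du.
have E0 := es_ge0 es Du.
have E1 : 0 < e u u + 1 by lra.
exists (9^-1 / (e u u + 1)); first by rewrite divr_gt0.
exists (u @^-1` [set r | r < 3^-1]), (u @^-1` [set r | 2 / 3 < r]); split.
- by apply: open_comp => [z _|]; [exact: cu|exact: open_lt].
- by rewrite /= ux.
- by apply: open_comp => [z _|]; [exact: cu|exact: open_gt].
- by rewrite /= uy; lra.
move=> x y /= hx hy.
have [|r0 hr] := @le_resistance x y u Du; first by apply/eqP; lra.
by rewrite ler_pdivrMr//; nra.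
Qed.

Lemma resistance_away x0 (U : set X) : open U -> U x0 -> exists2 c : R, 0 < c &
  forall y, ~ U y -> c <= resistance D e x0 y.
Proof.
move=> oU Ux0.
have cK : compact (~` U).
  apply: (@subclosed_compact _ _ [set: X]) => //; first exact: open_closedC.
  exact: es_compact es.
have /choice[f hf] : forall y, exists cV : R * set X, ~ U y ->
    [/\ 0 < cV.1, open cV.2, cV.2 y & forall z, cV.2 z -> cV.1 <= resistance D e x0 z].
  move=> y; have [Uy|nUy] := pselect (U y); first by exists (0, set0).
  have xy : x0 <> y by move=> xy; apply: nUy; rewrite -xy.
  have [c c0 [V [W [_ Vx oW Wy h]]]] := resistance_near xy.
  by exists (c, W) => _; split => // z Wz; exact: h.
move: cK; rewrite compact_cover => /(_ X (~` U) (fun y => (f y).2)) [].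
- by move=> y nUy; case: (hf y nUy).
- by move=> y nUy; exists y => //; case: (hf y nUy).
move=> G GU cover.
(* A number below all local constants of the finite cover, and positive even when the cover is
   empty. *)
exists (1 + \sum_(y <- G) (f y).1^-1)^-1.
  rewrite invr_gt0 ltr_pwDl// big_seq sumr_ge0// => y /GU /[!inE] nUy.
  by rewrite invr_ge0 ltW//; case: (hf y nUy).
move=> z nUz; have [y /= yG yz] := cover z nUz.
have nUy : ~ U y by have := GU _ yG; rewrite inE.
have [c0 _ _ hc] := hf y nUy.
rewrite (le_trans _ (hc z yz))// -[leRHS]invrK lef_pV2 ?posrE ?invr_gt0//; last first.
  rewrite ltr_pwDl// big_seq sumr_ge0// => y' /GU /[!inE] nUy'.
  by rewrite invr_ge0 ltW//; case: (hf y' nUy').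
rewrite (big_rem y)//= addrCA lerDl addr_ge0//.
rewrite big_seq sumr_ge0// => y' /mem_rem /GU /[!inE] nUy'.
by rewrite invr_ge0 ltW//; case: (hf y' nUy').
Qed.

End resistance_metric.

(** * The Sobolev inequality and square sums over orthogonal functions *)

Section operator_bound.
Variables (R : realType) (X : ptopologicalType).
Variable mu : {measure set (borel X) -> \bar R}.
Variables (D : set (X -> R)) (e : (X -> R) -> (X -> R) -> R).
Hypothesis es : energy_space D e mu.
Implicit Types (f g u v : X -> R).

Lemma Rintegral_sum (I : Type) (s : seq I) (f : I -> X -> R) :
  (forall i, mu.-integrable [set: borel X] (EFin \o f i)) ->
  mu.-integrable [set: borel X] (EFin \o (fun x => \sum_(i <- s) f i x)) /\
  \int[mu]_x (\sum_(i <- s) f i x) = \sum_(i <- s) \int[mu]_x f i x.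
Proof.
move=> hf; elim: s => [|i s [ih1 ih2]].
  rewrite big_nil (_ : (fun x => _) = cst 0); last by apply/funext => x; rewrite big_nil.
  by rewrite Rintegral_cst// mul0r; split => //; exact: integrable0.
rewrite big_cons (_ : (fun x => _) = (fun x => f i x + \sum_(j <- s) f j x)); last first.
  by apply/funext => x; rewrite big_cons.
split; last by rewrite RintegralD// ih2.
by have := integrableD measurableT (hf i) ih1.
Qed.

Lemma mass_gt0 : 0 < mass mu.
Proof.
apply: fine_gt0; rewrite (es_finite es) andbT.
by apply: (es_support es); [exact: openT|exists point].
Qed.

Lemma Rintegral_const (c : R) : \int[mu]_(x in [set: borel X]) c = c * mass mu.
Proof. by rewrite Rintegral_cst. Qed.

Lemma rinner_bound f B : continuous f -> (forall x, `|f x| <= B) ->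
  rinner mu f f <= B ^+ 2 * mass mu.
Proof.
move=> cf fB; apply: (Rintegral_le_const es).
  by apply: L2_integrable_mul; exact: (continuous_L2 es cf).
move=> x; rewrite -expr2 -real_normK ?num_real// lerXn2r ?nnegrE//.
exact: le_trans (normr_ge0 _) (fB x).
Qed.

Lemma weak_laplacian_lin (a : R) u v f g : weak_laplacian D e mu u f ->
  weak_laplacian D e mu v g ->
  weak_laplacian D e mu (fun x => a * u x + v x) (fun x => a * f x + g x).
Proof.
move=> [Du Lf hu] [Dv Lg hv]; split; first exact: (es_lin es a Du Dv).
  exact: L2_lin.
move=> w Dw; rewrite (es_bilin es)// hu// hv//.
by have := rinner_lin a Lf Lg (dom_L2 es Dw); rewrite /rinner => ->; ring.
Qed.

Lemma weak_laplacian0 : weak_laplacian D e mu (cst 0) (cst 0).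
Proof.
split; [exact: es_zero es|exact: L2_0|].
move=> w Dw; have := es_bilin es (-1) (es_zero es) (es_zero es) Dw.
rewrite (_ : (fun x : X => -1 * cst 0 x + cst 0 x) = cst 0); last first.
  by apply/funext => x /=; rewrite mulr0 addr0.
move=> h; rewrite (@eq_Rintegral _ _ _ _ _ (cst 0)); last by move=> x _; rewrite mul0r.
by rewrite Rintegral_cst// mul0r oppr0; lra.
Qed.

Lemma weak_laplacian_sum (I : eqType) (s : seq I) (c : I -> R) (u f : I -> X -> R) :
  (forall i, i \in s -> weak_laplacian D e mu (u i) (f i)) ->
  weak_laplacian D e mu (fun x => \sum_(i <- s) c i * u i x) (fun x => \sum_(i <- s) c i * f i x).
Proof.
elim: s => [|i s ih] h.
  by have := weak_laplacian0; congr weak_laplacian; apply/funext => x; rewrite big_nil.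
have := weak_laplacian_lin (c i) (h i (mem_head _ _))
  (ih (fun j js => h j (mem_behead (s := i :: s) js))).
by congr weak_laplacian; apply/funext => x; rewrite big_cons.
Qed.

(** Average u(x)^2 <= 2 (u(x) - u(y))^2 + 2 u(y)^2 over y. The first term is bounded by the energy
    of u, and this energy, minus the product of f and u, by half the sum of the two square norms. *)
Lemma sobolev : exists2 C : R, 0 <= C & forall u f, weak_laplacian D e mu u f ->
  forall x, u x ^+ 2 <= C * (rinner mu u u + rinner mu f f).
Proof.
have [C0 C00 hC0] := es_osc es; have m0 := mass_gt0.
exists (C0 + 2 / mass mu); first by rewrite addr_ge0 ?divr_ge0// ltW.
move=> u f [Du Lf hu] x; have Lu := dom_L2 es Du.
have euu : e u u <= (rinner mu u u + rinner mu f f) / 2.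
  rewrite hu// -/(rinner mu f u).
  have := rinner_ge0 mu (fun z => 1 * f z + 1 * u z).
  by rewrite rinner_sqD//; lra.
have uu0 := rinner_ge0 mu u; have ff0 := rinner_ge0 mu f.
have key y : u x ^+ 2 <= 2 * (C0 * e u u) + 2 * (u y * u y).
  have := hC0 u x y Du; have := sqr_ge0 (u x - 2 * u y); nra.
have : u x ^+ 2 * mass mu <= 2 * (C0 * e u u) * mass mu + 2 * rinner mu u u.
  have iuu := L2_integrable_mul Lu Lu.
  have iuu2 : mu.-integrable [set: borel X] (EFin \o (fun y => 2 * (u y * u y))).
    by have := integrableZl measurableT 2 iuu.
  have icst (c : R) : mu.-integrable [set: borel X] (EFin \o (fun=> c)).
    by apply: (continuous_integrable es) => y; exact: cvg_cst.
  rewrite -!Rintegral_const -[rinner mu u u]/(\int[mu]_y (u y * u y)) -RintegralZl//.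
  rewrite -RintegralD//; apply: le_Rintegral => //.
  by have := integrableD measurableT (icst (2 * (C0 * e u u))) iuu2.
move=> h; rewrite -(ler_pM2r m0) (le_trans h)//.
have -> : (C0 + 2 / mass mu) * (rinner mu u u + rinner mu f f) * mass mu =
   C0 * (rinner mu u u + rinner mu f f) * mass mu + 2 * (rinner mu u u + rinner mu f f).
  by field; rewrite gt_eqF.
apply: lerD; last by lra.
rewrite ler_wpM2r ?(ltW m0)//.
by have := ler_wpM2l (ltW C00) euu; lra.
Qed.

(** Expanding the square norm in z gives a double sum of v_l(x) v_l'(x) with coefficients
    independent of x. Integration in x leaves the diagonal, whose coefficients are at most B^2 times
    the mass. *)
Lemma integral_sq_sum (s : seq R) (w v : R -> X -> R) B : uniq s ->
  (forall l, l \in s -> continuous (w l)) -> (forall l x, l \in s -> `|w l x| <= B) ->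
  (forall l, continuous (v l)) ->
  (forall l l', l \in s -> l' \in s -> l != l' -> rinner mu (v l) (v l') = 0) ->
  let G x := rinner mu (fun z => \sum_(l <- s) v l x * w l z) (fun z => \sum_(l <- s) v l x * w l z) in
  mu.-integrable [set: borel X] (EFin \o G) /\
  \int[mu]_x G x <= B ^+ 2 * mass mu * \sum_(l <- s) rinner mu (v l) (v l).
Proof.
move=> us cw wB cv orth G.
pose w' l := if l \in s then w l else cst 0.
have cw' l : continuous (w' l).
  by rewrite /w'; case: ifPn => [/cw//|_ x]; exact: cvg_cst.
have Lw l : L2 mu (w' l) by exact: (continuous_L2 es (cw' l)).
have Lv l : L2 mu (v l) by exact: (continuous_L2 es (cv l)).
have GE x : G x = \sum_(l <- s) \sum_(l' <- s) rinner mu (w' l) (w' l') * (v l x * v l' x).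
  have gE : (fun z => \sum_(l <- s) v l x * w l z) = (fun z => \sum_(l <- s) v l x * w' l z).
    apply/funext => z; rewrite big_seq [RHS]big_seq; apply: eq_bigr => l ls.
    by rewrite /w' ls.
  rewrite /G gE rinner_suml//; last exact: L2_sum.
  apply: eq_bigr => l _; rewrite rinnerC rinner_suml// mulr_sumr.
  by apply: eq_bigr => l' _; rewrite [rinner mu (w' l') _]rinnerC; ring.
have ivv (a : R) l l' : mu.-integrable [set: borel X] (EFin \o (fun x => a * (v l x * v l' x))).
  by have := integrableZl measurableT a (L2_integrable_mul (Lv l) (Lv l')).
have h1 l := @Rintegral_sum _ s (fun l' x => rinner mu (w' l) (w' l') * (v l x * v l' x))
  (fun l' => ivv _ l l').
have [h2 h3] := @Rintegral_sum _ s (fun l x => \sum_(l' <- s) rinner mu (w' l) (w' l') * (v l x * v l' x))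
  (fun l => (h1 l).1).
have -> : G = (fun x => \sum_(l <- s) \sum_(l' <- s) rinner mu (w' l) (w' l') * (v l x * v l' x)).
  by apply/funext.
split=> //; rewrite h3 mulr_sumr big_seq [leRHS]big_seq; apply: ler_sum => l ls.
rewrite (h1 l).2 (bigD1_seq l)//= big1_seq ?addr0.
  rewrite RintegralZl//; last exact: L2_integrable_mul.
  rewrite ler_wpM2r ?rinner_ge0// rinner_bound// => x; rewrite /w' ls; exact: wB.
move=> l' /andP[ll' ls']; rewrite RintegralZl//; last exact: L2_integrable_mul.
by rewrite -/(rinner mu (v l) (v l')) orth ?mulr0// eq_sym.
Qed.

End operator_bound.

(** * Passage between complex and real values *)

Section complex_real_parts.
Variable R : realType.
Implicit Types z : R[i].

Lemma Re_le_cabs z : `|complex.Re z| <= cabs z.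
Proof.
by case: z => a b /=; rewrite -sqrtr_sqr ler_wsqrtr// lerDl sqr_ge0.
Qed.

Lemma Im_le_cabs z : `|complex.Im z| <= cabs z.
Proof.
by case: z => a b /=; rewrite -sqrtr_sqr ler_wsqrtr// lerDr sqr_ge0.
Qed.

Lemma cabs_le_ReIm z : cabs z <= `|complex.Re z| + `|complex.Im z|.
Proof.
case: z => a b /=; rewrite -[leRHS]ger0_norm ?addr_ge0// -sqrtr_sqr ler_wsqrtr//.
rewrite sqrrD !real_normK ?num_real// -addrA lerD2l lerDr.
by rewrite mulrn_wge0// mulr_ge0.
Qed.

Lemma complexReD z z' : complex.Re (z + z') = complex.Re z + complex.Re z'.
Proof. by case: z; case: z'. Qed.

Lemma complexImD z z' : complex.Im (z + z') = complex.Im z + complex.Im z'.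
Proof. by case: z; case: z'. Qed.

Lemma complexReB z z' : complex.Re (z - z') = complex.Re z - complex.Re z'.
Proof. by case: z; case: z'. Qed.

Lemma complexImB z z' : complex.Im (z - z') = complex.Im z - complex.Im z'.
Proof. by case: z; case: z'. Qed.

Lemma complexReM z z' : complex.Re (z * z') =
  complex.Re z * complex.Re z' - complex.Im z * complex.Im z'.
Proof. by case: z; case: z'. Qed.

Lemma complexImM z z' : complex.Im (z * z') =
  complex.Re z * complex.Im z' + complex.Im z * complex.Re z'.
Proof. by case: z; case: z'. Qed.

Lemma complexRe_sum (I : Type) (s : seq I) (P : pred I) (f : I -> R[i]) :
  complex.Re (\sum_(i <- s | P i) f i) = \sum_(i <- s | P i) complex.Re (f i).
Proof. by elim/big_rec2: _ => // i a b _ <-; rewrite complexReD. Qed.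

Lemma complexIm_sum (I : Type) (s : seq I) (P : pred I) (f : I -> R[i]) :
  complex.Im (\sum_(i <- s | P i) f i) = \sum_(i <- s | P i) complex.Im (f i).
Proof. by elim/big_rec2: _ => // i a b _ <-; rewrite complexImD. Qed.

End complex_real_parts.

Lemma eq_sum_support (R : realType) (s s' : seq R) (f : R -> R) : uniq s -> uniq s' ->
  {subset s <= s'} -> (forall l, l \in s' -> l \notin s -> f l = 0) ->
  \sum_(l <- s') f l = \sum_(l <- s) f l.
Proof.
move=> us us' ss' f0; rewrite (bigID (mem s))/= [X in _ + X]big1_seq ?addr0; last first.
  by move=> l /andP[ls ls']; exact: f0.
rewrite -big_filter; apply: perm_big; apply: uniq_perm => //; first exact: filter_uniq.
move=> l; rewrite mem_filter; apply/andP/idP => [[]//|ls]; split => //; exact: ss'.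
Qed.

Lemma ler_sum_subset (R : realType) (s s' : seq R) (f : R -> R) : uniq s -> uniq s' ->
  {subset s <= s'} -> (forall l, l \in s' -> 0 <= f l) ->
  \sum_(l <- s) f l <= \sum_(l <- s') f l.
Proof.
move=> us us' ss' f0; rewrite [leRHS](bigID (mem s))/=.
rewrite [X in X + _](_ : _ = \sum_(l <- s) f l).
  by rewrite lerDl big_seq_cond sumr_ge0// => l /andP[ls' _]; exact: f0.
rewrite -big_filter; apply: perm_big; apply: uniq_perm => //; first exact: filter_uniq.
move=> l; rewrite mem_filter; apply/andP/idP => [[]//|ls]; split => //; exact: ss'.
Qed.

Lemma cvg_complex (R : realType) (T : topologicalType) (f : T -> R[i]) (z : T) :
  {for z, continuous (fun x => complex.Re (f x))} -> {for z, continuous (fun x => complex.Im (f x))} ->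
  {for z, continuous (fun x => f x : (R[i])^o)}.
Proof.
(* In the partial order of the complex numbers a positive eps is real, hence [eps2 = 0]. *)
move=> cr ci; apply/cvgrPdist_lt => -[eps1 eps2] e0.
have [E2 e1] : eps2 = 0 /\ 0 < eps1.
  by move: e0; rewrite ltcE /= => /andP[/eqP -> ->].
rewrite E2; have e2 : 0 < eps1 / 2 by rewrite divr_gt0.
move/cvgrPdist_lt/(_ _ e2): cr => cr; move/cvgrPdist_lt/(_ _ e2): ci => ci.
apply: filterS2 cr ci => x hr hi.
rewrite [ltLHS](_ : _ = (cabs (f z - f x))%:C%C)// ltcR.
rewrite (le_lt_trans (cabs_le_ReIm _))// complexReB complexImB.
by rewrite [ltRHS](splitr eps1) ltrD.
Qed.

(** * Almost everywhere limits and supports *)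

Section ae_limits.
Variables (R : realType) (X : ptopologicalType).
Variable mu : {measure set (borel X) -> \bar R}.
Implicit Types (f g u w : X -> R).

Lemma eq_ae_integral f g : measurable_fun [set: borel X] (f : borel X -> R) ->
  mu.-integrable [set: borel X] (EFin \o g) ->
  mu.-negligible ([set x | f x <> g x] : set (borel X)) ->
  mu.-integrable [set: borel X] (EFin \o f) /\ \int[mu]_x f x = \int[mu]_x g x.
Proof.
move=> mf ig [N [mN N0 hN]].
have mg : measurable_fun [set: borel X] (EFin \o g) by case/integrableP: ig.
have mf' : measurable_fun [set: borel X] (EFin \o f) by exact/measurable_EFinP.
have fg (k : \bar R -> \bar R) : ae_eq mu [set: borel X] (k \o (EFin \o f)) (k \o (EFin \o g)).
  exists N; split => // x /= hx; apply: hN => /= E; apply: hx => _.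
  by rewrite E.
split.
  apply/integrableP; split => //.
  have [_] := integrableP _ _ _ ig; apply: le_lt_trans; rewrite le_eqVlt; apply/orP; left.
  apply/eqP; apply: ae_eq_integral => //; first exact: measurableT_comp.
    exact: measurableT_comp.
  exact: (fg abse).
by rewrite /Rintegral; congr fine; apply: ae_eq_integral => //; exact: (fg id).
Qed.

(** Fatou's lemma on O for the squares of w - F_J, which converge pointwise to the square of w - g
    and whose integrals tend to 0. *)
Lemma L2_limit_ae (O : set X) w g (F : nat -> X -> R) : open O -> L2 mu w ->
  (forall J, L2 mu (F J)) ->
  rinner mu (fun x => -1 * F J x + w x) (fun x => -1 * F J x + w x) @[J --> \oo] --> (0 : R) ->
  (forall x, O x -> F J x @[J --> \oo] --> g x) ->
  mu.-negligible ([set x | O x /\ w x <> g x] : set (borel X)).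
Proof.
move=> oO Lw LF cN cF; have mO : measurable (O : set (borel X)) := open_borel oO.
pose a J x := -1 * F J x + w x; have La J : L2 mu (a J) by exact: L2_lin.
pose b x := -1 * g x + w x.
have ca x : O x -> a J x @[J --> \oo] --> b x.
  by move=> Ox; apply: cvgD; [apply: cvgMr; exact: cF|exact: cvg_cst].
have iaa J := L2_integrable_mul (La J) (La J).
have maa J : measurable_fun (O : set (borel X)) (EFin \o (fun x => a J x * a J x)).
  by apply: measurable_funS (subsetT _) _ => //; case/integrableP: (iaa J).
have mbb : measurable_fun (O : set (borel X)) (EFin \o (fun x => b x * b x)).
  apply: (emeasurable_fun_cvg _ _ maa) => x Ox /=.
  by apply: cvg_EFin; [near=> J|exact: (cvgM (ca x Ox) (ca x Ox))].
have int0 : (\int[mu]_(x in O) (b x * b x)%R%:E <= 0)%E.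
  have aa0 J x : O x -> (0 <= (EFin \o (fun x => a J x * a J x)%R) x)%E.
    by move=> _; rewrite /= lee_fin -expr2 sqr_ge0.
  have := fatou mu mO maa aa0.
  have -> : (\int[mu]_(x in O) limn_einf ((fun J => EFin \o (fun x => a J x * a J x)%R) ^~ x) =
     \int[mu]_(x in O) (b x * b x)%:E)%E.
    apply: eq_integral => x; rewrite inE => Ox.
    have c : ((fun J => EFin \o (fun x => a J x * a J x)) ^~ x) J @[J --> \oo] --> (b x * b x)%:E.
      by apply: cvg_EFin; [near=> J|exact: (cvgM (ca x Ox) (ca x Ox))].
    by rewrite is_cvg_limn_einfE ?(cvg_lim _ c)//; apply/cvg_ex; exists (b x * b x)%:E.
  have cI : (\int[mu]_(x in O) (a J x * a J x)%R%:E)%E @[J --> \oo] --> (0 : \bar R).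
    apply: (@squeeze_cvge _ _ _ _ (cst 0%E) _ (fun J => (rinner mu (a J) (a J))%:E)).
    - near=> J; apply/andP; split; first by apply: integral_ge0 => x Ox; exact: (aa0 J x Ox).
      rewrite /rinner /Rintegral fineK; last exact: (integrable_fin_num measurableT (iaa J)).
      apply: ge0_subset_integral => //; first by case/integrableP: (iaa J).
      by move=> x _; rewrite lee_fin -expr2 sqr_ge0.
    - exact: cvg_cst.
    - by apply: cvg_EFin; [near=> J|exact: cN].
  by rewrite is_cvg_limn_einfE ?(cvg_lim _ cI)//; apply/cvg_ex; exists 0%E.
have : (\int[mu]_(x in O) `|(b x * b x)%:E| = 0)%E.
  apply/eqP; rewrite eq_le; apply/andP; split; last by apply: integral_ge0 => x _.
  rewrite (le_trans _ int0)// le_eqVlt; apply/orP; left; apply/eqP; apply: eq_integral => x _.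
  by rewrite gee0_abs// lee_fin -expr2 sqr_ge0.
move=> /(ae_eq_integral_abs _ mO mbb) [N [mN N0 hN]].
exists N; split => // x [Ox wx]; apply: hN => /= h; apply: wx.
by have [] := h Ox => /eqP; rewrite mulf_eq0 orbb /b => /eqP; lra.
Unshelve. all: by end_near. Qed.

End ae_limits.

Definition vanishes_near (R : realType) (X : ptopologicalType)
  (mu : {measure set (borel X) -> \bar R}) (x : X) (u : X -> R) := exists U : set X, [/\ open U, U x &
  mu.-negligible ([set y | U y /\ u y <> 0] : set (borel X))].

Lemma supp_open (R : realType) (X : ptopologicalType) (mu : {measure set (borel X) -> \bar R})
  (u : X -> R[i]) : open (~` supp mu u).
Proof.
rewrite /supp setCK [X in open X](_ : _ = \bigcup_(U in [set U : set X | open U /\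
   mu.-negligible ([set y | U y /\ u y <> 0] : set (borel X))]) U).
  by apply: bigcup_open => U [].
by apply/seteqP; split => x [U]; [move=> [oU Ux nU]; exists U|move=> [oU nU] Ux; exists U].
Qed.

Lemma vanishes_near_supp (R : realType) (X : ptopologicalType)
  (mu : {measure set (borel X) -> \bar R}) (u : X -> R[i]) x : ~ supp mu u x ->
  vanishes_near mu x (cRe u) /\ vanishes_near mu x (cIm u).
Proof.
move=> /contrapT[U [oU Ux nU]]; split; exists U; split => //; apply: negligibleS nU;
by move=> y [Uy uy]; split => // u0; apply: uy; rewrite /cRe/cIm u0.
Qed.

Lemma cL2_cvg_ReIm (R : realType) (X : ptopologicalType)
  (mu : {measure set (borel X) -> \bar R}) (f : nat -> X -> R[i]) (g : X -> R[i]) :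
  (forall k, cL2 mu (f k)) -> cL2 mu g -> cL2_cvg mu f g ->
  let sqnorm (u : X -> R) := rinner mu u u in
  sqnorm (fun x => -1 * cRe g x + cRe (f k) x) @[k --> \oo] --> (0 : R) /\
  sqnorm (fun x => -1 * cIm g x + cIm (f k) x) @[k --> \oo] --> (0 : R).
Proof.
move=> Lf [Lgr Lgi] fg sqnorm.
have E k : \int[mu]_x (cabs (f k x - g x) ^+ 2) =
    sqnorm (fun x => -1 * cRe g x + cRe (f k) x) + sqnorm (fun x => -1 * cIm g x + cIm (f k) x).
  have [Lr Li] := Lf k.
  have L1 : L2 mu (fun x => -1 * cRe g x + cRe (f k) x) by exact: L2_lin.
  have L2 : L2 mu (fun x => -1 * cIm g x + cIm (f k) x) by exact: L2_lin.
  rewrite /sqnorm /rinner -RintegralD//; try exact: L2_integrable_mul.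
  apply: eq_Rintegral => x _; rewrite /cRe /cIm.
  case: (f k x) => a b; case: (g x) => a' b' /=.
  by rewrite sqr_sqrtr ?addr_ge0 ?sqr_ge0//; ring.
have ge0 u : 0 <= sqnorm u by exact: rinner_ge0.
by split; apply: (squeeze_cvgr _ (cvg_cst 0) fg); near=> k; rewrite ge0/= E ?lerDl ?lerDr.
Unshelve. all: by end_near. Qed.

(** Both components are written as a times one pairing plus another, with a = -1 and a = 1, the form
    in which [kernel_off_support] treats them at once. *)
Lemma cintegral_kernel (R : realType) (X : ptopologicalType)
  (mu : {measure set (borel X) -> \bar R}) (f g : X -> R) (u : X -> R[i]) :
  mu.-integrable [set: borel X] (EFin \o (fun y => f y * cRe u y)) ->
  mu.-integrable [set: borel X] (EFin \o (fun y => f y * cIm u y)) ->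
  mu.-integrable [set: borel X] (EFin \o (fun y => g y * cRe u y)) ->
  mu.-integrable [set: borel X] (EFin \o (fun y => g y * cIm u y)) ->
  cintegral mu (fun y => (f y +i* g y)%C * u y) =
  ((-1 * rinner mu g (cIm u) + rinner mu f (cRe u)) +i*
   (1 * rinner mu g (cRe u) + rinner mu f (cIm u)))%C.
Proof.
move=> fr fi gr gi; rewrite /cintegral; congr (_ +i* _)%C.
  rewrite /rinner -RintegralZl// -RintegralD//; last by have := integrableZl measurableT (-1) gi.
  by apply: eq_Rintegral => y _; rewrite /cRe /cIm; case: (u y) => a b /=; ring.
rewrite /rinner mul1r -RintegralD//.
by apply: eq_Rintegral => y _; rewrite /cRe /cIm; case: (u y) => a b /=; ring.
Qed.

(** * Multipliers and their kernels *)

Section spectral_multipliers.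
Variables (R : realType) (X : ptopologicalType).
Variable mu : {measure set (borel X) -> \bar R}.
Variables (D : set (X -> R)) (e : (X -> R) -> (X -> R) -> R).
Hypothesis es : energy_space D e mu.
Variable P : R -> X -> X -> R.
Hypothesis hP : forall l, spectrum D e mu l -> spectral_projection_kernel D e mu l (P l).
Variable h : R[i] -> X -> X -> R[i].
Hypothesis hheat : heat_kernel (spectrum D e mu) P h.
Variables (c1 c2 d gamma : R).
Hypothesis c1_gt0 : 0 < c1.
Hypothesis c2_gt0 : 0 < c2.
Hypothesis d_gt0 : 0 < d.
Hypothesis gamma_gt0 : 0 < gamma.
Let rho := resistance D e.
Hypothesis hest : heat_kernel_estimate rho (P 0) h c1 c2 d gamma.
Let L := spectrum D e mu.
Let delta := d / (d + 1).
Let diff (f g : X -> R) : X -> R := fun x => -1 * g x + f x.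
Implicit Types (x y : X) (t l s A B : R) (m q : X -> R -> R) (u v w : X -> R).

(** * The heat kernel as a limit of finite spectral sums *)

Definition heat t x y : R := complex.Re (h t%:C%C x y).

Lemma heat_has_sum t x y (eps : R) : 0 < t -> 0 < eps ->
  exists2 G : {fset R}, [set` G] `<=` L & forall H : {fset R},
    [set` G] `<=` [set` H] -> [set` H] `<=` L ->
    `|\sum_(l <- H) expR (- (t * l)) * P l x y - heat t x y| < eps.
Proof.
move=> t0 e0; have [|G GL hG] := hheat (z := t%:C%C) x y _ e0.
  by [].
exists G => // H GH HL; apply: le_lt_trans (hG H GH HL).
rewrite (le_trans _ (Re_le_cabs _))// complexReB complexRe_sum /heat le_eqVlt; apply/orP; left.
apply/eqP; congr (`|_ - _|); apply: eq_bigr => l _.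
have -> : - t%:C%C * l%:C%C = (- (t * l))%:C%C by rewrite -rmorphN -rmorphM mulNr.
by rewrite complexReM /= cos0 mulr1 mulr0 subr0.
Qed.

Lemma heat_bound_le t x y : 0 < t <= 1 ->
  `|heat t x y| <= c1 * t `^ (- delta) * expR (- (c2 * (rho x y `^ (d + 1) / t) `^ gamma)).
Proof.
move=> t01; have [/(_ t01) ht _] := hest t x y.
exact: le_trans (Re_le_cabs _) ht.
Qed.

Lemma heat_le t x y : 0 < t <= 1 -> `|heat t x y| <= c1 * t `^ (- delta).
Proof.
move=> t01; apply: (le_trans (heat_bound_le x y t01)).
rewrite ler_piMr ?mulr_ge0 ?powR_ge0 ?(ltW c1_gt0)//.
by rewrite expR_le1 oppr_le0 mulr_ge0 ?powR_ge0// ltW.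
Qed.

(** Diagonal terms are nonnegative, so every finite partial sum stays below the unordered sum. *)
Lemma heat_diag_sum t x (H : {fset R}) : 0 < t <= 1 -> [set` H] `<=` L ->
  \sum_(l <- H) expR (- (t * l)) * P l x x <= c1 * t `^ (- delta).
Proof.
move=> /[dup] t01 /andP[t0 t1] HL; apply/ler_addgt0Pr => eps e0.
have [G GL hG] := heat_has_sum x x t0 e0.
have GGH : [set` G] `<=` [set` (G `|` H)%fset].
  by move=> l lG; rewrite /= in_fsetU; apply/orP; left.
have GHL : [set` (G `|` H)%fset] `<=` L.
  by move=> l /=; rewrite in_fsetU => /orP[/GL|/HL].
have := hG _ GGH GHL; have := heat_le x x t01.
rewrite ltr_norml ler_norml => /andP[_ h1] /andP[_ h2].
apply: (@le_trans _ _ (\sum_(l <- (G `|` H)%fset) expR (- (t * l)) * P l x x)).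
  apply: ler_sum_subset; rewrite ?fset_uniq//.
    by move=> l lH; rewrite in_fsetU lH orbT.
  move=> l lGH; rewrite mulr_ge0 ?expR_ge0//.
  have Ll : L l := GHL _ lGH; exact: (kernel_diag_ge0 es (hP Ll)).
by lra.
Qed.

(** Spectral points whose projection kernel is zero contribute to no sum and are left out: the count
    that proves finiteness rests on traces of nonzero projections. *)
Definition band_spectrum (n : nat) : set R :=
  [set l | [/\ L l, l <= n%:R & exists x, P l x x != 0]].

Lemma band_spectrum_ge0 n l : band_spectrum n l -> 0 <= l.
Proof.
move=> [Ll _ [x Px]]; rewrite leNgt; apply/negP => l0.
by move/eqP: Px; apply; exact: (kernel_neg es (hP Ll)).
Qed.

(** Integrate the diagonal heat bound at t = 1: each point contributes at least e^-n times a trace,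
    which is at least 1, so there are at most e^n c1 mu(X) points. *)
Lemma band_spectrum_finite n : finite_set (band_spectrum n).
Proof.
apply: contrapT => inf.
pose B := expR n%:R * (c1 * mass mu).
have [G GA Gk] := infinite_set_fset (Num.bound B) inf.
have GL : [set` G] `<=` L by move=> l /GA[].
have Pd l : l \in G -> continuous (fun x => P l x x).
  by move=> lG; exact: kernel_diag_continuous (hP (GL _ lG)).
have B0 : 0 <= B by rewrite mulr_ge0 ?expR_ge0// mulr_ge0 ?mass_ge0// ltW.
have sumE : \int[mu]_x (\sum_(l <- G) expR (- l) * P l x x) =
    \sum_(l <- G) expR (- l) * \int[mu]_x P l x x.
  pose f l := if l \in G then (fun x => P l x x) else cst 0.
  have cf l : continuous (f l).
    by rewrite /f; case: ifPn => [/Pd//|_ x]; exact: cvg_cst.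
  have c1' : continuous (cst 1 : X -> R) by move=> x; exact: cvg_cst.
  have := rinner_suml (enum_fset G) (fun l => expR (- l)) (fun l => continuous_L2 es (cf l))
    (continuous_L2 es c1').
  rewrite /rinner => E; rewrite [LHS](_ : _ = \int[mu]_x ((\sum_(i <- G) expR (- i) * f i x) * cst 1 x)).
    rewrite E; rewrite big_seq [RHS]big_seq; apply: eq_bigr => l lG; congr (_ * _).
    by apply: eq_Rintegral => x _; rewrite /f lG mulr1.
  apply: eq_Rintegral => x _; rewrite mulr1 big_seq [RHS]big_seq.
  by apply: eq_bigr => l lG; rewrite /f lG.
have : \int[mu]_x (\sum_(l <- G) expR (- l) * P l x x) <= c1 * mass mu.
  apply: Rintegral_le_const es _ _ _ _.
    apply: (continuous_integrable es) => x.
    have : \sum_(l <- G | l \in G) expR (- l) * P l y y @[y --> x] -->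
        \sum_(l <- G | l \in G) expR (- l) * P l x x.
      apply: (@cvg_big _ _ _ _ _) => [|l lG]; first exact: add_continuous.
      by apply: cvgMr; exact: Pd.
    by rewrite -big_seq; under eq_cvg do rewrite -big_seq.
  move=> x; have := @heat_diag_sum 1 x G; rewrite ltr01 lexx powR1 mulr1 => /(_ isT GL).
  by under eq_bigr do rewrite mul1r.
rewrite sumE => hle.
have : (#|` G|)%:R <= B.
  rewrite /B mulrC -ler_pdivrMr ?expR_gt0// -expRN (le_trans _ hle)//.
  rewrite -[#|` G|]/(size G) -sum1_size natr_sum mulr_suml big_seq [leRHS]big_seq.
  apply: ler_sum => l lG; have [Ll ln [x Px]] := GA _ lG.
  rewrite mul1r -[leLHS]mulr1 ler_pM ?expR_ge0//; first by rewrite ler_expR lerN2.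
  exact: (kernel_trace_ge1 es (hP Ll) Px).
rewrite leNgt => /negP; apply.
by rewrite (lt_le_trans (archi_boundP B0))// ler_nat.
Qed.

Definition sp n : seq R := enum_fset (fset_set (band_spectrum n)).

Lemma sp_uniq n : uniq (sp n).
Proof. exact: fset_uniq. Qed.

Lemma mem_sp n l : l \in sp n <-> band_spectrum n l.
Proof.
rewrite /sp -[l \in _]/(l \in fset_set (band_spectrum n)).
rewrite in_fset_set; last exact: band_spectrum_finite.
by rewrite inE.
Qed.

Lemma sp_spectrum n l : l \in sp n -> L l.
Proof. by move=> /mem_sp[]. Qed.

Lemma sp_ge0 n l : l \in sp n -> 0 <= l.
Proof. by move=> /mem_sp/band_spectrum_ge0. Qed.

Lemma sp_le n n' : (n <= n')%N -> {subset sp n <= sp n'}.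
Proof.
move=> nn' l /mem_sp[Ll ln Px]; apply/mem_sp; split => //.
by rewrite (le_trans ln)// ler_nat.
Qed.

Lemma sp_abs n t x y : 0 < t <= 1 ->
  \sum_(l <- sp n) expR (- (t * l)) * `|P l x y| <= c1 * t `^ (- delta).
Proof.
move=> t01.
have hx z : \sum_(l <- sp n) expR (- (t * l)) * P l z z <= c1 * t `^ (- delta).
  by apply: heat_diag_sum => // l; exact: sp_spectrum.
apply: (@le_trans _ _ (2^-1 * (\sum_(l <- sp n) expR (- (t * l)) * P l x x) +
    2^-1 * (\sum_(l <- sp n) expR (- (t * l)) * P l y y))).
  rewrite !mulr_sumr -big_split/= big_seq [leRHS]big_seq; apply: ler_sum => l /sp_spectrum Ll.
  rewrite ![2^-1 * _]mulrCA -mulrDr ler_wpM2l ?expR_ge0//.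
  by have := kernel_le_diag es (hP Ll) x y; lra.
by have := hx x; have := hx y; lra.
Qed.

Lemma sp_zero n l x y : L l -> l <= n%:R -> l \notin sp n -> P l x y = 0.
Proof.
move=> Ll ln lsp; have P0 z : P l z z = 0.
  by apply/eqP; apply/negP => /negP Pz; move/negP: lsp; apply; apply/mem_sp; split => //; exists z.
by apply/eqP; rewrite -normr_le0 (le_trans (kernel_le_diag es (hP Ll) x y))// !P0 addr0 mul0r.
Qed.

(** For the convergence, [sp n] is enlarged by the finite set G given by the unordered sum; once n
    exceeds all elements of G, the added points have zero kernel and the sum over [sp n] is
    unchanged. *)
Lemma heat_dataP x y : heat_data c1 c2 delta gamma (rho x y `^ (d + 1)) sp
  (fun l => P l x y) (fun t => heat t x y).
Proof.
split.
- by move=> n l; exact: sp_ge0.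
- by move=> n t; exact: sp_abs.
- move=> t /andP[t0 _]; apply/cvgrPdist_lt => eps e0.
  have [G GL hG] := heat_has_sum x y t0 e0.
  pose M := Num.bound (\sum_(l <- G) `|l|).
  have GM l : l \in G -> l <= M%:R.
    move=> lG; rewrite (le_trans (ler_norm _))//.
    rewrite (le_trans _ (ltW (archi_boundP _)))//; last by rewrite sumr_ge0.
    by rewrite (big_rem l)//= lerDl sumr_ge0.
  near=> n; pose H := (G `|` fset_set (band_spectrum n))%fset.
  have HL : [set` H] `<=` L.
    move=> l; rewrite /H /= in_fsetU => /orP[/GL//|ln].
    by apply: (@sp_spectrum n).
  have := hG H _ HL; rewrite distrC => hH.
  rewrite /spectral_sum -(@eq_sum_support _ (sp n) H) ?sp_uniq ?fset_uniq//.
  + by apply: hH => l /= lG; rewrite /H in_fsetU lG.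
  + by move=> l ln; rewrite /H in_fsetU; apply/orP; right.
  + move=> l; rewrite /H in_fsetU => /orP[lG|ln] lsp; last by move/negP: lsp.
    rewrite (@sp_zero n l x y) ?mulr0//; first exact: GL.
    rewrite (le_trans (GM _ lG))// ler_nat; near: n; exact: nbhs_infty_ge.
- by move=> t; exact: heat_bound_le.
Unshelve. all: by end_near. Qed.

(** The additional terms have l >= n: half of the exponent gives exp(-t n / 2), and the other half
    keeps the sum absolutely bounded. *)
Lemma spectral_sum_tail n n' t A (m : R -> R) x y : (n <= n')%N -> 0 < t <= 1 -> 0 <= A ->
  (forall l, 0 <= l -> `|m l| <= A * expR (- (t * l))) ->
  `|spectral_sum sp (fun l => P l x y) n' m - spectral_sum sp (fun l => P l x y) n m| <=
  A * (c1 * (t / 2) `^ (- delta)) * expR (- (t / 2 * n%:R)).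
Proof.
move=> nn' /andP[t0 t1] A0 hm; have t2 : 0 < t / 2 <= 1 by apply/andP; split; lra.
rewrite /spectral_sum (bigID (mem (sp n)))/=.
rewrite [X in X + _ - _](_ : _ = \sum_(l <- sp n) m l * P l x y); last first.
  rewrite -big_filter; apply: perm_big; apply: uniq_perm; rewrite ?filter_uniq ?sp_uniq//.
  by move=> l; rewrite mem_filter; apply/andP/idP => [[]//|ls]; split => //; exact: sp_le nn' _ ls.
rewrite addrAC subrr add0r (le_trans (ler_norm_sum _ _ _))//.
apply: (@le_trans _ _ (A * expR (- (t / 2 * n%:R)) *
   (\sum_(l <- sp n') expR (- (t / 2 * l)) * `|P l x y|))); last first.
  rewrite mulrAC ler_wpM2r ?expR_ge0// ler_wpM2l//.
  exact: sp_abs.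
rewrite mulr_sumr big_seq_cond [leRHS]big_seq.
rewrite [leRHS](bigID (fun l => l \notin sp n))/= -[leLHS]addr0 lerD//; last first.
  by rewrite sumr_ge0// => l _; rewrite !mulr_ge0 ?expR_ge0.
apply: ler_sum => l /andP[ln' ln].
have l0 := sp_ge0 ln'.
have nl : n%:R <= l.
  rewrite leNgt; apply/negP => lt; move/negP: ln; apply; apply/mem_sp.
  by have /mem_sp[Ll _ Px] := ln'; split => //; exact: ltW.
rewrite normrM mulrA ler_wpM2r// (le_trans (hm _ l0))// -mulrA ler_wpM2l// -expRD ler_expR.
have : 0 <= t * (l - n%:R) by rewrite mulr_ge0// ?subr_ge0// ltW.
by lra.
Qed.

(** * Kernels of multipliers that decay exponentially in l *)

Definition kernel_sum m n x y : R :=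
  spectral_sum sp (fun l => P l x y) n (m x).

Definition kernel_of m x y : R := lim (kernel_sum m n x y @[n --> \oo]).

Definition decays m s A := 0 <= A /\ forall x l, 0 <= l -> `|m x l| <= A * expR (- (l / s)).

Lemma delta_gt0 : 0 < delta.
Proof. by rewrite divr_gt0// addr_gt0. Qed.

Lemma delta_lt1 : delta < 1.
Proof. by rewrite ltr_pdivrMr ?addr_gt0// mul1r ltrDl. Qed.

Definition kernel_tail s A n : R :=
  A * (c1 * (s^-1 / 2) `^ (- delta)) * expR (- (s^-1 / 2 * n%:R)).

Lemma kernel_tail0 s A : 0 < s -> kernel_tail s A n @[n --> \oo] --> 0.
Proof.
move=> s0; rewrite -[X in _ --> X](mulr0 (A * (c1 * (s^-1 / 2) `^ (- delta)))).
apply: cvgMr; have -> : (fun n : nat => expR (- (s^-1 / 2 * n%:R))) =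
    (fun n => expR (- (s^-1 / 2)) ^+ n).
  by apply/funext => n; rewrite -expRM_natr mulNr.
by apply: cvg_expr; rewrite ger0_norm ?expR_ge0// expR_lt1 oppr_lt0 divr_gt0// invr_gt0.
Qed.

Lemma kernel_of_cvg m s A x y : 1 <= s -> decays m s A ->
  kernel_sum m n x y @[n --> \oo] --> kernel_of m x y /\
  forall n, `|kernel_of m x y - kernel_sum m n x y| <= kernel_tail s A n.
Proof.
move=> s1 [A0 hm]; have s0 : 0 < s by lra.
have [] := @cauchy_rate _ (fun n => kernel_sum m n x y) _ (kernel_tail0 A s0).
  move=> n n' nn'; apply: (spectral_sum_tail) => //.
    by rewrite invr_gt0 s0 invf_le1.
  by move=> l l0; rewrite [s^-1 * l]mulrC; exact: hm.
by move=> cvg_sum; split.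
Qed.

Lemma kernel_of_le m s A x y : 1 <= s -> decays m s A ->
  `|kernel_of m x y| <= A * (c1 * s `^ delta).
Proof.
move=> s1 hm; have [cvg_sum _] := kernel_of_cvg x y s1 hm; case: hm => A0 hm.
apply: (norm_cvg_le cvg_sum (cvg_cst _)) => n.
exact: spectral_sum_abs (heat_dataP x y) s1 A0 (hm x).
Qed.

Lemma kernel_sum_continuous m n : (forall l, 0 <= l -> continuous (m ^~ l)) ->
  continuous (fun z : X * X => kernel_sum m n z.1 z.2).
Proof.
move=> cm z; rewrite /kernel_sum /spectral_sum.
have : \sum_(l <- sp n | l \in sp n) m y.1 l * P l y.1 y.2 @[y --> z] -->
    \sum_(l <- sp n | l \in sp n) m z.1 l * P l z.1 z.2.
  apply: (@cvg_big _ _ _ _ _) => [|l ln]; first exact: add_continuous.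
  apply: cvgM.
    apply: (@continuous_comp _ _ _ fst (m ^~ l) z); first exact: cvg_fst.
    exact: (cm _ (sp_ge0 ln)).
  exact: (spk_continuous (hP (sp_spectrum ln))).
by rewrite /continuous_at -big_seq; under eq_cvg do rewrite -big_seq.
Qed.

Lemma kernel_of_continuous m s A : 1 <= s -> decays m s A ->
  (forall l, 0 <= l -> continuous (m ^~ l)) ->
  continuous (fun z : X * X => kernel_of m z.1 z.2).
Proof.
move=> s1 hm cm z; have s0 : 0 < s by lra.
apply/cvgrPdist_le => eps e0.
have e3 : 0 < eps / 3 by lra.
have [n _ hn] := (cvgr_le 0 (kernel_tail0 A s0)) _ e3.
have tn : kernel_tail s A n <= eps / 3 by exact: hn (leqnn n).
have /cvgrPdist_le/(_ _ e3) := @kernel_sum_continuous m n cm z.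
apply: filterS => w hw.
have [_ h1] := kernel_of_cvg z.1 z.2 s1 hm; have [_ h2] := kernel_of_cvg w.1 w.2 s1 hm.
have := h1 n; have := h2 n; move: hw tn; rewrite !ler_norml => *; apply/andP; split; lra.
Qed.

(** Satisfied by the real and by the imaginary part of the symbol. The Laplacian in x enters the L^2
    bounds through the Sobolev inequality; the Euler derivatives enter the kernel estimate. The
    latter are carried as a family E because those of p are iterated on the complex symbol. *)
Record real_symbol q : Prop := {
  rsy_laplacian : exists B, forall l, 0 < l -> exists f : X -> R,
    [/\ continuous f, weak_laplacian D e mu (q ^~ l) f & forall z, `|f z| <= B];
  rsy_jet : exists E : X -> nat -> R -> R, [/\ forall x, E x 0%N = q x,
    forall x, euler_jet (E x) & forall k, exists B, forall x i l,
      (i <= k)%N -> 0 < l -> `|E x i l| <= B]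
}.

Lemma real_symbol_bounded q : real_symbol q ->
  exists2 B, 0 <= B & forall x l, 0 < l -> `|q x l| <= B.
Proof.
move=> hq; have [E [E0 _ /(_ 0%N)[B hB]]] := rsy_jet hq; exists B.
  by rewrite (le_trans _ (hB point 0%N 1 _ _)).
by move=> x l l0; rewrite -E0; exact: hB.
Qed.

Lemma real_symbol_continuous q l : real_symbol q -> 0 < l -> continuous (q ^~ l).
Proof.
move=> hq l0; have [B /(_ l l0)[f [_ [Dq _ _] _]]] := rsy_laplacian hq.
exact: (es_continuous es Dq).
Qed.

(* Symbols are only given for l > 0: the eigenvalue 0 is discarded. *)
Definition truncated k q J : X -> R -> R :=
  fun x l => if 0 < l then q x l * low_pass k (expR (- (l / 2 ^+ J))) else 0.

Lemma pow2_ge1 J : 1 <= 2 ^+ J :> R.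
Proof. by rewrite exprn_ege1// ler1n. Qed.

Lemma expR_pow2_itv l J : 0 <= l -> 0 <= (expR (- (l / 2 ^+ J)) : R) <= 1.
Proof. by move=> l0; rewrite expR_ge0 expR_le1 oppr_le0 divr_ge0// exprn_ge0. Qed.

Lemma truncated_decays k q J B : 0 <= B -> (forall x l, 0 < l -> `|q x l| <= B) ->
  decays (truncated k q J) (2 ^+ J) (k.+1%:R * B).
Proof.
move=> B0 qB; split; first by rewrite mulr_ge0.
move=> x l l0; rewrite /truncated; case: ifPn => [l1|_]; last first.
  by rewrite normr0 !mulr_ge0// expR_ge0.
have [g0 _ g1] := low_pass_bound k (expR_pow2_itv J l0).
rewrite normrM (ger0_norm g0) [leRHS](_ : _ = B * (k.+1%:R * expR (- (l / 2 ^+ J)))); last by ring.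
by rewrite ler_pM// qB.
Qed.

Lemma truncated_continuous k q J l : real_symbol q -> continuous (truncated k q J ^~ l).
Proof.
move=> hq x; have [l0|l0] := boolP (0 < l).
  have -> : truncated k q J ^~ l = (fun x => q x l * low_pass k (expR (- (l / 2 ^+ J)))).
    by apply/funext => z; rewrite /truncated l0.
  by apply: cvgMl; exact: (real_symbol_continuous hq l0).
have -> : truncated k q J ^~ l = cst 0.
  by apply/funext => z; rewrite /truncated (negbTE l0).
exact: cvg_cst.
Qed.

Definition truncated_kernel k q J : X -> X -> R := kernel_of (truncated k q J).

(** On the diagonal the limit may diverge, whence the explicit value 0. *)
Definition symbol_kernel k q x y : R :=
  if x == y then 0 else lim (truncated_kernel k q J x y @[J --> \oo]).

(** exp(-l / 2^J) is the square of exp(-l / 2^(J+1)), so the two filters differ by the band at scale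
    2^(J+1). At l = 0 the truncations and the band all vanish. *)
Lemma truncated_kernel_diff k q E J x y : real_symbol q -> E 0%N = q x ->
  kernel_sum (fun=> band k E (2 ^+ J.+1)) n x y @[n --> \oo] -->
  truncated_kernel k q J.+1 x y - truncated_kernel k q J x y.
Proof.
move=> hq E0; have [B B0 qB] := real_symbol_bounded hq.
have [c1' _] := kernel_of_cvg x y (pow2_ge1 J.+1) (truncated_decays k J.+1 B0 qB).
have [c2' _] := kernel_of_cvg x y (pow2_ge1 J) (truncated_decays k J B0 qB).
rewrite [X in X @ _](_ : _ = (fun n => kernel_sum (truncated k q J.+1) n x y -
    kernel_sum (truncated k q J) n x y)); first exact: cvgB c1' c2'.
apply/funext => n; apply/esym; rewrite /kernel_sum /spectral_sum -sumrB big_seq [RHS]big_seq; apply: eq_bigr => l ln.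
rewrite -mulrBl; congr (_ * _).
have := sp_ge0 ln; rewrite le_eqVlt => /predU1P[<-|l0].
  by rewrite /truncated ltxx subrr /band mul0r oppr0 expR0 expr1n subrr mulr0.
rewrite /truncated l0 -mulrBr /band E0; congr (_ * (_ - low_pass k _)).
rewrite -expRM_natl; congr expR; rewrite exprS; field.
by rewrite expf_neq0.
Qed.

(** [band_bound] feeds [dyadic_sum] with sigma = R(x,y)^(d+1), for which sigma^(-delta) =
    R(x,y)^(-d). *)
Lemma symbol_kernel_bound : exists k, forall q, real_symbol q -> exists2 C : R, 0 <= C &
  forall x y, x <> y ->
   [/\ `|symbol_kernel k q x y| <= C * rho x y `^ (- d) &
       forall J, `|symbol_kernel k q x y - truncated_kernel k q J x y| <=
         C / rho x y `^ (d + 1) * (2 `^ delta / 2) ^+ J].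
Proof.
have [Rm Rm0 hRm] := resistance_le es.
have d1 : 0 < d + 1 by rewrite addr_gt0.
have sm0 : 0 < Rm `^ (d + 1) by rewrite powR_gt0.
have [k [C C0 hC]] := band_bound c1_gt0 c2_gt0 gamma_gt0 (ltW delta_gt0) sm0.
have [C' C'0 hC'] := dyadic_sum (introT andP (conj delta_gt0 delta_lt1)).
exists k => q hq; have [E [E0 hE /(_ k)[B0 hB0]]] := rsy_jet hq.
pose B := `|B0|; have B_ge0 : 0 <= B by rewrite normr_ge0.
have hB x i l : (i <= k)%N -> 0 < l -> `|E x i l| <= B.
  by move=> ik l0; rewrite (le_trans (hB0 x i l ik l0))// ler_norm.
have qB x l : 0 < l -> `|q x l| <= B by move=> l0; rewrite -E0 hB.
pose Btop := k.+1%:R * B * c1.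
have Btop0 : 0 <= Btop by rewrite !mulr_ge0// ltW.
(* The first summand absorbs the kernel at J = 0, whose bound carries no power of R: since R <= Rm,
   the product (Rm^(d+1))^delta sigma^(-delta) is at least 1. *)
pose C1 := Btop * (Rm `^ (d + 1)) `^ delta + C' * (C * B).
have CB0 : 0 <= C * B by rewrite mulr_ge0// ltW.
have C'CB0 : 0 <= C' * (C * B) by rewrite mulr_ge0// ltW.
have C10 : 0 <= C1 by rewrite addr_ge0// mulr_ge0// powR_ge0.
exists C1 => // x y xy.
have r0 : 0 < rho x y by exact: (resistance_gt0 es xy).
pose sigma := rho x y `^ (d + 1).
have s0 : 0 < sigma by rewrite powR_gt0.
have sm : sigma <= Rm `^ (d + 1).
  by rewrite ge0_ler_powR ?nnegrE ?(ltW d1) ?(ltW r0) ?(ltW Rm0)//; exact: hRm.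
have [] := hC' (fun J => truncated_kernel k q J x y) (C * B) Btop sigma s0 CB0.
- have := kernel_of_le x y (pow2_ge1 0) (truncated_decays k 0 B_ge0 qB).
  by rewrite expr0 powR1 mulr1.
- move=> J; apply: (hC sp (fun l => P l x y) (fun t => heat t x y) sigma (E x)).
  + exact: (heat_dataP x y).
  + by rewrite s0.
  + exact: hE.
  + exact: hB.
  + exact: pow2_ge1.
  + exact: (@truncated_kernel_diff k q (E x) J x y hq (E0 x)).
move=> cK K1 K2; rewrite /symbol_kernel; case: eqP => [//|_]; split.
  rewrite (le_trans K1)//.
  have -> : rho x y `^ (- d) = sigma `^ (- delta).
    by rewrite /sigma -powRrM; congr (_ `^ _); rewrite /delta; field; rewrite gt_eqF.
  rewrite /C1 mulrDl lerD// -mulrA ler_peMr//.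
  rewrite powRN ler_pdivlMr ?powR_gt0// mul1r.
  by rewrite ge0_ler_powR ?nnegrE ?powR_ge0// ltW// delta_gt0.
move=> J; rewrite (le_trans (K2 J))// ler_wpM2r//.
by rewrite ler_wpM2r ?invr_ge0 ?(ltW s0)// /C1 lerDr mulr_ge0// powR_ge0.
Qed.

(** Near a point off the diagonal R has a positive lower bound, so the continuous truncated kernels
    converge uniformly there. *)
Lemma symbol_kernel_continuous k q C : real_symbol q ->
  (forall x y, x <> y -> forall J,
     `|symbol_kernel k q x y - truncated_kernel k q J x y| <=
      C / rho x y `^ (d + 1) * (2 `^ delta / 2) ^+ J) -> 0 <= C ->
  forall z : X * X, z.1 <> z.2 -> {for z, continuous (fun z => symbol_kernel k q z.1 z.2)}.
Proof.
move=> hq hC C0 [x0 y0] /= xy; have d1 : 0 < d + 1 by rewrite addr_gt0.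
have [c c0 [U [V [oU Ux oV Vy hc]]]] := resistance_near es xy.
have [B B0 qB] := real_symbol_bounded hq.
pose A := C / c `^ (d + 1); pose b : R := 2 `^ delta / 2.
have A0 : 0 <= A by rewrite divr_ge0// powR_ge0.
have b0 : 0 <= b by rewrite divr_ge0// powR_ge0.
have b1 : b < 1.
  rewrite ltr_pdivrMr// mul1r.
  have r0 : 0 < 1 - delta by rewrite subr_gt0 delta_lt1.
  have := @gt0_ltr_powR R _ r0 1 2; rewrite powR1 !nnegrE => /(_ ler01 (ler0n _ _)).
  rewrite ltr1n => /(_ isT) h1.
  have E : delta + (1 - delta) = 1 by ring.
  have h2 : 2 `^ (delta + (1 - delta)) = 2 `^ delta * 2 `^ (1 - delta) :> R.
    by apply: powRD; rewrite E oner_eq0.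
  rewrite E powRr1 in h2; last by [].
  by rewrite [ltRHS]h2 ltr_pMr// powR_gt0.
have near_le x y J : U x -> V y ->
    `|symbol_kernel k q x y - truncated_kernel k q J x y| <= A * b ^+ J.
  move=> Ux' Vy'; have r := hc x y Ux' Vy'.
  have xy' : x <> y.
    by move=> E; move: r; rewrite E (resistance_refl D e y); lra.
  rewrite (le_trans (hC x y xy' J))// ler_wpM2r ?exprn_ge0// ler_wpM2l// lef_pV2 ?posrE ?powR_gt0//.
    by rewrite ge0_ler_powR ?nnegrE ?(ltW d1) ?(ltW c0)// (le_trans (ltW c0) r).
  exact: lt_le_trans c0 r.
apply/cvgrPdist_le => eps e0; have e3 : 0 < eps / 3 by lra.
have t0 : A * b ^+ J @[J --> \oo] --> 0.
  by rewrite -[X in _ --> X](mulr0 A); apply: cvgMr; apply: cvg_expr; rewrite ger0_norm.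
have [J _ hJ] := (cvgr_le 0 t0) _ e3.
have tJ : A * b ^+ J <= eps / 3 by exact: hJ (leqnn J).
have cJ : continuous (fun z : X * X => truncated_kernel k q J z.1 z.2).
  apply: kernel_of_continuous (pow2_ge1 J) (truncated_decays k J B0 qB) _ => l _.
  exact: truncated_continuous.
have /cvgrPdist_le/(_ _ e3) hw := cJ (x0, y0).
have UV : \forall w \near (x0, y0), U w.1 /\ V w.2.
  by exists (U, V) => //=; split; apply: open_nbhs_nbhs.
apply: filterS2 UV hw => w [Uw Vw] hw.
have := near_le x0 y0 J Ux Vy; have := near_le w.1 w.2 J Uw Vw.
move: hw tJ; rewrite /truncated_kernel !ler_norml /= => *; apply/andP; split; lra.
Qed.

(** * Finite sums of eigenfunctions and the L^2 bound *)

Definition banded n v := exists2 c : R -> X -> R,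
  forall l, Defs.eigenspace D e mu l (c l) & v = fun x => \sum_(l <- sp n) c l x.

Lemma rinner_band (c : R -> X -> R) n l x : (forall l, Defs.eigenspace D e mu l (c l)) ->
  spectrum D e mu l ->
  rinner mu (P l x) (fun y => \sum_(l <- sp n) c l y) =
  if l \in sp n then c l x else 0.
Proof.
move=> hc Ll; have Lc l' := eigenspace_L2 es (hc l').
have -> : (fun x => \sum_(l <- sp n) c l x) = (fun x => \sum_(l <- sp n) 1 * c l x).
  by apply/funext => y; apply: eq_bigr => l' _; rewrite mul1r.
rewrite rinnerC rinner_suml//; last exact: (kernel_L2 es (hP Ll)).
have E l' : rinner mu (c l') (P l x) = if l == l' then c l x else 0.
  rewrite rinnerC; case: eqVneq => [<-|ll']; first exact: (kernel_op_id es (hP Ll) x (hc l)).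
  exact: (kernel_op_other es (hP Ll) x ll' (hc l')).
case: ifPn => ln.
  rewrite (bigD1_seq l ln (sp_uniq n))/= E eqxx mul1r big1 ?addr0// => l' ll'.
  by rewrite E eq_sym (negbTE ll') mulr0.
rewrite big_seq big1// => l' ln'; rewrite E; case: eqVneq => [ll'|]; last by rewrite mulr0.
by move: ln; rewrite ll' ln'.
Qed.

Lemma banded_continuous n v : banded n v -> continuous v.
Proof.
move=> [c hc ->] x; rewrite /continuous_at.
by apply: (@cvg_big _ _ _ _ _) => [|l _]; [exact: add_continuous|exact: (eigenspace_continuous es (hc l))].
Qed.

Lemma banded_lin n a u v : banded n u -> banded n v -> banded n (fun x => a * u x + v x).
Proof.
move=> [c hc ->] [c' hc' ->]; exists (fun l x => a * c l x + c' l x).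
  by move=> l; exact: eigenspace_lin.
by apply/funext => x; rewrite mulr_sumr -big_split.
Qed.

Lemma banded0 n : banded n (cst 0).
Proof.
exists (fun=> cst 0); first by move=> l; exact: (eigenspace0 es).
by apply/funext => x; rewrite big1.
Qed.

Lemma banded_le n n' v : (n <= n')%N -> banded n v -> banded n' v.
Proof.
move=> nn' [c hc ->]; exists (fun l => if l \in sp n then c l else cst 0).
  by move=> l; case: ifP => // _; exact: (eigenspace0 es).
apply/funext => x; apply/esym.
rewrite (@eq_sum_support _ (sp n) _ (fun l => (if l \in sp n then c l else cst 0) x))//.
- by rewrite big_seq [RHS]big_seq; apply: eq_bigr => l ->.
- exact: sp_uniq.
- exact: sp_uniq.
- exact: sp_le.
- by move=> l _ /negbTE ->.
Qed.

(** The eigenvalue of a nonzero v belongs to the spectrum, and its projection kernel is not zero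
    because it reproduces v. *)
Lemma banded_eigen l v : Defs.eigenspace D e mu l v -> exists n, banded n v.
Proof.
move=> hv; have [->|v0] := pselect (v = cst 0); first by exists 0%N; exact: banded0.
have Ll := eigenspace_spectrum es hv v0.
exists (Num.bound `|l|); exists (fun l' => if l' == l then v else cst 0).
  by move=> l'; case: eqP => [->//|_]; exact: (eigenspace0 es).
have ln : l \in sp (Num.bound `|l|).
  apply/(mem_sp); split => //.
    by rewrite (le_trans (ler_norm _))// ltW// archi_boundP.
  apply: contrapT => Pl; apply: v0; apply/funext => x.
  rewrite -(kernel_op_id es (hP Ll) x hv) /kernel_op.
  have P0 y : P l y y = 0 by apply/eqP/negPn/negP => Py; apply: Pl; exists y.
  rewrite /rinner (@eq_Rintegral _ _ _ _ _ (cst 0)) ?Rintegral_cst ?mul0r// => y _.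
  suff -> : P l x y = 0 by rewrite mul0r.
  by apply/eqP; rewrite -normr_le0 (le_trans (kernel_le_diag es (hP Ll) x y))// !P0 addr0 mul0r.
apply/funext => x; rewrite (bigD1_seq l ln (sp_uniq _))/= eqxx big1 ?addr0// => l' /negbTE ->.
by [].
Qed.

(** For v in band n this is m(x, -Delta) v, and by [mult_le] a larger band gives the same
    function. *)
Definition mult m n v : X -> R :=
  fun x => \sum_(l <- sp n) m x l * rinner mu (P l x) v.

Lemma mult_le m n n' v x : banded n v -> (n <= n')%N -> mult m n' v x = mult m n v x.
Proof.
move=> bv nn'; rewrite /mult (@eq_sum_support _ (sp n))//.
  exact: sp_uniq.
  exact: sp_uniq.
  exact: sp_le.
move=> l ln' ln; have Ll := sp_spectrum ln'.
by case: bv => c hc ->; rewrite rinner_band// (negbTE ln) mulr0.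
Qed.

Lemma mult_continuous m n v : (forall l, continuous (m ^~ l)) -> L2 mu v ->
  continuous (mult m n v).
Proof.
move=> cm Lv x.
have : \sum_(l <- sp n | l \in sp n) m y l * rinner mu (P l y) v @[y --> x] -->
    \sum_(l <- sp n | l \in sp n) m x l * rinner mu (P l x) v.
  apply: (@cvg_big _ _ _ _ _) => [|l ln]; first exact: add_continuous.
  apply: cvgM; first exact: cm.
  exact: (eigenspace_continuous es (kernel_op_eigen (hP (sp_spectrum ln)) Lv)).
by rewrite /continuous_at/mult -big_seq; under eq_cvg do rewrite -big_seq.
Qed.

Definition laplacian_bounded m B := forall l, exists2 f : X -> R,
  weak_laplacian D e mu (m ^~ l) f & continuous f /\ forall x, `|m x l| <= B /\ `|f x| <= B.

Lemma laplacian_bounded_continuous m B : laplacian_bounded m B -> forall l, continuous (m ^~ l).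
Proof. by move=> hm l; have [f [Dm _ _] _] := hm l; exact: (es_continuous es Dm). Qed.

(* Apply the Sobolev inequality to z |-> sum_l m(z, l) v_l(x), evaluate it at
   z = x and integrate in x: by orthogonality only diagonal terms remain. *)
Lemma mult_bound : exists2 C : R, 0 <= C & forall m B, laplacian_bounded m B ->
  forall n v, banded n v -> rinner mu (mult m n v) (mult m n v) <= C * B ^+ 2 * rinner mu v v.
Proof.
have [C C0 hC] := sobolev es.
exists (C * (2 * mass mu)); first by rewrite !mulr_ge0// mass_ge0.
move=> m B hm n v bv; have Lv := continuous_L2 es (banded_continuous bv).
have /choice[f hf] : forall l, exists f : X -> R, [/\ weak_laplacian D e mu (m ^~ l) f,
    continuous f & forall x, `|m x l| <= B /\ `|f x| <= B].
  by move=> l; have [f h1 [h2 h3]] := hm l; exists f.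
have wf l : weak_laplacian D e mu (m ^~ l) (f l) by case: (hf l).
have cf l : continuous (f l) by case: (hf l).
have mB l x : `|m x l| <= B by case: (hf l) => _ _ /(_ x)[].
have fB l x : `|f l x| <= B by case: (hf l) => _ _ /(_ x)[].
have [c hc vE] := bv.
pose s := sp n.
have Lc l := eigenspace_L2 es (hc l).
have cc l : continuous (c l) := eigenspace_continuous es (hc l).
have orth l l' : l \in s -> l' \in s -> l != l' -> rinner mu (c l) (c l') = 0.
  by move=> _ _ ll'; exact: (eigenspace_orthogonal es ll' (hc l) (hc l')).
have cm l : continuous (m ^~ l) by exact: laplacian_bounded_continuous hm l.
have [i1 h1] := integral_sq_sum es (sp_uniq n) (fun l _ => cm l)
  (fun l x _ => mB l x) cc orth.
have [i2 h2] := integral_sq_sum es (sp_uniq n) (fun l _ => cf l) (fun l x _ => fB l x) cc orth.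
have vv : rinner mu v v = \sum_(l <- s) rinner mu (c l) (c l).
  have vE1 : v = (fun x => \sum_(l <- s) 1 * c l x).
    by rewrite vE; apply/funext => y; apply: eq_bigr => l' _; rewrite mul1r.
  rewrite {1}vE1 rinner_suml// big_seq [RHS]big_seq; apply: eq_bigr => l ls.
  rewrite mul1r rinnerC vE1 rinner_suml// (bigD1_seq l ls (sp_uniq n))/= mul1r big1_seq ?addr0//.
  by move=> l' /andP[ll' ls']; rewrite mul1r orth.
have multE x : mult m n v x = \sum_(l <- s) c l x * m x l.
  rewrite /mult big_seq [RHS]big_seq; apply: eq_bigr => l ls.
  by rewrite vE rinner_band ?ls 1?mulrC//; exact: sp_spectrum ls.
move: i1 h1 i2 h2; rewrite -/s -vv.
set G1 := (fun x => rinner mu (fun z => \sum_(l <- s) c l x * m z l) _).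
set G2 := (fun x => rinner mu (fun z => \sum_(l <- s) c l x * f l z) _).
move=> i1 h1 i2 h2.
have key x : mult m n v x * mult m n v x <= C * (G1 x + G2 x).
  rewrite -expr2 multE; apply: (hC _ (fun z => \sum_(l <- s) c l x * f l z)).
  by apply: (weak_laplacian_sum es) => l _.
have i12 : mu.-integrable [set: borel X] (EFin \o (fun x => G1 x + G2 x)).
  by have := integrableD measurableT i1 i2.
rewrite /rinner; apply: (@le_trans _ _ (\int[mu]_x (C * (G1 x + G2 x)))).
  apply: le_Rintegral => //; last by have := integrableZl measurableT C i12.
  apply: L2_integrable_mul; apply: (continuous_L2 es); apply: mult_continuous => //;
  exact: laplacian_bounded_continuous hm.
rewrite RintegralZl// RintegralD// -[C * _ * _]mulrA -[C * _ * _]mulrA ler_wpM2l//.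
by move: h1 h2; rewrite -/(rinner mu v v); lra.
Qed.

(** With g = 1 this is the whole symbol on l > 0, and with g the low-pass filter it is [truncated].
    A factor in l alone passes through the Laplacian in x. *)
Definition cutoff q (g : R -> R) : X -> R -> R := fun x l => if 0 < l then q x l * g l else 0.

Lemma cutoff_laplacian_bounded q : real_symbol q -> exists2 B, 0 <= B &
  forall (g : R -> R) (b : R), 0 <= b -> (forall l, 0 < l -> `|g l| <= b) ->
    laplacian_bounded (cutoff q g) (B * b).
Proof.
move=> hq; have [B1 B10 qB] := real_symbol_bounded hq.
have [B2 hB2] := rsy_laplacian hq.
exists (B1 + `|B2|); first by rewrite addr_ge0.
move=> g b b0 gb l; have [l0|l0] := boolP (0 < l); last first.
  exists (cst 0).
    have := weak_laplacian0 es; congr weak_laplacian.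
    by apply/funext => x; rewrite /cutoff (negbTE l0).
  split; first by move=> x; exact: cvg_cst.
  by move=> x; rewrite /cutoff (negbTE l0) normr0 mulr_ge0 ?addr_ge0.
have [f [cf wf fB]] := hB2 l l0.
exists (fun x => g l * f x + cst 0 x).
  have := weak_laplacian_lin es (g l) wf (weak_laplacian0 es).
  by congr weak_laplacian; apply/funext => x; rewrite /cutoff l0 addr0 mulrC.
split; first by move=> x; apply: cvgD; [apply: cvgMr; exact: cf|exact: cvg_cst].
move=> x; rewrite /cutoff l0 addr0 !normrM; split.
  by rewrite ler_pM// ?gb// (le_trans (qB x l l0))// lerDl.
rewrite mulrC ler_pM// ?gb// (le_trans (fB x))// (le_trans (ler_norm _))// lerDr.
exact: B10.
Qed.

(** * The truncated operators on L^2 limits of eigenfunctions *)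

Definition truncated_op k q J u : X -> R :=
  fun x => rinner mu (truncated_kernel k q J x) u.

Lemma low_pass_expR_bound k J l : 0 < l -> `|low_pass k (expR (- (l / 2 ^+ J)))| <= 1.
Proof.
move=> l0; have [g0 g1 _] := low_pass_bound k (expR_pow2_itv J (ltW l0)).
by rewrite ger0_norm.
Qed.

Lemma truncated_kernel_continuous k q J x : real_symbol q ->
  continuous (truncated_kernel k q J x).
Proof.
move=> hq; have [B B0 qB] := real_symbol_bounded hq.
have c := kernel_of_continuous (pow2_ge1 J)
  (truncated_decays k J B0 qB) (fun l _ => @truncated_continuous k q J l hq).
move=> y; apply: (@continuous_comp _ _ _ (fun y => (x, y))
  (fun z : X * X => kernel_of (truncated k q J) z.1 z.2)); last exact: c.
by apply: cvg_pair => /=; [exact: cvg_cst|exact: cvg_id].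
Qed.

(** Cauchy-Schwarz with a bounded kernel. The constant depends on J and serves to pass to limits at
    fixed J. *)
Lemma truncated_op_sup k q J : real_symbol q -> exists2 C : R, 0 <= C &
  forall u x, L2 mu u -> truncated_op k q J u x ^+ 2 <= C * rinner mu u u.
Proof.
move=> hq; have [B B0 qB] := real_symbol_bounded hq.
exists ((k.+1%:R * B * (c1 * (2 ^+ J) `^ (d / (d + 1)))) ^+ 2 * mass mu).
  by rewrite mulr_ge0 ?sqr_ge0// mass_ge0.
move=> u x Lu; have cK : continuous (truncated_kernel k q J x) := @truncated_kernel_continuous k q J x hq.
rewrite (le_trans (rinner_cauchy (continuous_L2 es cK) Lu))// ler_wpM2r ?rinner_ge0//.
apply: (rinner_bound es cK) => y.
exact: (kernel_of_le x y (pow2_ge1 J) (truncated_decays k J B0 qB)).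
Qed.

Lemma truncated_op_lin k q J a u v x : real_symbol q -> L2 mu u -> L2 mu v ->
  truncated_op k q J (fun x => a * u x + v x) x = a * truncated_op k q J u x + truncated_op k q J v x.
Proof.
move=> hq Lu Lv; apply: rinner_linr => //.
exact: (continuous_L2 es (@truncated_kernel_continuous k q J x hq)).
Qed.

(** The kernel is a limit of finite spectral sums, uniformly in y, and each of these whose band
    contains that of v acts on v as the multiplier. *)
Lemma truncated_op_banded k q J n v x : real_symbol q -> banded n v ->
  truncated_op k q J v x = mult (truncated k q J) n v x.
Proof.
move=> hq bv; have [B B0 qB] := real_symbol_bounded hq.
have Lv := continuous_L2 es (banded_continuous bv).
have Lc n' : L2 mu (kernel_sum (truncated k q J) n' x).
  apply: (continuous_L2 es) => y.
  apply: (@continuous_comp _ _ _ (fun y => (x, y))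
    (fun z : X * X => kernel_sum (truncated k q J) n' z.1 z.2)).
    by apply: cvg_pair => /=; [exact: cvg_cst|exact: cvg_id].
  apply: (kernel_sum_continuous).
  by move=> l _; exact: (truncated_continuous).
have LK := continuous_L2 es (@truncated_kernel_continuous k q J x hq).
have sumE n' : (n <= n')%N ->
    rinner mu (kernel_sum (truncated k q J) n' x) v = mult (truncated k q J) n v x.
  move=> nn'; rewrite -(mult_le _ x bv nn').
  rewrite /kernel_sum /spectral_sum /mult.
  pose Q l := if l \in sp n' then P l x else cst 0.
  have LQ l : L2 mu (Q l).
    rewrite /Q; case: ifPn => ln; last exact: L2_0.
    exact: (kernel_L2 es (hP (sp_spectrum ln))).
  have := rinner_suml (sp n') (truncated k q J x) LQ Lv.
  rewrite [X in rinner mu X v](_ : _ = (fun y =>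
     \sum_(l <- sp n') truncated k q J x l * P l x y)).
    move=> ->; rewrite big_seq [RHS]big_seq; apply: eq_bigr => l ln.
    by rewrite /Q ln.
  apply/funext => y; rewrite big_seq [RHS]big_seq; apply: eq_bigr => l ln.
  by rewrite /Q ln.
have s1 := pow2_ge1 J; have s0 : 0 < 2 ^+ J :> R by lra.
pose t n' := kernel_tail (2 ^+ J) (k.+1%:R * B) n' : R.
have t2 : t n' ^+ 2 * mass mu * rinner mu v v @[n' --> \oo] --> 0.
  rewrite -[X in _ --> X](mul0r (rinner mu v v)); apply: cvgMl.
  rewrite -[X in _ --> X](mul0r (mass mu)); apply: cvgMl.
  rewrite (_ : 0 = 0 * 0 :> R); last by rewrite mulr0.
  by apply: cvgM; exact: kernel_tail0.
apply/eqP; rewrite -subr_eq0 -sqrf_eq0 eq_le sqr_ge0 andbT.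
apply: (@ler_cvg_to _ \oo _ _ (cst ((truncated_op k q J v x - mult (truncated k q J) n v x) ^+ 2)) _ _ _ (cvg_cst _) t2).
exists n => // n' /= nn'; rewrite -(sumE _ nn') /truncated_op.
have -> : rinner mu (truncated_kernel k q J x) v - rinner mu (kernel_sum (truncated k q J) n' x) v =
   rinner mu (fun y => -1 * kernel_sum (truncated k q J) n' x y + truncated_kernel k q J x y) v.
  by rewrite rinner_lin//; ring.
rewrite (le_trans (rinner_cauchy _ Lv))//; first exact: L2_lin.
rewrite ler_wpM2r ?rinner_ge0//; apply: (Rintegral_le_const es).
  by apply: L2_integrable_mul; exact: L2_lin.
move=> y; have [_ /(_ n')] := kernel_of_cvg x y s1 (truncated_decays k J B0 qB).
rewrite -/(t n') ler_norml /truncated_kernel => /andP[h1' h2']; nra.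
Qed.

Lemma mult_cutoff_L2 q (g : R -> R) n v : real_symbol q ->
  (forall l, 0 < l -> `|g l| <= 1) -> banded n v ->
  L2 mu (mult (cutoff q g) n v).
Proof.
move=> hq hg bv; have [B _ /(_ g 1 ler01 hg) hB] := cutoff_laplacian_bounded hq.
apply/(continuous_L2 es)/(mult_continuous) => [l|].
  exact: (laplacian_bounded_continuous hB).
exact: (continuous_L2 es (banded_continuous bv)).
Qed.

Lemma rinner_sqD_le a f g : L2 mu f -> L2 mu g ->
  rinner mu (fun x => a * f x + g x) (fun x => a * f x + g x) <=
  2 * a ^+ 2 * rinner mu f f + 2 * rinner mu g g.
Proof.
move=> Lf Lg; have := rinner_ge0 mu (fun x => a * f x + -1 * g x).
have := rinner_sqD a 1 Lf Lg; have := rinner_sqD a (-1) Lf Lg.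
have -> : (fun x => a * f x + 1 * g x) = (fun x => a * f x + g x).
  by apply/funext => x; rewrite mul1r.
by move=> -> -> /[!(expr1n, sqrrN)]; lra.
Qed.

Lemma low_pass_expR_cvg k l : low_pass k (expR (- (l / 2 ^+ J))) @[J --> \oo] --> (1 : R).
Proof.
have y0 : - (l / 2 ^+ J) @[J --> \oo] --> (0 : R).
  rewrite -oppr0; apply: cvgN; rewrite -[X in _ --> X](mulr0 l); apply: cvgMr.
  have -> : (fun J => (2 ^+ J)^-1) = (fun J => (2^-1 : R) ^+ J) by apply/funext => J; rewrite exprVn.
  by apply: cvg_expr; rewrite ger0_norm// invf_lt1// ltr1n.
have yc : expR (- (l / 2 ^+ J)) @[J --> \oo] --> (1 : R).
  rewrite -[X in _ --> X](expR0 R).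
  exact: (@cvg_comp _ _ _ _ expR _ _ _ y0 (@continuous_expR R 0)).
have lc : continuous (low_pass k : R -> R).
  move=> y; rewrite /continuous_at /low_pass; apply: cvgB; first exact: cvg_cst.
  have c1' : 1 - z ^+ k.+1 @[z --> y] --> 1 - y ^+ k.+1.
    by apply: cvgB; [exact: cvg_cst|exact: exprn_continuous].
  exact: (@cvg_comp _ _ _ _ (fun z : R => z ^+ k.+1) _ _ _ c1' (@exprn_continuous R k.+1 _)).
rewrite -[X in _ --> X](low_pass1 R k).
exact: (@cvg_comp _ _ _ _ (low_pass k) _ _ _ yc (lc 1)).
Qed.

(** A fixed band has finitely many l, so 1 minus the filter tends to 0 uniformly on it, and
    [mult_bound] applies with a bound that tends to 0. *)
Lemma mult_diff_cvg k q n v : real_symbol q -> banded n v ->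
  let f J := diff (mult (cutoff q (cst 1)) n v) (mult (truncated k q J) n v) in
  rinner mu (f J) (f J) @[J --> \oo] --> (0 : R).
Proof.
move=> hq bv f; have [C C0 hC] := mult_bound.
have [B B0 hB] := cutoff_laplacian_bounded hq.
pose b J := \sum_(l <- sp n) `|1 - low_pass k (expR (- (l / 2 ^+ J)))|.
pose g J l := if l \in sp n then 1 - low_pass k (expR (- (l / 2 ^+ J))) else 0.
have fE J : f J = mult (cutoff q (g J)) n v.
  apply/funext => x; rewrite /f /diff /mult mulr_sumr -big_split/= big_seq [RHS]big_seq.
  apply: eq_bigr => l ln; rewrite /cutoff /truncated /g ln.
  by case: ifPn => _ /=; ring.
have b0 J : 0 <= b J by apply: sumr_ge0.
have gb J l : `|g J l| <= b J.
  rewrite /g; case: ifPn => ln; last by rewrite normr0.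
  by rewrite /b (bigD1_seq l ln (sp_uniq _))//= lerDl sumr_ge0.
have bc : b J @[J --> \oo] --> (0 : R).
  rewrite [X in _ --> X](_ : 0 = \sum_(l <- sp n) (0 : R)); last by rewrite big1.
  apply: (@cvg_big _ _ _ _ _) => [|l _]; first exact: add_continuous.
  rewrite -(normr0 R); apply: cvg_norm; rewrite -[X in _ --> X](subrr (1 : R)).
  by apply: cvgB; [exact: cvg_cst|exact: low_pass_expR_cvg].
apply: (@squeeze_cvgr _ _ _ _ (cst 0) (fun J => C * (B * b J) ^+ 2 * rinner mu v v)).
- near=> J; rewrite rinner_ge0/= fE; apply: hC => //; exact: hB.
- exact: cvg_cst.
- rewrite [X in _ --> X](_ : 0 = C * (B * 0) ^+ 2 * rinner mu v v); last by rewrite !(mulr0, expr0n, mul0r).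
  have Bb : B * b J @[J --> \oo] --> B * 0 by exact: cvgMr.
  by apply: cvgMl; apply: cvgMr; rewrite expr2; exact: (cvgM Bb Bb).
Unshelve. all: by end_near. Qed.

Definition band_limit (v : nat -> X -> R) u := [/\ L2 mu u,
  forall j, exists n, banded n (v j) &
  rinner mu (diff (v j) u) (diff (v j) u) @[j --> \oo] --> (0 : R)].

Lemma band_limit_sub (v : nat -> X -> R) u n w : band_limit v u -> banded n w ->
  band_limit (fun j => diff (v j) w) (diff u w).
Proof.
move=> [Lu bv vu] bw; split.
- exact: L2_lin (continuous_L2 es (banded_continuous bw)) Lu.
- move=> j; have [m bm] := bv j; exists (maxn m n).
  by apply: (banded_lin); [exact: (banded_le (leq_maxr _ _) bw)|exact: (banded_le (leq_maxl _ _) bm)].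
- have -> : (fun j => rinner mu (diff (diff (v j) w) (diff u w)) (diff (diff (v j) w) (diff u w))) =
    (fun j => rinner mu (diff (v j) u) (diff (v j) u)); last exact: vu.
  apply/funext => j; suff -> : diff (diff (v j) w) (diff u w) = diff (v j) u by [].
  by apply/funext => x; rewrite /diff; ring.
Qed.

(** A uniform limit of continuous functions, by [truncated_op_sup]. *)
Lemma truncated_op_continuous k q J (v : nat -> X -> R) u : real_symbol q ->
  band_limit v u -> continuous (truncated_op k q J u).
Proof.
move=> hq [Lu bv vu] x0.
have [C C0 hC] := truncated_op_sup k J hq.
have cv j : continuous (v j) by have [n bn] := bv j; exact: (banded_continuous bn).
have Lv j : L2 mu (v j) by exact: (continuous_L2 es (cv j)).
have cT j : continuous (truncated_op k q J (v j)).
  have [n bn] := bv j.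
  rewrite (_ : truncated_op k q J (v j) = mult (truncated k q J) n (v j)).
    apply: (mult_continuous) => // l.
    exact: (truncated_continuous).
  by apply/funext => x; exact: (truncated_op_banded).
apply/cvgrPdist_le => eps e0; have e3 : 0 < (eps / 3) ^+ 2 by rewrite exprn_gt0; lra.
have c0 : C * rinner mu (diff (v j) u) (diff (v j) u) @[j --> \oo] --> (0 : R).
  by rewrite -[X in _ --> X](mulr0 C); apply: cvgMr.
have [j _ /(_ j (leqnn j)) hj] := (cvgr_le 0 c0) _ e3.
have close x : `|truncated_op k q J (v j) x - truncated_op k q J u x| <= eps / 3.
  have := hC (diff (v j) u) x (L2_lin (-1) Lu (Lv j)).
  rewrite (truncated_op_lin)// => h1.
  have h2 := le_trans h1 hj; have e3' : 0 <= eps / 3 by lra.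
  rewrite -(ler_pXn2r (n := 2))// ?nnegrE//; rewrite real_normK ?num_real//.
  by rewrite (le_trans _ h2)// le_eqVlt; apply/orP; left; apply/eqP; ring.
have ep : 0 < eps / 3 by lra.
have /cvgrPdist_le/(_ _ ep) := cT j x0; apply: filterS => x hx.
have := close x0; have := close x; move: hx.
rewrite !ler_norml => *; apply/andP; split; lra.
Qed.

(** The constant of [truncated_op_sup], which depends on J, multiplies only the square distance from
    v_j to u, and this tends to 0 at fixed J. What survives is the constant of [mult_bound], the
    same for all J because the filters are bounded by 1. *)
Lemma truncated_op_bound k q : real_symbol q -> exists2 C : R, 0 <= C &
  forall J (v : nat -> X -> R) u, band_limit v u ->
  rinner mu (truncated_op k q J u) (truncated_op k q J u) <= C * rinner mu u u.
Proof.
move=> hq; have [C C0 hC] := mult_bound.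
have [B B0 hB] := cutoff_laplacian_bounded hq.
pose A := C * (B * 1) ^+ 2; have A0 : 0 <= A by rewrite mulr_ge0// sqr_ge0.
exists (4 * A); first by rewrite mulr_ge0.
move=> J v u vu; have [Lu bv cvu] := vu.
have [C' C'0 hC'] := truncated_op_sup k J hq.
have Lv j : L2 mu (v j) by have [n bn] := bv j; exact: (continuous_L2 es (banded_continuous bn)).
have TL j : rinner mu (truncated_op k q J (v j)) (truncated_op k q J (v j)) <= A * rinner mu (v j) (v j).
  have [n bn] := bv j.
  rewrite (_ : truncated_op k q J (v j) = mult (truncated k q J) n (v j)).
    apply: (hC _ _ _ n) => //; apply: (hB (fun l => low_pass k (expR (- (l / 2 ^+ J)))) 1) => // l.
    exact: low_pass_expR_bound.
  by apply/funext => x; exact: (truncated_op_banded).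
have cTu : continuous (truncated_op k q J u) := @truncated_op_continuous k q J v u hq vu.
have LT j : L2 mu (truncated_op k q J (v j)).
  apply: (continuous_L2 es); have [n bn] := bv j.
  suff vj : band_limit (fun=> v j) (v j) by move=> x; exact: (@truncated_op_continuous k q J _ _ hq vj x).
  split; [exact: Lv|by move=> _; exists n|].
  rewrite (_ : (fun _ => _) = cst 0); first exact: cvg_cst.
  apply/funext => j'; rewrite /rinner (@eq_Rintegral _ _ _ _ _ (cst 0)) ?Rintegral_cst ?mul0r//.
  by move=> x _; rewrite /diff mulN1r addNr mulr0.
have Ldiff j : L2 mu (diff (v j) u) by exact: L2_lin.
pose K := 2 * C' * mass mu + 4 * A.
have le j : rinner mu (truncated_op k q J u) (truncated_op k q J u) <=
    K * rinner mu (diff (v j) u) (diff (v j) u) + 4 * A * rinner mu u u.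
  have TE x : truncated_op k q J (diff (v j) u) x =
      -1 * truncated_op k q J u x + truncated_op k q J (v j) x.
    exact: (truncated_op_lin).
  have LTd : L2 mu (truncated_op k q J (diff (v j) u)).
    rewrite (_ : truncated_op k q J (diff (v j) u) = fun x =>
      -1 * truncated_op k q J u x + truncated_op k q J (v j) x).
      exact: L2_lin (continuous_L2 es cTu) (LT j).
    by apply/funext.
  have h1 := rinner_sqD_le (-1) LTd (LT j).
  have h2 := rinner_sqD_le 1 (Ldiff j) Lu.
  have h3 : rinner mu (truncated_op k q J (diff (v j) u))
      (truncated_op k q J (diff (v j) u)) <=
      C' * rinner mu (diff (v j) u) (diff (v j) u) * mass mu.
    apply: (Rintegral_le_const es); first exact: L2_integrable_mul.
    by move=> x; rewrite -expr2; exact: hC'.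
  have E1 : (fun x => -1 * truncated_op k q J (diff (v j) u) x +
     truncated_op k q J (v j) x) = truncated_op k q J u.
    by apply/funext => x; rewrite TE; ring.
  have E2 : (fun x => 1 * diff (v j) u x + u x) = v j.
    by apply/funext => x; rewrite /diff; ring.
  rewrite E1 in h1; rewrite E2 in h2; rewrite /K.
  move: h1 h2 h3 (ler_wpM2l A0 h2) (TL j); rewrite sqrrN expr1n {TL}.
  by clear; do ?[move: (rinner _ _ _) => ?]; lra.
have cle : K * rinner mu (diff (v j) u) (diff (v j) u) + 4 * A * rinner mu u u @[j --> \oo] -->
    4 * A * rinner mu u u.
  rewrite -[X in _ --> X]add0r; apply: cvgD; last exact: cvg_cst.
  by rewrite -[X in _ --> X](mulr0 K); apply: cvgMr.
apply: (@ler_cvg_to _ \oo _ _ (cst (rinner mu (truncated_op k q J u) (truncated_op k q J u))) _ _ _ (cvg_cst _) cle).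
by near=> j; exact: le.
Unshelve. all: by end_near. Qed.

(** T_J u - p v_j is T_J (u - v_j) plus T_J v_j - p v_j. The first is small for large j uniformly in
    J, the second for large J once j is fixed; hence the order of the quantifiers. *)
Lemma truncated_op_approx k q (v : nat -> X -> R) (n : nat -> nat) u (eps : R) :
  real_symbol q -> band_limit v u -> (forall j, banded (n j) (v j)) -> 0 < eps ->
  \forall j \near \oo, \forall J \near \oo,
   let f := diff (truncated_op k q J u) (mult (cutoff q (cst 1)) (n j) (v j)) in
   rinner mu f f <= eps.
Proof.
move=> hq vu bv e0; have [Lu _ cvu] := vu.
have [C C0 hC] := truncated_op_bound k hq.
have cc : C * rinner mu (diff (v j) u) (diff (v j) u) @[j --> \oo] --> (0 : R).
  by rewrite -[X in _ --> X](mulr0 C); apply: cvgMr.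
have e4 : 0 < eps / 4 by lra.
near=> j; have hj : C * rinner mu (diff (v j) u) (diff (v j) u) <= eps / 4.
  by near: j; exact: ((cvgr_le 0 cc) _ e4).
near=> J; set f := diff _ _.
have hJ : let g := diff (mult (cutoff q (cst 1)) (n j) (v j))
    (mult (truncated k q J) (n j) (v j)) in rinner mu g g <= eps / 4.
  by near: J; exact: ((cvgr_le 0 (mult_diff_cvg k hq (bv j))) _ e4).
have Lv := continuous_L2 es (banded_continuous (bv j)).
have h1 := hC J _ _ (band_limit_sub vu (bv j)).
have TE x : truncated_op k q J (diff u (v j)) x =
    -1 * truncated_op k q J (v j) x + truncated_op k q J u x.
  exact: (truncated_op_lin k J (-1) x hq Lv Lu).
have fE : f = (fun x => -1 * diff (mult (cutoff q (cst 1)) (n j) (v j))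
     (mult (truncated k q J) (n j) (v j)) x + truncated_op k q J (diff u (v j)) x).
  apply/funext => x; rewrite TE /f /diff.
  by rewrite -(truncated_op_banded)//; ring.
have uv : rinner mu (diff u (v j)) (diff u (v j)) = rinner mu (diff (v j) u) (diff (v j) u).
  by apply: eq_Rintegral => x _; rewrite /diff; ring.
have LTd : L2 mu (truncated_op k q J (diff u (v j))).
  exact: (continuous_L2 es (@truncated_op_continuous k q J _ _ hq (band_limit_sub vu (bv j)))).
have Lm : L2 mu (diff (mult (cutoff q (cst 1)) (n j) (v j))
    (mult (truncated k q J) (n j) (v j))).
  have cg := fun (g : R -> R) hg => mult_cutoff_L2 (g := g) hq hg (bv j).
  apply: L2_lin; apply: cg => l l0; first exact: low_pass_expR_bound.
  by rewrite normr1.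
have h2 := rinner_sqD_le (-1) Lm LTd.
by rewrite uv in h1; rewrite fE; move: h1 h2 hj hJ; rewrite sqrrN expr1n /=; lra.
Unshelve. all: by end_near. Qed.

(** * Off the support of u: pointwise limit and L^2 limit *)

Definition off_diagonal_approx k q C := forall x y, x <> y ->
   [/\ `|symbol_kernel k q x y| <= C * rho x y `^ (- d) &
       forall J, `|symbol_kernel k q x y - truncated_kernel k q J x y| <=
         C / rho x y `^ (d + 1) * (2 `^ (d / (d + 1)) / 2) ^+ J].

Lemma dyadic_decay A : A * (2 `^ (d / (d + 1)) / 2) ^+ J @[J --> \oo] --> (0 : R).
Proof.
rewrite -[X in _ --> X](mulr0 A); apply: cvgMr; apply: cvg_expr.
rewrite ger0_norm ?divr_ge0 ?powR_ge0// ltr_pdivrMr// mul1r.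
rewrite -[ltRHS](@powRr1 _ 2)// /powR pnatr_eq0/= ltr_expR ltr_pM2r ?ln_gt0 ?ltr1n//.
by rewrite ltr_pdivrMr ?mul1r ?ltrDl// addr_gt0.
Qed.

(** Away from x it is a limit of continuous functions; the indicator of the complement of x produces
    the value 0 at x. *)
Lemma symbol_kernel_measurable k q C x : real_symbol q -> off_diagonal_approx k q C ->
  measurable_fun [set: borel X] (symbol_kernel k q x : borel X -> R).
Proof.
move=> hq hC.
have cK J : continuous (truncated_kernel k q J x).
  exact: (@truncated_kernel_continuous k q J x hq).
have mx : measurable (~` [set x] : set (borel X)).
  apply: measurableC; apply: closed_borel.
  exact/accessible_closed_set1/hausdorff_accessible/(es_hausdorff es).
apply: (@measurable_fun_cvg _ (borel X) R [set: borel X] (fun J (y : borel X) => truncated_kernel k q J x y * \1_(~` [set x]) y)).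
  move=> J; apply: measurable_funM; first exact: continuous_borel.
  exact: measurable_indic.
move=> y _; have [<-|xy] := pselect (x = y).
  rewrite /symbol_kernel eqxx indicE memNset ?mulr0; last by move=> /(_ erefl).
  by rewrite (_ : (fun _ => _) = cst 0); [exact: cvg_cst|apply/funext => J; rewrite mulr0].
have -> : \1_(~` [set x]) y = 1 :> R by rewrite indicE mem_set// => yx; apply: xy.
under eq_cvg do rewrite mulr1.
have [_ h1] := hC x y xy.
apply/cvgrPdist_le => eps e0; near=> J; rewrite (le_trans (h1 J))//.
by near: J; exact: ((cvgr_le 0 (dyadic_decay (C / rho x y `^ (d + 1)))) _ e0).
Unshelve. all: by end_near. Qed.

(** As u vanishes near x, only points y outside U count. There R(x, y) is bounded below, so the
    kernels converge uniformly and Cauchy-Schwarz carries the limit through the integral. *)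
Lemma off_support k q C u x (U : set X) : real_symbol q -> 0 <= C ->
  off_diagonal_approx k q C -> L2 mu u -> open U -> U x ->
  mu.-negligible ([set y | U y /\ u y <> 0] : set (borel X)) ->
  mu.-integrable [set: borel X] (EFin \o (fun y => symbol_kernel k q x y * u y)) /\
  truncated_op k q J u x @[J --> \oo] --> rinner mu (symbol_kernel k q x) u.
Proof.
move=> hq C0 hC Lu oU Ux neg.
have [c c0 hc] := resistance_away es oU Ux.
have d1 : 0 < d + 1 by rewrite addr_gt0.
have mK := symbol_kernel_measurable x hq hC.
have mI : measurable_fun [set: borel X] (\1_(~` U) : borel X -> R).
  by apply: measurable_indic; apply: measurableC; exact: open_borel.
have cK J : continuous (truncated_kernel k q J x).
  exact: (@truncated_kernel_continuous k q J x hq).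
have LK J := continuous_L2 es (cK J).
pose f y := symbol_kernel k q x y * \1_(~` U) y.
pose fJ J y := truncated_kernel k q J x y * \1_(~` U) y.
have I0 y : U y -> \1_(~` U) y = 0 :> R.
  by move=> Uy; rewrite indicE memNset// => /(_ Uy).
have I1 y : ~ U y -> \1_(~` U) y = 1 :> R by move=> nUy; rewrite indicE mem_set.
have xy y : ~ U y -> x <> y by move=> nUy xy; apply: nUy; rewrite -xy.
have fB y : `|f y| <= C * c `^ (- d).
  have [Uy|nUy] := pselect (U y).
    by rewrite /f I0// mulr0 normr0 mulr_ge0// powR_ge0.
  rewrite /f I1// mulr1; have [h1 _] := hC x y (xy y nUy).
  rewrite (le_trans h1)// ler_wpM2l// !powRN lef_pV2 ?posrE ?powR_gt0//; last first.
    exact: lt_le_trans c0 (hc y nUy).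
  by rewrite ge0_ler_powR ?nnegrE ?(ltW d_gt0) ?(ltW c0) ?hc// (le_trans (ltW c0)) ?hc.
have Lf : L2 mu f by apply: (bounded_L2 es _ fB); exact: measurable_funM.
pose A := C / c `^ (d + 1); pose b : R := 2 `^ (d / (d + 1)) / 2.
have diffB J y : `|-1 * fJ J y + f y| <= A * b ^+ J.
  have b0 : 0 <= b by rewrite divr_ge0// powR_ge0.
  have A0 : 0 <= A by rewrite divr_ge0// powR_ge0.
  have [Uy|nUy] := pselect (U y).
    by rewrite /f /fJ I0// !mulr0 addr0 normr0 mulr_ge0// exprn_ge0.
  have [_ /(_ J) h1] := hC x y (xy y nUy).
  rewrite /f /fJ I1// !mulr1 mulN1r addrC (le_trans h1)// ler_wpM2r ?exprn_ge0//.
  rewrite ler_wpM2l// lef_pV2 ?posrE ?powR_gt0//; last exact: lt_le_trans c0 (hc y nUy).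
  by rewrite ge0_ler_powR ?nnegrE ?(ltW d1) ?(ltW c0) ?hc// (le_trans (ltW c0)) ?hc.
have LfJ J : L2 mu (fJ J).
  have [B _ hB] := continuous_bounded es (cK J).
  apply: (bounded_L2 es (B := B)).
    by apply: measurable_funM => //; exact: continuous_borel.
  move=> y; rewrite /fJ; have [Uy|nUy] := pselect (U y); last by rewrite I1// mulr1.
  by rewrite I0// mulr0 normr0 (le_trans (normr_ge0 _) (hB y)).
have ae (g : X -> R) : measurable_fun [set: borel X] (g : borel X -> R) ->
    L2 mu (fun y => g y * \1_(~` U) y) ->
    mu.-integrable [set: borel X] (EFin \o (fun y => g y * u y)) /\
    rinner mu g u = rinner mu (fun y => g y * \1_(~` U) y) u.
  move=> mg Lg; apply: eq_ae_integral.
  - by apply: measurable_funM => //; exact: L2_measurable Lu.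
  - exact: L2_integrable_mul.
  - case: neg => N [mN N0 hN]; exists N; split => // y /= hy; apply: hN => /=.
    have [Uy|nUy] := pselect (U y); last by exfalso; apply: hy; rewrite I1// mulr1.
    by split => // uy; apply: hy; rewrite uy !mulr0.
have [iK ->] := ae _ mK Lf; split => //.
have TE J : truncated_op k q J u x = rinner mu (fJ J) u.
  by have [_] := ae _ (continuous_borel (cK J)) (LfJ J).
under eq_cvg do rewrite TE.
pose S := mass mu * rinner mu u u.
have S0 : 0 <= S by rewrite mulr_ge0 ?mass_ge0 ?rinner_ge0.
apply/cvgrPdist_le => eps e0.
near=> J; have hJ : A * Num.sqrt S * b ^+ J <= eps.
  by near: J; exact: ((cvgr_le 0 (dyadic_decay (A * Num.sqrt S))) _ e0).
have Ld : L2 mu (fun y => -1 * fJ J y + f y) by exact: L2_lin.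
have -> : rinner mu f u - rinner mu (fJ J) u = rinner mu (fun y => -1 * fJ J y + f y) u.
  by rewrite rinner_lin//; ring.
have A0 : 0 <= A by rewrite divr_ge0// powR_ge0.
have b0 : 0 <= b by rewrite divr_ge0// powR_ge0.
have AS0 : 0 <= A * Num.sqrt S * b ^+ J := mulr_ge0 (mulr_ge0 A0 (sqrtr_ge0 S)) (exprn_ge0 J b0).
rewrite (le_trans _ hJ)// -(ler_pXn2r (n := 2))// ?nnegrE//.
rewrite real_normK ?num_real// (le_trans (rinner_cauchy Ld Lu))//.
rewrite mulrAC exprMn sqr_sqrtr// /S mulrA ler_wpM2r ?rinner_ge0//.
apply: (Rintegral_le_const es); first exact: L2_integrable_mul.
move=> y; rewrite -expr2 -real_normK ?num_real// lerXn2r ?nnegrE ?diffB//.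
exact: le_trans (normr_ge0 _) (diffB J y).
Unshelve. all: by end_near. Qed.

(** The combination of the two truncated operators converges to w in L^2, by comparison with the
    approximating sums, and on O pointwise to the integrals against the kernels, so the two limits
    agree almost everywhere. *)
Lemma kernel_off_support k q C k' q' C' a u u' w (v v' : nat -> X -> R) (n n' : nat -> nat)
    (O : set X) :
  real_symbol q -> 0 <= C -> off_diagonal_approx k q C ->
  real_symbol q' -> 0 <= C' -> off_diagonal_approx k' q' C' ->
  band_limit v u -> (forall j, banded (n j) (v j)) ->
  band_limit v' u' -> (forall j, banded (n' j) (v' j)) ->
  L2 mu w ->
  (let G j x := a * mult (cutoff q' (cst 1)) (n' j) (v' j) x +
     mult (cutoff q (cst 1)) (n j) (v j) x in
   rinner mu (diff w (G j)) (diff w (G j)) @[j --> \oo] --> (0 : R)) ->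
  open O -> (forall x, O x -> vanishes_near mu x u /\ vanishes_near mu x u') ->
  (forall x, O x ->
     mu.-integrable [set: borel X] (EFin \o (fun y => symbol_kernel k q x y * u y)) /\
     mu.-integrable [set: borel X] (EFin \o (fun y => symbol_kernel k' q' x y * u' y))) /\
  mu.-negligible ([set x | O x /\ w x <> a * rinner mu (symbol_kernel k' q' x) u' +
     rinner mu (symbol_kernel k q x) u] : set (borel X)).
Proof.
move=> hq C0 hC hq' C'0 hC' vu bv vu' bv' Lw cG oO hO.
have [Lu _ _] := vu; have [Lu' _ _] := vu'.
have off x : O x -> _ := fun Ox => let: conj (ex_intro U (And3 oU Ux nU)) _ := hO x Ox in
  off_support hq C0 hC Lu oU Ux nU.
have off' x : O x -> _ := fun Ox => let: conj _ (ex_intro U (And3 oU Ux nU)) := hO x Ox in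
  off_support hq' C'0 hC' Lu' oU Ux nU.
split; first by move=> x Ox; split; [case: (off x Ox)|case: (off' x Ox)].
pose F J x := a * truncated_op k' q' J u' x + truncated_op k q J u x.
have LT J : L2 mu (truncated_op k q J u).
  exact: (continuous_L2 es (@truncated_op_continuous k q J v u hq vu)).
have LT' J : L2 mu (truncated_op k' q' J u').
  exact: (continuous_L2 es (@truncated_op_continuous k' q' J v' u' hq' vu')).
apply: (L2_limit_ae (F := F) oO Lw) => [J||x Ox]; last first.
- apply: cvgD; last by case: (off x Ox).
  by apply: cvgMr; case: (off' x Ox).
- apply/cvgrPdist_le => eps e0.
  (* The shares add up to eps: the truncation errors have square norm at most 2 eps/12 + 2 eps/12
     together, which enters twice, and so does eps/6. *)
  have e12 : 0 < eps / 12 by lra.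
  have a2 : 0 < a ^+ 2 + 1 by rewrite ltr_wpDl// sqr_ge0.
  have ea : 0 < eps / 12 / (a ^+ 2 + 1) by rewrite divr_gt0.
  have e6 : 0 < eps / 6 by lra.
  have ap := truncated_op_approx k hq vu bv e12.
  have ap' := truncated_op_approx k' hq' vu' bv' ea.
  have [j [hj [hj' hG]]] := filter_ex (filterI ap (filterI ap' ((cvgr_le 0 cG) _ e6))).
  pose T := mult (cutoff q (cst 1)) (n j) (v j).
  pose T' := mult (cutoff q' (cst 1)) (n' j) (v' j).
  have Lc q0 (i : nat) z : real_symbol q0 -> banded i z ->
      L2 mu (mult (cutoff q0 (cst 1)) i z).
    move=> hq0 bz; apply: (mult_cutoff_L2 hq0) bz => l _.
    by rewrite normr1.
  have LTj : L2 mu T by exact: Lc.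
  have LTj' : L2 mu T' by exact: Lc.
  have LG : L2 mu (fun x => a * T' x + T x) by exact: L2_lin.
  near=> J.
  have hJ : rinner mu (diff (truncated_op k q J u) T)
      (diff (truncated_op k q J u) T) <= eps / 12 by near: J; exact: hj.
  have hJ' : rinner mu (diff (truncated_op k' q' J u') T')
      (diff (truncated_op k' q' J u') T') <= eps / 12 / (a ^+ 2 + 1).
    by near: J; exact: hj'.
  have Ld : L2 mu (diff (truncated_op k q J u) T) by exact: L2_lin.
  have Ld' : L2 mu (diff (truncated_op k' q' J u') T') by exact: L2_lin.
  have LwG : L2 mu (diff w (fun x => a * T' x + T x)) by exact: L2_lin.
  have h1 := rinner_sqD_le a Ld' Ld.
  have h2 := rinner_sqD_le (-1) (L2_lin a Ld' Ld) LwG.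
  rewrite sub0r normrN ger0_norm ?rinner_ge0//.
  have -> : (fun x => -1 * F J x + w x) = (fun x => -1 * (a * diff (truncated_op k' q' J u') T' x +
      diff (truncated_op k q J u) T x) + diff w (fun x => a * T' x + T x) x).
    by apply/funext => x; rewrite /F /diff; ring.
  have h3 : a ^+ 2 * rinner mu (diff (truncated_op k' q' J u') T')
      (diff (truncated_op k' q' J u') T') <= eps / 12.
    rewrite (le_trans (ler_wpM2l (sqr_ge0 a) hJ'))// mulrA ler_pdivrMr//.
    by rewrite mulrC ler_wpM2l ?(ltW e12)// lerDl.
  have hG' : rinner mu (diff w (fun x => a * T' x + T x)) (diff w (fun x => a * T' x + T x)) <= eps / 6.
    exact: hG.
  rewrite sqrrN expr1n in h2; apply: (le_trans h2).
  clear - h1 h3 hJ hG' e0.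
  move: h1 h3 hJ hG'; do 4 move: (rinner _ _ _) => ?.
  by lra.
- exact: L2_lin.
Unshelve. all: by end_near. Qed.

(** * Back to the complex symbol *)

Lemma Delta_spec u : dom_Delta D e mu u ->
  continuous (Delta D e mu u) /\ weak_laplacian D e mu u (Delta D e mu u).
Proof. by move=> hu; exact: (@xgetPex _ _ [set f | continuous f /\ weak_laplacian D e mu u f] hu). Qed.

Lemma iter_euler_jet (g : R -> R[i]) : (forall i l, 0 < l -> cderivable (iter i (@euler R) g) l) ->
  euler_jet (fun i l => complex.Re (iter i (@euler R) g l)) /\
  euler_jet (fun i l => complex.Im (iter i (@euler R) g l)).
Proof.
move=> hg; split=> i l l0; have [hRe hIm] := hg i l l0.
  rewrite /= mulrC mulKf ?gt_eqF// derive1E.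
  exact: derivableP hRe.
rewrite /= mulrC mulKf ?gt_eqF// derive1E.
exact: derivableP hIm.
Qed.

Variables (p : X -> R -> R[i]) (hp : symbol_class D e mu d 0 p).

(** The order of the symbol is 0, so the weight is (1 + l)^0 = 1; the constants of the finitely many
    Euler derivatives are added. *)
Lemma symbol_uniform_bound j k : exists C : R, forall i x l, (i <= k)%N -> 0 < l ->
  cabs (iter i (@euler R) (fun s => iter j (cDelta D e mu) (p ^~ s) x) l) <= C.
Proof.
have /choice[C hC] : forall i, exists C : R, 0 < C /\ forall x l, 0 < l ->
    cabs (iter i (@euler R) (fun s => iter j (cDelta D e mu) (p ^~ s) x) l) <= C.
  move=> i; have [C C0 hC] := sc_bound hp j i; exists C; split => // x l l0.
  by have := hC x l l0; rewrite mul0r powRr0 mulr1.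
exists (\sum_(i < k.+1) C i) => i x l ik l0.
rewrite (le_trans ((hC i).2 x l l0))// (bigD1 (inord i))//= inordK// lerDl.
by apply: sumr_ge0 => i' _; exact: ltW (hC i').1.
Qed.

Lemma real_symbol_Re : real_symbol (fun x l => complex.Re (p x l)).
Proof.
split.
  have [C hC] := symbol_uniform_bound 1 0; exists C => l l0.
  have [/Delta_spec[cD wD] _] := sc_smooth_space hp l0 0%N.
  exists (Delta D e mu (cRe (p ^~ l))); split => // z.
  exact: le_trans (Re_le_cabs _) (hC 0%N z l (leqnn _) l0).
exists (fun x i l => complex.Re (iter i (@euler R) (p x) l)); split => //.
  move=> x; have [] // := @iter_euler_jet (p x) _.
  by move=> i l l0; exact: (sc_smooth_spectral hp 0 i x l0).
move=> k; have [C hC] := symbol_uniform_bound 0 k; exists C => x i l ik l0.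
exact: le_trans (Re_le_cabs _) (hC i x l ik l0).
Qed.

Lemma real_symbol_Im : real_symbol (fun x l => complex.Im (p x l)).
Proof.
split.
  have [C hC] := symbol_uniform_bound 1 0; exists C => l l0.
  have [_ /Delta_spec[cD wD]] := sc_smooth_space hp l0 0%N.
  exists (Delta D e mu (cIm (p ^~ l))); split => // z.
  exact: le_trans (Im_le_cabs _) (hC 0%N z l (leqnn _) l0).
exists (fun x i l => complex.Im (iter i (@euler R) (p x) l)); split => //.
  move=> x; have [] // := @iter_euler_jet (p x) _.
  by move=> i l l0; exact: (sc_smooth_spectral hp 0 i x l0).
move=> k; have [C hC] := symbol_uniform_bound 0 k; exists C => x i l ik l0.
exact: le_trans (Im_le_cabs _) (hC i x l ik l0).
Qed.

Lemma eigenspan_banded (v : X -> R[i]) : eigenspan D e mu v ->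
  exists n, banded n (cRe v) /\ banded n (cIm v).
Proof.
move=> [k [c [l [f [hf ->]]]]].
have /choice[n hn] : forall a : 'I_k, exists n, banded n (f a).
  by move=> a; exact: (banded_eigen (hf a)).
exists (\max_(a < k) n a)%N.
have hN (a : 'I_k) : banded (\max_(a < k) n a)%N (f a).
  by apply: (banded_le) (hn a); exact: leq_bigmax.
have comb (s : seq 'I_k) (b : 'I_k -> R) :
    banded (\max_(a < k) n a)%N (fun x => \sum_(a <- s) b a * f a x).
  elim: s => [|a s ih].
    by have := banded0 (\max_(a < k) n a)%N; congr banded; apply/funext => x; rewrite big_nil.
  have := banded_lin (b a) (hN a) ih; congr banded.
  by apply/funext => x; rewrite big_cons.
split.
  have := comb (index_enum 'I_k) (fun a : 'I_k => complex.Re (c a)); congr banded.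
  by apply/funext => x; rewrite /cRe complexRe_sum; apply: eq_bigr => a _; rewrite complexReM /= mulr0 subr0.
have := comb (index_enum 'I_k) (fun a : 'I_k => complex.Im (c a)); congr banded.
by apply/funext => x; rewrite /cIm complexIm_sum; apply: eq_bigr => a _; rewrite complexImM /= mulr0 add0r.
Qed.

Lemma cintegral_mul (z : R[i]) f (u : X -> R[i]) : L2 mu f -> cL2 mu u ->
  cintegral mu (fun y => z * (f y)%:C%C * u y) =
  z * (rinner mu f (cRe u) +i* rinner mu f (cIm u))%C.
Proof.
move=> Lf [Lr Li]; have ir := L2_integrable_mul Lf Lr; have ii := L2_integrable_mul Lf Li.
have lin (a b : R) : \int[mu]_y (a * (f y * cRe u y) + b * (f y * cIm u y)) =
    a * rinner mu f (cRe u) + b * rinner mu f (cIm u).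
  rewrite RintegralD//.
  - by rewrite !RintegralZl.
  - by have := integrableZl measurableT a ir.
  - by have := integrableZl measurableT b ii.
rewrite /cintegral; case: z => a b /=; apply/eqP; rewrite eq_complex /=; apply/andP; split; apply/eqP.
  rewrite -mulNr -lin; apply: eq_Rintegral => y _.
  rewrite [LHS](_ : _ = complex.Re ((a +i* b)%C * (f y)%:C%C * u y))//.
  by rewrite !complexReM !complexImM /= /cRe /cIm; ring.
rewrite addrC -lin; apply: eq_Rintegral => y _.
rewrite [LHS](_ : _ = complex.Im ((a +i* b)%C * (f y)%:C%C * u y))//.
by rewrite !complexImM !complexReM /= /cRe /cIm; ring.
Qed.

(** The sum over the positive spectrum reduces to [sp n], because for any other l the product of
    P(x, .) with a function in band n is 0. *)
Lemma symbol_opE n (v : X -> R[i]) : banded n (cRe v) -> banded n (cIm v) ->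
  let q1 := cutoff (fun x l => complex.Re (p x l)) (cst 1) in
  let q2 := cutoff (fun x l => complex.Im (p x l)) (cst 1) in
  cRe (symbol_op mu (spectrum D e mu) P p v) =
    (fun x => -1 * mult q2 n (cIm v) x + mult q1 n (cRe v) x) /\
  cIm (symbol_op mu (spectrum D e mu) P p v) =
    (fun x => 1 * mult q2 n (cRe v) x + mult q1 n (cIm v) x).
Proof.
move=> br bi q1 q2.
have cv : cL2 mu v.
  by split; apply: (continuous_L2 es); [exact: banded_continuous br|exact: banded_continuous bi].
have E x : symbol_op mu (spectrum D e mu) P p v x = \sum_(l <- sp n)
    (if 0 < l then p x l * (rinner mu (P l x) (cRe v) +i* rinner mu (P l x) (cIm v))%C else 0).
  rewrite /symbol_op (fsbigE [seq l <- sp n | 0 < l]).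
  - rewrite -big_filter.
    rewrite (_ : [seq i <- [seq l <- sp n | 0 < l] | i \in spectrum D e mu `&` [set l | 0 < l]] =
      [seq l <- sp n | 0 < l]).
      rewrite big_filter big_mkcond/= big_seq [RHS]big_seq; apply: eq_bigr => l ln.
      by case: ifPn => // l0; rewrite cintegral_mul//; exact: (kernel_L2 es (hP (sp_spectrum ln))).
    apply/all_filterP/allP => l; rewrite mem_filter => /andP[l0 ln].
    by rewrite inE; split => //; exact: sp_spectrum ln.
  - by rewrite filter_uniq// sp_uniq.
  - by move=> l /=; rewrite mem_filter => /andP[l0 ln]; split => //; exact: sp_spectrum ln.
  move=> l [Ll l0]; rewrite mem_filter l0/= => ln.
  rewrite cintegral_mul//; last exact: (kernel_L2 es (hP Ll)).
  case: br => c hc ->; case: bi => c' hc' ->.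
  rewrite !(rinner_band)// (negbTE ln).
  by rewrite (_ : (0 +i* 0)%C = 0) ?mulr0.
split; apply/funext => x.
  rewrite -[LHS]/(complex.Re _) E complexRe_sum /mult mulr_sumr -big_split/=; apply: eq_bigr => l _.
  by rewrite /q1 /q2 /cutoff; case: ifPn => l0; rewrite ?complexReM /=; ring.
rewrite -[LHS]/(complex.Im _) E complexIm_sum /mult mulr_sumr -big_split/=; apply: eq_bigr => l _.
by rewrite /q1 /q2 /cutoff; case: ifPn => l0; rewrite ?complexImM /=; ring.
Qed.

Let q1 x l := complex.Re (p x l).
Let q2 x l := complex.Im (p x l).

Lemma given_by_symbol_kernel k1 k2 C1 C2 : 0 <= C1 -> 0 <= C2 ->
  off_diagonal_approx k1 q1 C1 -> off_diagonal_approx k2 q2 C2 ->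
  given_by_kernel mu (symbol_op_L2 D e mu P p)
   (fun x y => (symbol_kernel k1 q1 x y +i* symbol_kernel k2 q2 x y)%C).
Proof.
move=> C10 C20 h1 h2 u w [Lu Lw [v ev [vu vw]]].
have r1 := real_symbol_Re; have r2 := real_symbol_Im.
have /choice[n hn] := fun k => eigenspan_banded (ev k).
have br k := (hn k).1; have bi k := (hn k).2.
have cv k : cL2 mu (v k).
  split; apply: (continuous_L2 es);
    [exact: banded_continuous (br k)|exact: banded_continuous (bi k)].
have TE k := symbol_opE (br k) (bi k).
have Lc q0 (i : nat) z : real_symbol q0 -> banded i z ->
    L2 mu (mult (cutoff q0 (cst 1)) i z).
  move=> hq0 bz; apply: (mult_cutoff_L2 hq0) bz => l _.
  by rewrite normr1.
have LT k : cL2 mu (symbol_op mu (spectrum D e mu) P p (v k)).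
  by split; [rewrite (TE k).1|rewrite (TE k).2]; apply: L2_lin; exact: Lc.
have [vur vui] := cL2_cvg_ReIm cv Lu vu.
have [Tr Ti] := cL2_cvg_ReIm LT Lw vw.
have blr : band_limit (fun k => cRe (v k)) (cRe u).
  by split; [case: Lu|move=> k; exists (n k); exact: br|exact: vur].
have bli : band_limit (fun k => cIm (v k)) (cIm u).
  by split; [case: Lu|move=> k; exists (n k); exact: bi|exact: vui].
have oO := supp_open mu u.
have vanish x : (~` supp mu u) x -> _ := @vanishes_near_supp _ _ mu u x.
pose m (q : X -> R -> R) (f : nat -> X -> R) k := mult (cutoff q (cst 1)) (n k) (f k).
have rinner_subC (f g : X -> R) : rinner mu (fun x => -1 * f x + g x) (fun x => -1 * f x + g x) =
    rinner mu (fun x => -1 * g x + f x) (fun x => -1 * g x + f x).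
  by apply: eq_Rintegral => x _; ring.
have cG1 : let G k x := -1 * m q2 (fun k => cIm (v k)) k x + m q1 (fun k => cRe (v k)) k x in
    rinner mu (fun x => -1 * G k x + cRe w x) (fun x => -1 * G k x + cRe w x) @[k --> \oo] --> (0 : R).
  move=> G; pose T k := cRe (symbol_op mu (spectrum D e mu) P p (v k)).
  rewrite [X in X @ _](_ : _ = fun k => rinner mu (fun x => -1 * cRe w x + T k x)
    (fun x => -1 * cRe w x + T k x)); first exact: Tr.
  by apply/funext => k; rewrite rinner_subC /T (TE k).1.
have cG2 : let G k x := 1 * m q2 (fun k => cRe (v k)) k x + m q1 (fun k => cIm (v k)) k x in
    rinner mu (fun x => -1 * G k x + cIm w x) (fun x => -1 * G k x + cIm w x) @[k --> \oo] --> (0 : R).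
  move=> G; pose T k := cIm (symbol_op mu (spectrum D e mu) P p (v k)).
  rewrite [X in X @ _](_ : _ = fun k => rinner mu (fun x => -1 * cIm w x + T k x)
    (fun x => -1 * cIm w x + T k x)); first exact: Ti.
  by apply/funext => k; rewrite rinner_subC /T (TE k).2.
have [i1 n1] := kernel_off_support (a := -1) r1 C10 h1 r2 C20 h2
  blr br bli bi Lw.1 cG1 oO vanish.
have [i2 n2] := kernel_off_support (a := 1) r1 C10 h1 r2 C20 h2
  bli bi blr br Lw.2 cG2 oO (fun x Ox => conj (vanish x Ox).2 (vanish x Ox).1).
apply: negligibleS (negligibleU n1 n2) => x /= nx.
have Ox : (~` supp mu u) x by move=> sx; apply: nx.
apply: contrapT => /not_orP[/not_andP/= wr /not_andP/= wi]; apply: nx => _.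
have {}wr : cRe w x = -1 * rinner mu (symbol_kernel k2 q2 x) (cIm u) +
    rinner mu (symbol_kernel k1 q1 x) (cRe u) by case: wr => // /contrapT.
have {}wi : cIm w x = 1 * rinner mu (symbol_kernel k2 q2 x) (cRe u) +
    rinner mu (symbol_kernel k1 q1 x) (cIm u) by case: wi => // /contrapT.
have [ir1 ii2] := i1 x Ox; have [ii1 ir2] := i2 x Ox.
rewrite (cintegral_kernel ir1 ii1 ir2 ii2) -wr -wi /cRe /cIm.
by case: (w x).
Qed.

End spectral_multipliers.

Theorem theorem9p5 (R : realType)
  (* the nested fractal K0, its energy and its measure *)
  (n M : nat) (F : 'I_M -> 'rV[R]_n -> 'rV[R]_n) (K0 : set 'rV[R]_n)
  (hK0 : nested_fractal F K0)
  (r : 'I_M -> R) (D0 : set ('rV[R]_n -> R))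
  (e0 : ('rV[R]_n -> R) -> ('rV[R]_n -> R) -> R)
  (he0 : self_similar_energy F K0 r D0 e0)
  (w : 'I_M -> R) (mu0 : probability (borel 'rV[R]_n) R)
  (hmu0 : self_similar_measure F K0 w mu0)
  (* the fractafold X, its energy (D, e), measure mu and resistance metric *)
  (X : ptopologicalType) (N : nat) (phi : 'I_N -> 'rV[R]_n -> X)
  (hX : compact_fractafold F K0 phi)
  (mu : {measure set (borel X) -> \bar R})
  (hmu : fractafold_measure phi K0 mu0 mu) :
  let D := fractafold_dom phi D0 in
  let e := fractafold_energy phi e0 in
  let rho := resistance D e in
  forall
  (hdoubling : doubling mu rho)
  (* spectral projections and heat kernel *)
  (P : R -> X -> X -> R)
  (hP : forall l, spectrum D e mu l -> spectral_projection_kernel D e mu l (P l))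
  (h : R[i] -> X -> X -> R[i])
  (hheat : heat_kernel (spectrum D e mu) P h)
  (hholo : forall x y, holomorphic_right_half_plane (fun z => h z x y))
  (c1 c2 d gamma : R)
  (c1_gt0 : 0 < c1) (c2_gt0 : 0 < c2) (d_gt0 : 0 < d) (gamma_gt0 : 0 < gamma)
  (hest : heat_kernel_estimate rho (P 0) h c1 c2 d gamma)
  (* the symbol *)
  (p : X -> R -> R[i]) (hp : symbol_class D e mu d 0 p),
  exists K : X -> X -> R[i],
    [/\ given_by_kernel mu (symbol_op_L2 D e mu P p) K,
        continuous_off_diagonal K
      & exists C : R, forall x y : X, x <> y ->
          cabs (K x y) <= C * (rho x y) `^ (- d)].

Proof.
move=> D e rho _ P hP h hheat _ c1 c2 d gamma c1_gt0 c2_gt0 d_gt0 gamma_gt0 hest p hp.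
have es : energy_space D e mu := fractafold_energy_space hK0 he0 hmu0 hX hmu.
(* The flatness order k is fixed before the symbol, so the real and imaginary parts use the same
   filter. *)
have [k hk] := symbol_kernel_bound es hP hheat c1_gt0 c2_gt0 d_gt0 gamma_gt0 hest.
have r1 := real_symbol_Re hp; have r2 := real_symbol_Im hp.
have [C1 C10 h1] := hk _ r1; have [C2 C20 h2] := hk _ r2.
pose K1 := symbol_kernel mu D e P k (fun x l => complex.Re (p x l)).
pose K2 := symbol_kernel mu D e P k (fun x l => complex.Im (p x l)).
exists (fun x y => (K1 x y +i* K2 x y)%C); split.
- exact: (given_by_symbol_kernel es hP hheat c1_gt0 c2_gt0 d_gt0 hest hp C10 C20 h1 h2).
- move=> z zne; apply: cvg_complex.
    apply: (symbol_kernel_continuous es hP hheat c1_gt0 c2_gt0 d_gt0 hest r1 _ C10) => //.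
    by move=> x y /h1[].
  apply: (symbol_kernel_continuous es hP hheat c1_gt0 c2_gt0 d_gt0 hest r2 _ C20) => //.
  by move=> x y /h2[].
exists (C1 + C2) => x y xy; rewrite (le_trans (cabs_le_ReIm _))// mulrDl.
by apply: lerD; [case: (h1 x y xy)|case: (h2 x y xy)].
Qed.
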